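(* Let $m\ge 1$. A map $u\in\dot H^{1/2}(\mathbb{R},S^{m-1})$ is a weak $1/2$-harmonic map into $S^{m-1}$ if and only if it satisfies (in the sense of distributions on $\mathbb{R}$) the equation $$\Delta^{1/4}\big(u\wedge\Delta^{1/4}u\big)=T(u\wedge,u),$$ where $T(Q,u):=\Delta^{1/4}(Q\,\Delta^{1/4}u)-Q\,\Delta^{1/2}u+\Delta^{1/4}u\,\Delta^{1/4}Q$, taken here with $Q=u\wedge$.
   Context: $\widehat{\Delta^{s}u}(\xi)=|\xi|^{2s}\hat u(\xi)$, i.e. $\Delta^{1/4}$ has symbol $|\xi|^{1/2}$ and $\Delta^{1/2}$ has symbol $|\xi|$; these operators act componentwise. $\dot H^{1/2}(\mathbb{R},\mathbb{R}^m)$ is the homogeneous Sobolev space with seminorm $\|u\|_{\dot H^{1/2}}=\||\xi|^{1/2}\hat u\|_{L^2}=\|\Delta^{1/4}u\|_{L^2}$ (equivalent to $(\int\int |u(x)-u(y)|^2/|x-y|^2\,dx\,dy)^{1/2}$), and $\dot H^{1/2}(\mathbb{R},S^{m-1})=\{u\in\dot H^{1/2}(\mathbb{R},\mathbb{R}^m): u(x)\in S^{m-1}\text{ a.e.}\}$, where $S^{m-1}$ is the unit sphere of $\mathbb{R}^m$. $L(u)=\int_{\mathbb{R}}|\Delta^{1/4}u(x)|^2dx$. Let $\pi(y)=y/|y|$ be the orthogonal projection onto $S^{m-1}$, defined in a neighbourhood of $S^{m-1}$. A map $u\in\dot H^{1/2}(\mathbb{R},S^{m-1})$ is a weak $1/2$-harmonic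 map into $S^{m-1}$ if $\frac{d}{dt}L(\pi(u+t\phi))\big|_{t=0}=0$ for every $\phi\in C_0^\infty(\mathbb{R},\mathbb{R}^m)$. $u\wedge$ denotes the matrix-valued function whose value at $x$ represents the linear map $v\mapsto u(x)\wedge v$ from $\mathbb{R}^m$ to $\bigwedge_2(\mathbb{R}^m)$ ($\wedge$ is the exterior product). In $T(Q,u)$ all products are matrix-vector products; in particular the last term is $(\Delta^{1/4}Q)(\Delta^{1/4}u)$. Thus $T(u\wedge,u)=\Delta^{1/4}(u\wedge\Delta^{1/4}u)-u\wedge\Delta^{1/2}u+\Delta^{1/4}u\wedge\Delta^{1/4}u$. *)

(* Defs.v *)
From mathcomp Require Import all_boot all_order all_algebra.
From mathcomp Require Import all_classical all_reals all_analysis.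
From mathcomp Require Import complex.

Set Implicit Arguments.
Unset Strict Implicit.
Unset Printing Implicit Defensive.

Import Order.TTheory GRing.Theory Num.Theory.
Import numFieldNormedType.Exports.

Local Open Scope classical_set_scope.
Local Open Scope ring_scope.
Local Open Scope complex_scope.

Section FractionalLaplacian.
Context {R : realType}.
Implicit Types (s : R) (f g phi psi : R -> R).

Notation mu := (@lebesgue_measure R).

Definition test_fun phi : Prop :=
  (forall n x, derivable (derive1n n phi) x 1) /\
  compact (closure [set x | phi x != 0]).

(* Distributions on R are represented by their values on real test functions;
   two of them are equal when they agree on C_c^oo(R). *)
Definition distr : Type := (R -> R) -> R.

Definition distr_eq (S T : distr) : Prop :=
  forall phi, test_fun phi -> S phi = T phi.

Definition regular_distr f : distr := fun phi => \int[mu]_x (f x * phi x).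

Definition cintegral (h : R -> R[i]) : R[i] :=
  (\int[mu]_x complex.Re (h x)) +i* (\int[mu]_x complex.Im (h x)).

Definition expi (t : R) : R[i] := cos t +i* sin t.

Definition fourier (h : R -> R[i]) (xi : R) : R[i] :=
  cintegral (fun x => expi (- (xi * x)) * h x).

Definition inv_fourier (h : R -> R[i]) (x : R) : R[i] :=
  ((2 * pi)^-1)%:C * cintegral (fun xi => expi (x * xi) * h xi).

(* The operator with symbol |xi|^(2s) on a test function.  Its values are real,
   since the symbol is real and even; Re only adjusts the type. *)
Definition frac_lap_test s phi : R -> R := fun x =>
  complex.Re (inv_fourier
    (fun xi => (`|xi| `^ (2 * s))%:C * fourier (fun y => (phi y)%:C) xi) x).

(* Multiplication of the Fourier transform by |xi|^(2s), for distributions: by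
   transposition, since <FS, psi> = <S, F psi> and the symbol is even.
   For a test function phi, frac_lap_test s phi is smooth and O(|x|^(-1-2s)) at
   infinity, so S may be the regular distribution of any function that is
   integrable against such a decay, e.g. an L^2 or a bounded function. *)
Definition frac_lap s (S : distr) : distr := fun phi => S (frac_lap_test s phi).

Definition L2 g : Prop := g \in Lfun mu 2%:E.

Definition is_lap14 f g : Prop :=
  L2 g /\ distr_eq (regular_distr g) (frac_lap (1 / 4) (regular_distr f)).

(* \Delta^{1/4} f as an L^2 function; it is determined almost everywhere, and
   only enters integrals below. *)
Definition lap14 f : R -> R := xget (cst 0) [set g | is_lap14 f g].

(* The homogeneous space \dot H^{1/2}(R).  The weight makes the pairings of f
   with \Delta^{1/4} phi = O(|x|^(-3/2)) converge; functions with a finite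
   \dot H^{1/2} seminorm have bounded mean oscillation, hence satisfy it. *)
Definition Hdot12 f : Prop :=
  [/\ measurable_fun setT f,
      mu.-integrable setT (fun x => (f x / (1 + `|x|) `^ (3 / 2))%:E) &
      exists g, is_lap14 f g].

Definition cvg_H12 (psi_ : nat -> R -> R) psi : Prop :=
  [/\ forall n, L2 (psi_ n \- psi) /\ Hdot12 (psi_ n \- psi),
      (fun n => \int[mu]_x (psi_ n x - psi x) ^+ 2) @ \oo --> (0 : R) &
      (fun n => \int[mu]_x (lap14 (psi_ n \- psi) x) ^+ 2) @ \oo --> (0 : R)].

(* The H^{-1/2} - H^{1/2} duality bracket: the extension by continuity of S
   from C_c^oo(R) to H^{1/2}(R), in which C_c^oo(R) is dense. *)
Definition H12_pairing (S : distr) psi : R :=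
  xget 0 [set c | forall psi_ : nat -> R -> R,
    (forall n, test_fun (psi_ n)) -> cvg_H12 psi_ psi ->
    (fun n => S (psi_ n)) @ \oo --> c].

(* The product q S of a bounded \dot H^{1/2} function q with a distribution S
   of class \dot H^{-1/2}, such as \Delta^{1/2} f for f in \dot H^{1/2}. *)
Definition mul_distr (q : R -> R) (S : distr) : distr := fun phi =>
  H12_pairing S (q \* phi).

End FractionalLaplacian.

Section HalfHarmonic.
Context {R : realType}.
Variable m : nat.
Implicit Types (u : R -> 'rV[R]_m) (v w : 'rV[R]_m).

Notation mu := (@lebesgue_measure R).

(* The norm that the library puts on 'rV[R]_m is the sup norm. *)
Definition enorm v : R := Num.sqrt (\sum_j v 0 j ^+ 2).

Definition vlap14 u : R -> 'rV[R]_m := fun x =>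
  \row_j lap14 (fun y => u y 0 j) x.

Definition mxlap14 k (Q : R -> 'M[R]_(m, k)) : R -> 'M[R]_(m, k) := fun x =>
  \matrix_(j, l) lap14 (fun y => Q y j l) x.

Definition Hdot12_vec u : Prop := forall j, Hdot12 (fun x => u x 0 j).

Definition Hdot12_sphere u : Prop :=
  Hdot12_vec u /\ {ae mu, forall x, enorm (u x) = 1}.

Definition energy u : R := \int[mu]_x (enorm (vlap14 u x) ^+ 2).

Definition sphere_proj v : 'rV[R]_m := (enorm v)^-1 *: v.

Definition weak_half_harmonic u : Prop :=
  Hdot12_sphere u /\
  forall phi : R -> 'rV[R]_m, (forall j, test_fun (fun x => phi x 0 j)) ->
    is_derive (0 : R) (1 : R)
      (fun t : R => energy (fun x => sphere_proj (u x + t *: phi x))) (0 : R).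

(* Exterior product, with \bigwedge_2(R^m) realised as the skew-symmetric
   matrices: entry (i, j) is the coordinate v_i w_j - v_j w_i. *)
Definition wedge v w : 'M[R]_m := v^T *m w - w^T *m v.

(* The matrix of w |-> v /\ w; as usual for row vectors, it acts by right
   multiplication, so that w *m wedge_mx v = mxvec (wedge v w). *)
Definition wedge_mx v : 'M[R]_(m, m * m) := lin1_mx (fun w => mxvec (wedge v w)).

(* The components of T(Q,u) = \Delta^{1/4}(Q \Delta^{1/4}u) - Q \Delta^{1/2}u
   + (\Delta^{1/4}Q)(\Delta^{1/4}u), with Q acting on row vectors. *)
Definition T_op k (Q : R -> 'M[R]_(m, k)) u (l : 'I_k) : @distr R := fun phi =>
  frac_lap (1 / 4) (regular_distr (fun x => (vlap14 u x *m Q x) 0 l)) phi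
  - \sum_j mul_distr (fun x => Q x j l)
      (frac_lap (1 / 2) (regular_distr (fun x => u x 0 j))) phi
  + regular_distr (fun x => (vlap14 u x *m mxlap14 Q x) 0 l) phi.

End HalfHarmonic.

(* Main.v *)
Require Import Defs.
From mathcomp Require Import all_boot all_order all_algebra.
From mathcomp Require Import all_classical all_reals all_analysis.
From mathcomp Require Import complex.
From mathcomp Require Import measurable_realfun ring lra.

(** Write [D] for the operator of symbol [|xi|^(1/2)] and
    [dq f (x, t) = (f (x + t) - f x) / t]. On test functions Fourier inversion and
    the homogeneity of [\int (1 - cos (t xi)) / |t|^(1 + a) dt] turn the symbol
    calculus into singular integrals of second differences, whence
      [\int D phi * D psi = c \int \int dq phi * dq psi]
    with an absolute constant [c] ([D_form]); the right-hand side, [gag phi psi], is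
    the Gagliardo form. Unlike [D], it is local enough in [x] to be used with
    products, and both sides of the equivalence are statements about it.

    Harmonicity. For small [t] the map [pi (u + t phi)] is
    [u + t tau + t^2 r_t], where [tau = phi - (u . phi) u] is tangential and [r_t] is
    bounded in energy because it is a Lipschitz function of [(u, phi)], uniformly in
    [t]. So the energy is differentiable at [0] with derivative
    [2 c \sum_j gag u_j tau_j] ([energy_derivative]).

    The equation. As [w |-> u /\ w] is multiplication by the matrix of [u /\], the
    left-hand side is equal to the first term of [T]. The third term is
    [v /\ v = 0] with [v] the quarter Laplacian of [u] ([last_term]). What remains is
    that the second term vanishes, and its [(i, j)] component tested with [psi] is
      [c (gag u_j (u_i psi) - gag u_i (u_j psi))]   ([bracket_wedge]).

    The two conditions agree since tangential fields are generated by the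
    infinitesimal rotations [psi (u_i e_j - u_j e_i)]: with [|u| = 1] one has
    [tau_j = \sum_i u_i (u_i phi_j - u_j phi_i)]. The fields that occur here are
    products of test functions with components of [u], hence only of finite energy,
    and both conditions are first extended from test functions to them by
    mollification ([critical_balanced]).

    Three facts of analysis make this legitimate. The relation between [u] and its
    quarter Laplacian [g] is given against [D phi] with [phi] a test function; since
    [D phi] is not a test function, an approximation of [D] by operators that
    preserve test functions is needed in order to obtain
    [\int g * D phi = c \int \int dq u * dq phi] ([lap14_transfer], [lap14_form]). A
    Caccioppoli estimate on mollifications of [u] then shows that the bounded
    function [u] has finite Gagliardo energy ([lap14_fingag]). Finally, by
    completeness of [L^2], compactly supported bounded functions of finite energy
    have a quarter Laplacian ([energy_lap14]), for which the bracket with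
    [\Delta^(1/2) u] is computed by the Gagliardo form ([bracket_form]). *)

Set Implicit Arguments.
Unset Strict Implicit.
Unset Printing Implicit Defensive.

Import Order.TTheory GRing.Theory Num.Theory.
Import numFieldNormedType.Exports.

Local Open Scope classical_set_scope.
Local Open Scope ring_scope.

(** * Real-valued integrable and square-integrable functions *)

Lemma cvg_seq_ge (R : realType) (u : nat -> R) a c : u @ \oo --> a ->
  (forall n, c <= u n) -> c <= a.
Proof. by move=> cu h; apply: (cvgr_to_ge cu); exact: nearW. Qed.

Lemma cvg_seq_le (R : realType) (u : nat -> R) a c : u @ \oo --> a ->
  (forall n, u n <= c) -> a <= c.
Proof. by move=> cu h; apply: (cvgr_to_le cu); exact: nearW. Qed.

Section Integrable.
Context d (T : measurableType d) (R : realType).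
Context (m : {measure set T -> \bar R}).
Implicit Types f g h : T -> R.

(** Real-valued integrability on the whole space, so that integrals can be computed
    in [R] instead of the extended reals. *)
Definition intg f : Prop := m.-integrable setT (EFin \o f).

Lemma intg_meas f : intg f -> measurable_fun setT f.
Proof. by move=> /integrableP[/measurable_EFinP]. Qed.

Lemma intg_le f g : measurable_fun setT f -> intg g ->
  (forall x, `|f x| <= g x) -> intg f.
Proof.
move=> mf ig fg; apply: (le_integrable measurableT _ _ ig).
  exact/measurable_EFinP.
by move=> x _ /=; rewrite lee_fin (le_trans (fg x))// ler_norm.
Qed.

Lemma intgD f g : intg f -> intg g -> intg (fun x => f x + g x).
Proof. by move=> hf hg; have := integrableD measurableT hf hg. Qed.

Lemma intgB f g : intg f -> intg g -> intg (fun x => f x - g x).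
Proof. by move=> hf hg; have := integrableB measurableT hf hg. Qed.

Lemma intgZ c f : intg f -> intg (fun x => c * f x).
Proof. by move=> hf; have := integrableZl measurableT c hf. Qed.

Lemma intg0 : intg (fun=> 0).
Proof. exact: integrable0. Qed.

Lemma intg_norm f : intg f -> intg (fun x => `|f x|).
Proof. exact: integrable_norm. Qed.

Lemma intg_normP f : measurable_fun setT f -> intg (fun x => `|f x|) -> intg f.
Proof. by move=> mf /intg_le; apply. Qed.

Lemma intg_bddM (M : R) f g : measurable_fun setT f -> intg g ->
  (forall x, `|f x| <= M) -> intg (fun x => f x * g x).
Proof.
move=> mf ig fM; apply: (@intg_le _ (fun x => M * `|g x|)).
- by apply: measurable_funM => //; exact: intg_meas.
- exact/intgZ/intg_norm.
- by move=> x; rewrite normrM ler_wpM2r.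
Qed.

Lemma IntD f g : intg f -> intg g ->
  \int[m]_x (f x + g x) = \int[m]_x f x + \int[m]_x g x.
Proof. by move=> hf hg; rewrite RintegralD. Qed.

Lemma IntB f g : intg f -> intg g ->
  \int[m]_x (f x - g x) = \int[m]_x f x - \int[m]_x g x.
Proof. by move=> hf hg; rewrite RintegralB. Qed.

Lemma IntZ c f : intg f -> \int[m]_x (c * f x) = c * \int[m]_x f x.
Proof. by move=> hf; rewrite RintegralZl. Qed.

Lemma Int0 : \int[m]_x (0 : R) = 0.
Proof. by rewrite /Rintegral integral0. Qed.

Lemma Int_le f g : intg f -> intg g -> (forall x, f x <= g x) ->
  \int[m]_x f x <= \int[m]_x g x.
Proof. by move=> hf hg fg; apply: le_Rintegral. Qed.

Lemma Int_ge0 f : (forall x, 0 <= f x) -> 0 <= \int[m]_x f x.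
Proof. by move=> f0; apply: Rintegral_ge0. Qed.

Lemma Int_abs f g : intg f -> intg g -> (forall x, `|f x| <= g x) ->
  `|\int[m]_x f x| <= \int[m]_x g x.
Proof.
move=> hf hg fg; apply: le_trans (le_normr_Rintegral _ hf) _ => //.
by apply: Int_le => //; exact: intg_norm.
Qed.

Lemma Int_EFin f : intg f -> (\int[m]_x (f x)%:E)%E = (\int[m]_x f x)%:E.
Proof.
by move=> hf; rewrite /Rintegral fineK//; exact: integrable_fin_num.
Qed.

Lemma intg_sum (I : Type) (s : seq I) (f : I -> T -> R) :
  (forall i, intg (f i)) -> intg (fun x => \sum_(i <- s) f i x).
Proof.
move=> hf; elim: s => [|a s ih].
  by under eq_fun do rewrite big_nil; exact: intg0.
by under eq_fun do rewrite big_cons; exact: intgD.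
Qed.

Lemma Int_sum (I : Type) (s : seq I) (f : I -> T -> R) :
  (forall i, intg (f i)) ->
  \int[m]_x (\sum_(i <- s) f i x) = \sum_(i <- s) \int[m]_x f i x.
Proof.
move=> hf; elim: s => [|a s ih].
  by under eq_fun do rewrite big_nil; rewrite Int0 big_nil.
under eq_fun do rewrite big_cons; rewrite IntD ?ih ?big_cons//.
exact: intg_sum.
Qed.

Lemma Int_ae f g : measurable_fun setT f -> measurable_fun setT g ->
  {ae m, forall x, f x = g x} -> \int[m]_x f x = \int[m]_x g x.
Proof.
move=> mf mg fg; congr fine; apply: ae_eq_integral => //.
- exact/measurable_EFinP.
- exact/measurable_EFinP.
- by apply: filterS fg => x /= -> _.
Qed.

Lemma intg_ae f g : measurable_fun setT f -> measurable_fun setT g ->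
  {ae m, forall x, f x = g x} -> intg f -> intg g.
Proof.
move=> mf mg fg ig; apply: intg_normP => //.
apply/integrableP; split; first exact/measurable_EFinP/measurableT_comp.
case/integrableP : ig => _; congr (_ < _)%E; apply: ae_eq_integral => //.
- by apply/measurable_EFinP/measurableT_comp.
- by apply: measurableT_comp => //; exact/measurable_EFinP/measurableT_comp.
- by apply: filterS fg => x /= -> _; rewrite normr_id.
Qed.

Lemma dct (f_ : nat -> T -> R) f g : (forall n, measurable_fun setT (f_ n)) ->
  measurable_fun setT f -> {ae m, forall x, f_ ^~ x @ \oo --> f x} ->
  intg g -> (forall n x, `|f_ n x| <= g x) ->
  intg f /\ (fun n => \int[m]_x f_ n x) @ \oo --> \int[m]_x f x.
Proof.
move=> mf_ mf cf ig fg.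
have [|||||i1 _ c] := @dominated_convergence _ _ _ m setT measurableT
  (fun n x => (f_ n x)%:E) (EFin \o f) (EFin \o g).
- by move=> n; exact/measurable_EFinP.
- exact/measurable_EFinP.
- by apply: filterS cf => x cx _; apply/cvg_EFin => //; exact: nearW.
- exact: ig.
- by apply: aeW => x n _ /=; rewrite lee_fin.
split=> //; apply: fine_cvg.
by move: c; rewrite /= Int_EFin// /Rintegral.
Qed.

(** Fatou's lemma, in the form of a criterion for integrability. *)
Lemma fatou_intg (f_ : nat -> T -> R) f C : (forall n, intg (f_ n)) ->
  (forall n x, 0 <= f_ n x) -> (forall n, \int[m]_x f_ n x <= C) ->
  measurable_fun setT f -> {ae m, forall x, f_ ^~ x @ \oo --> f x} ->
  intg f /\ \int[m]_x f x <= C.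
Proof.
move=> if_ f0 fC mf cf.
have key : (\int[m]_x `|f x|%:E <= C%:E)%E.
  have mf_ n : measurable_fun setT (fun x => (f_ n x)%:E).
    exact/measurable_EFinP/intg_meas.
  have h := @fatou _ _ _ m _ measurableT (fun n x => (f_ n x)%:E)
    mf_ (fun n x _ => f0 n x).
  have -> : (\int[m]_x `|f x|%:E = \int[m]_x limn_einf (fun n => (f_ n x)%:E))%E;
    last first.
  - apply: le_trans h _.
    rewrite limn_einf_lim; apply: lime_le; first exact: is_cvg_einfs.
    apply: nearW => n; apply: ereal_inf_le; exists ((\int[m]_x f_ n x)%:E).
      by rewrite /= /sdrop /=; exists n => //=; rewrite Int_EFin.
    by rewrite lee_fin.
  - apply: ae_eq_integral => //.
    + by apply/measurable_EFinP; apply: measurableT_comp.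
    + rewrite (_ : (fun _ => _) =
          fun x => (- limn_esup (fun n => - (f_ n x)%:E))%E).
        apply: measurableT_comp => //; apply: measurable_fun_limn_esup => n.
        by apply: measurableT_comp.
      by apply/funext => x; rewrite -limn_einfN; congr limn_einf;
        apply/funext => n /=; rewrite ?oppeK ?opprK.
    apply: filterS cf => x cx _.
    have cx' : (fun n => (f_ n x)%:E) @ \oo --> (f x)%:E.
      by apply/cvg_EFin => //; exact: nearW.
    rewrite ger0_norm; last by apply: cvg_seq_ge cx _.
    by have [+ _] := cvg_limn_einf_sup cx'.
have if' : intg f.
  apply/integrableP; split; first exact/measurable_EFinP.
  by rewrite (le_lt_trans key)// ltry.
split => //; rewrite -lee_fin -Int_EFin//; apply: le_trans key.
apply: le_integral => //; first exact: intg_norm.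
by move=> x _; rewrite lee_fin ler_norm.
Qed.

Definition sqi f : Prop := measurable_fun setT f /\ intg (fun x => f x ^+ 2).

Lemma sqi_mul f g : sqi f -> sqi g -> intg (fun x => f x * g x).
Proof.
move=> [mf if_] [mg ig]; apply: (intg_le _ (intgD if_ ig)).
  exact: measurable_funM.
move=> x; rewrite normrM.
have : 0 <= (`|f x| - `|g x|) ^+ 2 by rewrite sqr_ge0.
rewrite -(real_normK (num_real (f x))) -(real_normK (num_real (g x))).
by have := normr_ge0 (f x); have := normr_ge0 (g x); nra.
Qed.

Lemma sqiD f g : sqi f -> sqi g -> sqi (fun x => f x + g x).
Proof.
move=> hf hg; split; first by apply: measurable_funD; [case: hf|case: hg].
have := intgD (intgD hf.2 hg.2) (intgZ 2 (sqi_mul hf hg)).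
by congr intg; apply/funext => x; ring.
Qed.

Lemma sqiZ c f : sqi f -> sqi (fun x => c * f x).
Proof.
move=> [mf hf]; split; first exact: measurable_funM.
by have := intgZ (c ^+ 2) hf; congr intg; apply/funext => x; rewrite exprMn.
Qed.

Lemma sqiB f g : sqi f -> sqi g -> sqi (fun x => f x - g x).
Proof.
move=> hf /(sqiZ (-1)) /(sqiD hf); congr sqi.
by apply/funext => x; rewrite mulN1r.
Qed.

Lemma sqi0 : sqi (fun=> 0).
Proof.
by split=> //; have := intg0; congr intg; apply/funext => x; rewrite expr0n.
Qed.

Lemma sqi_sum (I : Type) (s : seq I) (f : I -> T -> R) :
  (forall i, sqi (f i)) -> sqi (fun x => \sum_(i <- s) f i x).
Proof.
move=> hf; elim: s => [|a s ih].
  by under eq_fun do rewrite big_nil; exact: sqi0.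
by under eq_fun do rewrite big_cons; exact: sqiD.
Qed.

Lemma sqi_ae f g : measurable_fun setT g -> {ae m, forall x, f x = g x} ->
  sqi f -> sqi g.
Proof.
move=> mg fg [mf hf]; split => //; apply: intg_ae hf => //.
- exact: measurable_funX.
- exact: measurable_funX.
- by apply: filterS fg => x ->.
Qed.

Lemma cauchy_schwarz f g : sqi f -> sqi g ->
  (\int[m]_x (f x * g x)) ^+ 2 <= \int[m]_x (f x ^+ 2) * \int[m]_x (g x ^+ 2).
Proof.
move=> hf hg; set a := \int[m]_x (f x ^+ 2); set c := \int[m]_x (g x ^+ 2).
set b := \int[m]_x (f x * g x).
have pos s : 0 <= a + 2 * s * b + s ^+ 2 * c.
  have : 0 <= \int[m]_x ((f x + s * g x) ^+ 2).
    by apply: Int_ge0 => x; exact: sqr_ge0.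
  have -> : \int[m]_x ((f x + s * g x) ^+ 2) =
      \int[m]_x (f x ^+ 2 + 2 * s * (f x * g x) + s ^+ 2 * (g x ^+ 2)).
    by congr Rintegral; apply/funext => x; ring.
  have i1 := intgZ (2 * s) (sqi_mul hf hg); have i2 := intgZ (s ^+ 2) hg.2.
  rewrite IntD//; last by apply: intgD => //; case: hf.
  rewrite IntD//; last by case: hf.
  by rewrite IntZ//; [rewrite IntZ//; case: hg|exact: sqi_mul].
have c0 : 0 <= c by apply: Int_ge0 => x; exact: sqr_ge0.
have [c00|cn] := eqVneq c 0.
  have [->|b0] := eqVneq b 0; first by rewrite c00 mulr0 expr0n.
  (* The quadratic polynomial degenerates to an affine function taking the value -1. *)
  have := pos (- (a + 1) / (2 * b)); rewrite c00 mulr0 addr0.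
  have -> : 2 * (- (a + 1) / (2 * b)) * b = - (a + 1) by field.
  by lra.
have cp : 0 < c by rewrite lt0r cn.
(* The minimum of the quadratic polynomial. *)
have := pos (- b / c).
have -> : a + 2 * (- b / c) * b + (- b / c) ^+ 2 * c = (a * c - b ^+ 2) / c.
  by field.
by rewrite pmulr_lge0 ?invr_gt0// subr_ge0.
Qed.

Lemma cvg_sqr0 (u : nat -> R) (v : nat -> R) : (forall n, u n ^+ 2 <= v n) ->
  v @ \oo --> 0 -> u @ \oo --> 0.
Proof.
move=> uv v0; apply: norm_cvg0.
have h : (fun n => Num.sqrt (v n)) @ \oo --> (0 : R).
  by rewrite -[X in _ --> X]sqrtr0; apply: continuous_cvg => //; exact: sqrt_continuous.
apply: (@squeeze_cvgr _ _ _ _ (cst 0) _ _ _ _ _ h); last exact: cvg_cst.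
apply: nearW => n /=; rewrite normr_ge0/= -sqrtr_sqr ler_wsqrtr//.
Qed.

(** Strong convergence implies weak convergence. *)
Lemma sqi_cvg_ip g (h_ : nat -> T -> R) h : sqi g -> (forall n, sqi (h_ n)) ->
  sqi h -> (fun n => \int[m]_x ((h_ n x - h x) ^+ 2)) @ \oo --> 0 ->
  (fun n => \int[m]_x (g x * h_ n x)) @ \oo --> \int[m]_x (g x * h x).
Proof.
move=> hg hh_ hh c0; apply/subr_cvg0.
apply: (@cvg_sqr0 _ (fun n => \int[m]_x (g x ^+ 2) * \int[m]_x ((h_ n x - h x) ^+ 2))).
  move=> n; apply: le_trans (cauchy_schwarz hg (sqiB (hh_ n) hh)).
  rewrite le_eqVlt; apply/orP; left; apply/eqP; congr (_ ^+ 2).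
  rewrite /= -IntB//; [|exact: sqi_mul|exact: sqi_mul].
  by congr Rintegral; apply/funext => x; ring.
by rewrite -[X in _ --> X](mulr0 (\int[m]_x (g x ^+ 2))); apply: cvgMr.
Qed.

Lemma sqr_normB f g : sqi f -> sqi g -> \int[m]_x ((f x - g x) ^+ 2) =
  \int[m]_x (f x ^+ 2) - 2 * \int[m]_x (f x * g x) + \int[m]_x (g x ^+ 2).
Proof.
move=> hf hg; rewrite -IntZ; last exact: sqi_mul.
rewrite -IntB; [|exact: hf.2|exact/intgZ/sqi_mul].
rewrite -IntD; [|apply: intgB; [exact: hf.2|exact/intgZ/sqi_mul]|exact: hg.2].
by congr Rintegral; apply/funext => x; ring.
Qed.

Lemma sqr_normD f g : sqi f -> sqi g -> \int[m]_x ((f x + g x) ^+ 2) =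
  \int[m]_x (f x ^+ 2) + 2 * \int[m]_x (f x * g x) + \int[m]_x (g x ^+ 2).
Proof.
move=> hf hg; rewrite -IntZ; last exact: sqi_mul.
rewrite -IntD; [|exact: hf.2|exact/intgZ/sqi_mul].
rewrite -IntD; [|apply: intgD; [exact: hf.2|exact/intgZ/sqi_mul]|exact: hg.2].
by congr Rintegral; apply/funext => x; ring.
Qed.

(** Almost everywhere convergence without gain of norm is strong convergence:
    [4 h^2] is the pointwise limit of [2 h_n^2 + 2 h^2 - (h_n - h)^2 >= 0], and
    cutting the latter at [4 h^2] makes dominated convergence available. *)
Lemma ae_cvg_strong (h_ : nat -> T -> R) h : (forall n, sqi (h_ n)) -> sqi h ->
  (forall n, \int[m]_x (h_ n x ^+ 2) <= \int[m]_x (h x ^+ 2)) ->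
  {ae m, forall x, h_ ^~ x @ \oo --> h x} ->
  (fun n => \int[m]_x ((h_ n x - h x) ^+ 2)) @ \oo --> 0.
Proof.
move=> hh_ hh le_h ch.
pose F n x := 2 * h_ n x ^+ 2 + 2 * h x ^+ 2 - (h_ n x - h x) ^+ 2.
have FE n x : F n x = (h_ n x + h x) ^+ 2 by rewrite /F; ring.
pose G n x := Num.min (F n x) (4 * h x ^+ 2).
have mF n : measurable_fun setT (F n).
  by rewrite (_ : F n = fun x => (h_ n x + h x) ^+ 2);
    [exact: measurable_funX _ (sqiD (hh_ n) hh).1|exact/funext].
have i4 : intg (fun x => 4 * h x ^+ 2) := intgZ 4 hh.2.
have mG n : measurable_fun setT (G n).
  by apply: measurable_minr => //; exact: intg_meas.
have Gle n x : `|G n x| <= 4 * h x ^+ 2.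
  rewrite ger0_norm; first by rewrite /G ge_min lexx orbT.
  by rewrite /G le_min FE sqr_ge0/= mulr_ge0// sqr_ge0.
have cG : {ae m, forall x, G ^~ x @ \oo --> 4 * h x ^+ 2}.
  apply: filterS ch => x cx.
  have cF : F ^~ x @ \oo --> 4 * h x ^+ 2.
    rewrite (_ : F ^~ x = fun n => (h_ n x + h x) * (h_ n x + h x)); last first.
      by apply/funext => n; rewrite FE expr2.
    rewrite (_ : 4 * h x ^+ 2 = (h x + h x) * (h x + h x)); last by ring.
    by apply: cvgM; apply: cvgD => //; exact: cvg_cst.
  have -> : G ^~ x = fun n => (F n x + 4 * h x ^+ 2 - `|F n x - 4 * h x ^+ 2|) / 2.
    by apply/funext => n; rewrite -minr_absE.
  rewrite [X in _ --> X](_ : _ =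
      (4 * h x ^+ 2 + 4 * h x ^+ 2 - `|4 * h x ^+ 2 - 4 * h x ^+ 2|) / 2);
    last by rewrite subrr normr0; field.
  apply: cvgMl; apply: cvgB; first by apply: cvgD => //; exact: cvg_cst.
  by apply: cvg_norm; apply: cvgB => //; exact: cvg_cst.
have [_ cI] := dct mG (intg_meas i4) cG i4 Gle.
have iG n : intg (G n) by apply: intg_le i4 _.
have bnd n : \int[m]_x ((h_ n x - h x) ^+ 2) <=
    4 * \int[m]_x (h x ^+ 2) - \int[m]_x (G n x).
  have i1 := (sqiB (hh_ n) hh).2; have i2 := (sqiD (hh_ n) hh).2.
  have : \int[m]_x (G n x) <= \int[m]_x ((h_ n x + h x) ^+ 2).
    by apply: Int_le => // x; rewrite /G ge_min FE lexx.
  rewrite (sqr_normD (hh_ n) hh) (sqr_normB (hh_ n) hh).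
  by have := le_h n; lra.
have c1 : (fun n => 4 * \int[m]_x (h x ^+ 2) - \int[m]_x (G n x)) @ \oo --> (0 : R).
  rewrite -[X in _ --> X](subrr (4 * \int[m]_x (h x ^+ 2))).
  apply: cvgB; first exact: cvg_cst.
  by move: cI; rewrite IntZ//; case: hh.
apply: (@squeeze_cvgr _ _ _ _ (cst 0) _ _ _ _ _ c1); last exact: cvg_cst.
by apply: nearW => n /=; rewrite bnd andbT; apply: Int_ge0 => x; exact: sqr_ge0.
Qed.

End Integrable.

(** With [e k] the tail of the geometric series, [u - e] is nondecreasing and [u + e]
    is nonincreasing, so that monotone convergence applies. *)
Lemma geometric_cvg (R : realType) (u : nat -> R) C :
  (forall k, `|u k.+1 - u k| <= C / 2 ^+ k) -> cvgn u.
Proof.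
move=> hu.
pose e k := 2 * C / 2 ^+ k : R.
have C0 : 0 <= C by have := hu 0%N; rewrite expr0 divr1; exact: le_trans.
have e0 k : 0 <= e k by rewrite /e divr_ge0// ?mulr_ge0// exprn_ge0.
have eS k : e k - e k.+1 = C / 2 ^+ k.
  by rewrite /e exprS; field; rewrite expf_neq0.
have hb k := hu k; have {}hb k : u k - C / 2 ^+ k <= u k.+1 <= u k + C / 2 ^+ k.
  by have := hb k; rewrite ler_norml => /andP[]; lra.
have nd : {homo (fun k => u k - e k) : n m / (n <= m)%N >-> n <= m}.
  by apply/nondecreasing_seqP => k; have := hb k; have := eS k; lra.
have ni : {homo (fun k => u k + e k) : n m / (n <= m)%N >-> n >= m}.
  by apply/nonincreasing_seqP => k; have := hb k; have := eS k; lra.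
have cv : cvgn (fun k => u k - e k).
  apply: nondecreasing_is_cvgn nd _; exists (u 0%N + e 0%N) => _ [k _ <-].
  by have := ni 0%N k (leq0n k); have := e0 k; lra.
have ce : e @ \oo --> (0 : R).
  have -> : e = (fun k => 2 * C * (2^-1) ^+ k) by apply/funext => k; rewrite /e exprVn.
  rewrite -[X in _ --> X](mulr0 (2 * C)); apply: cvgMr.
  by apply: cvg_expr; rewrite ger0_norm ?invr_ge0// invf_lt1// ltr1n.
have -> : u = (fun k => (u k - e k) + e k) by apply/funext => k; rewrite subrK.
by apply: is_cvgD => //; apply/cvg_ex; exists 0.
Qed.

Section RieszFischer.
Context d (T : measurableType d) (R : realType).
Context (m : {measure set T -> \bar R}).

(** Along a subsequence with rapidly decreasing gaps the weighted sum
    [\sum_k 4^k (g_(k+1) - g_k)^2] has finite integral, so that the gaps are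
    dominated by a geometric sequence at almost every point. *)
Lemma sqi_fast_cvg (g_ : nat -> T -> R) : (forall n, sqi m (g_ n)) ->
  (forall k, \int[m]_x ((g_ k.+1 x - g_ k x) ^+ 2) <= (16^-1) ^+ k) ->
  {ae m, forall x, cvgn (g_ ^~ x)}.
Proof.
move=> sg hg.
pose D k x := 4 ^+ k * (g_ k.+1 x - g_ k x) ^+ 2.
have D0 k x : 0 <= D k x by rewrite /D mulr_ge0 ?sqr_ge0// exprn_ge0.
have iD k : intg m (D k) by apply: intgZ; exact: (sqiB (sg _) (sg _)).2.
have mD k : measurable_fun setT (EFin \o D k).
  exact/measurable_EFinP/(intg_meas (iD k)).
pose h x := (\sum_(k <oo) (D k x)%:E)%E.
have hfin : (\int[m]_x h x < +oo)%E.
  rewrite /h integral_nneseries//; last by move=> *; rewrite lee_fin.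
  apply: (@le_lt_trans _ _ (\sum_(k <oo) ((4^-1) ^+ k)%:E)%E).
    apply: lee_nneseries => [k *|k *].
      by apply: integral_ge0 => x _; rewrite lee_fin.
    rewrite Int_EFin// lee_fin IntZ//; last exact: (sqiB (sg _) (sg _)).2.
    rewrite (_ : (4^-1) ^+ k = 4 ^+ k * (16^-1) ^+ k) ?ler_wpM2l ?exprn_ge0//.
    by rewrite -exprMn; congr (_ ^+ _); field.
  have -> : (\sum_(k <oo) ((4^-1) ^+ k)%:E = (4 / 3 : R)%:E)%E.
    apply/cvg_lim => //.
    have := @cvg_geometric_series R 1 (4^-1).
    rewrite ger0_norm ?invr_ge0// invf_lt1 ?ltr1n// => /(_ isT).
    rewrite (_ : 1 / (1 - 4^-1) = 4 / 3); last by field.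
    move=> hc; apply/cvg_EFin; first by apply: nearW => n; rewrite sumEFin.
    rewrite (_ : fine \o _ = series (geometric 1 (4^-1 : R)))//.
    apply/funext => n; rewrite /= sumEFin/= /series/=.
    by apply: eq_bigr => k _; rewrite mul1r.
  by rewrite ltry.
have mh : measurable_fun setT h.
  apply: (@ge0_emeasurable_sum _ _ _ setT (fun k x => (D k x)%:E) xpredT).
    by move=> *; rewrite lee_fin.
  by move=> k _; exact: mD.
have h0 x : (0 <= h x)%E by apply: nneseries_ge0 => k _ _; rewrite lee_fin.
have /integrable_ae : m.-integrable setT h.
  apply/integrableP; split => //; rewrite (eq_integral h)// => x _.
  by rewrite gee0_abs.
move/(_ measurableT); apply: filterS => x /(_ I) hx.
have DM k : D k x <= fine (h x).
  rewrite -lee_fin fineK//.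
  have := @nneseries_lim_ge _ (fun k => (D k x)%:E) xpredT 0%N k.+1
    (fun k _ _ => D0 k x).
  by apply: le_trans; rewrite sumEFin lee_fin big_nat_recr//= lerDr sumr_ge0.
apply: (@geometric_cvg _ _ (Num.sqrt (fine (h x)))) => k.
rewrite -sqrtr_sqr -[X in _ / X]ger0_norm ?exprn_ge0// -sqrtr_sqr -sqrtrV ?sqr_ge0//.
rewrite -sqrtrM; last by apply: fine_ge0.
apply: ler_wsqrtr; rewrite ler_pdivlMr ?exprn_gt0//.
have -> : (2 ^+ k) ^+ 2 = 4 ^+ k :> R.
  by rewrite -exprM mulnC exprM; congr (_ ^+ _); ring.
by rewrite mulrC; exact: DM.
Qed.

(** The limit is built along a fast subsequence, where convergence holds almost
    everywhere; Fatou's lemma then controls the distance to the whole sequence. *)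
Lemma riesz_fischer (g_ : nat -> T -> R) : (forall n, sqi m (g_ n)) ->
  (forall e, 0 < e -> exists N, forall n p, (N <= n)%N -> (N <= p)%N ->
     \int[m]_x ((g_ n x - g_ p x) ^+ 2) <= e) ->
  exists g, sqi m g /\ (fun n => \int[m]_x ((g_ n x - g x) ^+ 2)) @ \oo --> 0.
Proof.
move=> sg hc.
have /choice[N hN] k : exists N, forall n p, (N <= n)%N -> (N <= p)%N ->
    \int[m]_x ((g_ n x - g_ p x) ^+ 2) <= (16^-1) ^+ k.
  by apply: hc; rewrite exprn_gt0// invr_gt0.
(* Sums make the indices increase while staying above [N k]. *)
pose nn k := (\sum_(i < k.+1) (N i).+1)%N.
have nnS k : (nn k <= nn k.+1)%N by rewrite /nn [X in (_ <= X)%N]big_ord_recr leq_addr.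
have nnN k : (N k <= nn k)%N by rewrite /nn big_ord_recr/= (leq_trans (leqnSn _))// leq_addl.
have nnk k : (k <= nn k)%N.
  rewrite /nn; elim: k => // k ih; rewrite big_ord_recr/=.
  by rewrite addnS ltnS (leq_trans ih)// leq_addr.
have cae : {ae m, forall x, cvgn (fun k => g_ (nn k) x)}.
  apply: (@sqi_fast_cvg (fun k => g_ (nn k))) => // k.
  by apply: hN => //; exact: leq_trans (nnN k) (nnS k).
pose g x := fine (limn_esup (fun k => (g_ (nn k) x)%:E)).
have mg : measurable_fun setT g.
  apply: measurableT_comp => //; apply: measurable_fun_limn_esup => k.
  exact/measurable_EFinP/(sg _).1.
have cg : {ae m, forall x, (fun k => g_ (nn k) x) @ \oo --> g x}.
  apply: filterS cae => x /cvg_ex[l /= cl].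
  have cl' : (fun k => (g_ (nn k) x)%:E) @ \oo --> l%:E.
    by apply/cvg_EFin => //; exact: nearW.
  by have [_ ls] := cvg_limn_einf_sup cl'; rewrite /g ls.
have key e : 0 < e -> exists N0, forall n, (N0 <= n)%N ->
    intg m (fun x => (g_ n x - g x) ^+ 2) /\ \int[m]_x ((g_ n x - g x) ^+ 2) <= e.
  move=> /hc[N0 h0]; exists N0 => n n0.
  apply: (@fatou_intg _ _ _ _ (fun k x => (g_ n x - g_ (nn (k + N0)%N) x) ^+ 2)).
  - by move=> k; exact: (sqiB (sg _) (sg _)).2.
  - by move=> k x; exact: sqr_ge0.
  - by move=> k; apply: h0 => //; apply: leq_trans (nnk _); exact: leq_addl.
  - by apply: measurable_funX; apply: measurable_funB => //; exact: (sg _).1.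
  - apply: filterS cg => x cx; rewrite /exprz.
    have c1 : (fun k => g_ (nn (k + N0)%N) x) @ \oo --> g x.
      by rewrite (cvg_shiftn N0 (fun k => g_ (nn k) x)).
    rewrite expr2 (_ : (fun k => _) = (fun k => (g_ n x - g_ (nn (k + N0)%N) x) *
      (g_ n x - g_ (nn (k + N0)%N) x))); last by apply/funext => k; rewrite expr2.
    by apply: cvgM; apply: cvgB => //; exact: cvg_cst.
exists g; split.
  have [N0 h0] := key 1 ltr01; have [i0 _] := h0 N0 (leqnn _).
  have sd : sqi m (fun x => g_ N0 x - g x).
    by split=> //; apply: measurable_funB => //; exact: (sg _).1.
  have := sqiB (sg N0) sd; congr sqi; apply/funext => x; ring.
apply/cvgrPdist_le => e e0; have [N0 h0] := key e e0; exists N0 => // n /= Nn.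
rewrite sub0r normrN ger0_norm; first exact: (h0 n Nn).2.
by apply: Int_ge0 => x; exact: sqr_ge0.
Qed.

End RieszFischer.

(** * Fubini's theorem for real-valued integrals *)

Section RealFubini.
Context d1 d2 (T1 : measurableType d1) (T2 : measurableType d2) (R : realType).
Context (m1 : {sigma_finite_measure set T1 -> \bar R}).
Context (m2 : {sigma_finite_measure set T2 -> \bar R}).
Implicit Type f : T1 * T2 -> R.

(** Tonelli's theorem: a function is integrable for the product as soon as its
    sections are, with norms bounded by an integrable function. *)
Lemma intg_prod2 f (b : T2 -> R) : measurable_fun setT f -> intg m2 b ->
  (forall y, intg m1 (fun x => f (x, y))) ->
  (forall y, \int[m1]_x `|f (x, y)| <= b y) -> intg (m1 \x m2)%E f.
Proof.
move=> mf ib i1 fb; apply/(integrable21ltyP m1 m2); first exact/measurable_EFinP.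
apply: (@le_lt_trans _ _ (\int[m2]_y (b y)%:E)%E); last by rewrite Int_EFin// ltry.
apply: ge0_le_integral => //.
- by move=> y _; apply: integral_ge0.
- apply: (@measurable_fun_fubini_tonelli_G _ _ _ _ _ m1 (fun p => `|f p|%:E)) => //.
  by apply/measurable_EFinP/measurableT_comp.
- exact/measurable_EFinP/(intg_meas ib).
- move=> y _ /=; rewrite Int_EFin; first by rewrite lee_fin.
  exact: intg_norm (i1 y).
Qed.

Lemma intg_prod1 f (b : T1 -> R) : measurable_fun setT f -> intg m1 b ->
  (forall x, intg m2 (fun y => f (x, y))) ->
  (forall x, \int[m2]_y `|f (x, y)| <= b x) -> intg (m1 \x m2)%E f.
Proof.
move=> mf ib i1 fb; apply/(integrable12ltyP m1 m2); first exact/measurable_EFinP.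
apply: (@le_lt_trans _ _ (\int[m1]_x (b x)%:E)%E); last by rewrite Int_EFin// ltry.
apply: ge0_le_integral => //.
- by move=> y _; apply: integral_ge0.
- apply: (@measurable_fun_fubini_tonelli_F _ _ _ _ _ m2 (fun p => `|f p|%:E)) => //.
  by apply/measurable_EFinP/measurableT_comp.
- exact/measurable_EFinP/(intg_meas ib).
- move=> y _ /=; rewrite Int_EFin; first by rewrite lee_fin.
  exact: intg_norm (i1 y).
Qed.

Lemma measurable_Int1 f : measurable_fun setT f ->
  measurable_fun setT (fun x => \int[m2]_y f (x, y)).
Proof.
move=> mf; apply: measurableT_comp => //.
have mE : measurable_fun setT (EFin \o f) by exact/measurable_EFinP.
rewrite (_ : (fun x => _) = (fun x => \int[m2]_y (EFin \o f)^\+ (x, y) -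
    \int[m2]_y (EFin \o f)^\- (x, y))%E); last first.
  by apply/funext => x; rewrite integralE; congr (_ - _)%E;
    apply: eq_integral => z _; rewrite ?funeposE ?funenegE.
apply: emeasurable_funB; apply: measurable_fun_fubini_tonelli_F => //.
  exact: measurable_funepos.
exact: measurable_funeneg.
Qed.

Lemma measurable_Int2 f : measurable_fun setT f ->
  measurable_fun setT (fun y => \int[m1]_x f (x, y)).
Proof.
move=> mf; apply: measurableT_comp => //.
have mE : measurable_fun setT (EFin \o f) by exact/measurable_EFinP.
rewrite (_ : (fun y => _) = (fun y => \int[m1]_x (EFin \o f)^\+ (x, y) -
    \int[m1]_x (EFin \o f)^\- (x, y))%E); last first.
  by apply/funext => y; rewrite integralE; congr (_ - _)%E;
    apply: eq_integral => z _; rewrite ?funeposE ?funenegE.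
apply: emeasurable_funB; apply: measurable_fun_fubini_tonelli_G => //.
  exact: measurable_funepos.
exact: measurable_funeneg.
Qed.

Lemma intg_Int1 f : intg (m1 \x m2)%E f ->
  intg m1 (fun x => \int[m2]_y f (x, y)).
Proof.
move=> hf; apply/integrableP; split.
  by apply/measurable_EFinP; exact: measurable_Int1 (intg_meas hf).
have /integrableP[mF] := @integrable_fubini_F _ _ _ _ _ m1 m2 (EFin \o f) hf.
apply: le_lt_trans; apply: ae_ge0_le_integral => //=.
- by apply/measurable_EFinP/measurableT_comp => //; exact: measurable_Int1 (intg_meas hf).
- exact: measurableT_comp.
- apply: filterS (ae_integrable1 hf) => x hx _.
  by rewrite /fubini_F /= Int_EFin.
Qed.

Lemma intg_Int2 f : intg (m1 \x m2)%E f ->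
  intg m2 (fun y => \int[m1]_x f (x, y)).
Proof.
move=> hf; apply/integrableP; split.
  by apply/measurable_EFinP; exact: measurable_Int2 (intg_meas hf).
have mf : measurable_fun setT (EFin \o f) := measurable_int _ hf.
apply: le_lt_trans ((integrable21ltyP m1 m2 mf).1 hf).
apply: ge0_le_integral => //.
- by apply: measurableT_comp => //; by apply/measurable_EFinP; exact: measurable_Int2 (intg_meas hf).
- apply: (@measurable_fun_fubini_tonelli_G _ _ _ _ _ m1 (fun p => `|f p|%:E)) => //.
  by apply/measurable_EFinP/measurableT_comp => //; exact/measurable_EFinP.
- move=> y _ /=.
  have le_fine (z : \bar R) : (`|fine z|%:E <= `|z|)%E by case: z => [r||] //=; rewrite leey.
  apply: le_trans (le_fine _) _; apply: le_abse_integral => //.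
  exact: measurableT_comp mf (pair2_measurable y).
Qed.

Lemma Int_prod1 f : intg (m1 \x m2)%E f ->
  \int[(m1 \x m2)%E]_p f p = \int[m1]_x \int[m2]_y f (x, y).
Proof.
move=> hf; congr fine; rewrite -integral12_prod_meas1//.
apply: ae_eq_integral => //.
- exact: (@measurable_fubini_F _ _ _ _ _ m1 m2 (EFin \o f)).
- by apply/measurable_EFinP; exact: measurable_Int1 (intg_meas hf).
- by apply: filterS (ae_integrable1 hf) => x hx _; rewrite /fubini_F /= Int_EFin.
Qed.

Lemma Int_prod2 f : intg (m1 \x m2)%E f ->
  \int[(m1 \x m2)%E]_p f p = \int[m2]_y \int[m1]_x f (x, y).
Proof.
move=> hf; congr fine; rewrite -integral21_prod_meas1//.
apply: ae_eq_integral => //.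
- exact: (@measurable_fubini_G _ _ _ _ _ m1 m2 (EFin \o f)).
- by apply/measurable_EFinP; exact: measurable_Int2 (intg_meas hf).
- by apply: filterS (ae_integrable2 hf) => x hx _; rewrite /fubini_G /= Int_EFin.
Qed.

Lemma Int_swap f : intg (m1 \x m2)%E f ->
  \int[m1]_x \int[m2]_y f (x, y) = \int[m2]_y \int[m1]_x f (x, y).
Proof. by move=> hf; rewrite -Int_prod1// Int_prod2. Qed.

End RealFubini.

(** * Affine changes of variable for Lebesgue measure *)

Section Affine.
Context {R : realType}.
Notation mu := (@lebesgue_measure R).
Notation RM := (measurableTypeR R).
Notation mble f := (measurable_fun (@setT RM) (f : RM -> R)).
Notation mble2 f := (measurable_fun (@setT (RM * RM)) (f : RM * RM -> R)).

Lemma measurable_oppM : measurable_fun setT (-%R : RM -> RM).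
Proof. by apply: continuous_measurable_fun => x; exact: opp_continuous. Qed.

Section Push.
Context (c b : R) (c0 : 0 < c).

Definition affine_map (x : RM) : RM := c * x + b.

Lemma measurable_affine_map : measurable_fun setT affine_map.
Proof.
by apply: measurable_funD => //; apply: measurable_funM.
Qed.

Let cnn : 0 <= c. Proof. exact: ltW. Qed.

(** Both sides are measures in [A], so it is enough to compare them on intervals. *)
Lemma lebesgue_affine (A : set R) : measurable A ->
  (mu A = c%:E * pushforward mu affine_map A)%E.
Proof.
move=> mA.
rewrite (@lebesgue_measure_unique _ (mscale (NngNum cnn) (pushforward mu affine_map)))//.
  exact: measurable_affine_map.
move=> mf _ [[x y]] _ <-.
change (mu `]x, y]%classic = (c%:E * mu (affine_map @^-1` `]x, y]%classic))%E).
have -> : affine_map @^-1` `]x, y]%classic = `](x - b) / c, (y - b) / c]%classic.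
  apply/seteqP; split => z /=; rewrite !in_itv/= /affine_map => /andP[h1 h2].
    by rewrite ltr_pdivrMr// ler_pdivlMr//; lra.
  by move: h1 h2; rewrite ltr_pdivrMr// ler_pdivlMr//; lra.
rewrite !lebesgue_measure_itv/= !lte_fin ltr_pM2r ?invr_gt0// ltrD2r.
case: ifPn => _; last by rewrite mule0.
by rewrite -EFinD -EFinM; congr EFin; field; rewrite gt_eqF.
Qed.

Lemma ge0_integral_affine (f : RM -> \bar R) : measurable_fun setT f ->
  (forall x, (0 <= f x)%E) ->
  (\int[mu]_x f x = c%:E * \int[mu]_x f (c * x + b)%R)%E.
Proof.
move=> mf f0.
have := @ge0_integral_pushforward _ _ (measurableTypeR R) (measurableTypeR R) R
  _ measurable_affine_map mu setT f measurableT mf (fun x _ => f0 x).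
rewrite preimage_setT => <-.
rewrite -(ge0_integral_mscale _ measurableT (NngNum cnn))//.
  exact: measurable_affine_map.
move=> mf'; apply: eq_measure_integral => A mA _; exact: lebesgue_affine.
Qed.

End Push.

Lemma intg_affine c b (f : RM -> R) : 0 < c -> intg mu f ->
  intg mu (fun x => f (c * x + b)).
Proof.
move=> c0 /integrableP[/measurable_EFinP mf fi].
have mfa : measurable_fun setT (fun x => f (c * x + b)).
  exact: measurableT_comp mf (measurable_affine_map c b).
apply/integrableP; split; first exact/measurable_EFinP.
rewrite (@ge0_integral_affine c b c0 (fun x => `|f x|%:E)) in fi => //; last 1 first.
  by apply/measurable_EFinP/measurableT_comp.
rewrite ltNge leye_eq; apply/negP => /eqP h; move: fi.
by rewrite h gt0_muley ?ltxx ?lte_fin.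
Qed.

Lemma Int_affine c b (f : RM -> R) : 0 < c -> intg mu f ->
  \int[mu]_x f (c * x + b) = c^-1 * \int[mu]_x f x.
Proof.
move=> c0 hf; have := hf => /integrableP[/measurable_EFinP mf fi].
have cne : c != 0 by rewrite gt_eqF.
have pos (g : RM -> R) : (forall x, 0 <= g x) -> intg mu g ->
    \int[mu]_x g (c * x + b) = c^-1 * \int[mu]_x g x.
  move=> g0 ig; apply: (mulfI cne); rewrite mulVKf//.
  apply/EFin_inj; rewrite EFinM -!Int_EFin//; last exact: intg_affine.
  rewrite (@ge0_integral_affine c b c0 (fun x => (g x)%:E))//.
  by apply/measurable_EFinP; exact: intg_meas ig.
have E x : f x = (f x + `|f x|) - `|f x| by rewrite addrK.
have i1 := intg_norm hf; have i2 := intgD hf i1.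
have j1 := intg_affine b c0 i1; have j2 := intg_affine b c0 i2.
rewrite (_ : (fun x => f (c * x + b)) = fun x =>
  (f (c * x + b) + `|f (c * x + b)|) - `|f (c * x + b)|); last first.
  by apply/funext => x; rewrite addrK.
rewrite [in RHS](_ : f = fun x => (f x + `|f x|) - `|f x|); last first.
  by apply/funext => x; rewrite addrK.
rewrite !IntB// (pos _ _ i2) ?(pos _ _ i1) ?mulrBr// => x.
by have := ler_norm (- f x); rewrite normrN; lra.
Qed.

Lemma intg_shift a (f : RM -> R) : intg mu f -> intg mu (fun x => f (x + a)).
Proof.
move=> /(intg_affine a ltr01); congr intg.
by apply/funext => x; rewrite mul1r.
Qed.

Lemma Int_shift a (f : RM -> R) : intg mu f ->
  \int[mu]_x f (x + a) = \int[mu]_x f x.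
Proof.
move=> /(Int_affine a ltr01); rewrite invr1 mul1r => <-.
by congr Rintegral; apply/funext => x; rewrite mul1r.
Qed.

Lemma ge0_integral_shift a (f : RM -> \bar R) : measurable_fun setT f ->
  (forall x, (0 <= f x)%E) -> (\int[mu]_x f (x + a)%R = \int[mu]_x f x)%E.
Proof.
move=> mf f0; rewrite [RHS](@ge0_integral_affine 1 a ltr01)// mul1e.
by apply: eq_integral => x _; rewrite mul1r.
Qed.

Lemma ge0_integral_opp (f : RM -> \bar R) : measurable_fun setT f ->
  (forall x, (0 <= f x)%E) -> (\int[mu]_x f (- x)%R = \int[mu]_x f x)%E.
Proof.
move=> mf f0.
have mo : measurable_fun setT (-%R : RM -> RM).
  exact: measurable_oppM.
have := @ge0_integral_pushforward _ _ (measurableTypeR R) (measurableTypeR R) R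
  _ mo mu setT f measurableT mf (fun x _ => f0 x).
rewrite preimage_setT => <-.
by apply: eq_measure_integral => A mA _; exact: lebesgue_measureN.
Qed.

Lemma intg_opp (f : RM -> R) : intg mu f -> intg mu (fun x => f (- x)).
Proof.
move=> /integrableP[/measurable_EFinP mf fi].
have mo : measurable_fun setT (-%R : RM -> RM) by exact: measurable_oppM.
apply/integrableP; split.
  apply/measurable_EFinP; exact: (measurableT_comp mf mo).
move: fi; rewrite -(ge0_integral_opp (f := fun x => `|f x|%:E))//.
by apply/measurable_EFinP/measurableT_comp.
Qed.

Lemma Int_opp (f : RM -> R) : intg mu f -> \int[mu]_x f (- x) = \int[mu]_x f x.
Proof.
move=> hf.
have pos (g : RM -> R) : (forall x, 0 <= g x) -> intg mu g ->
    \int[mu]_x g (- x) = \int[mu]_x g x.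
  move=> g0 ig; apply/EFin_inj; rewrite -!Int_EFin//; last exact: intg_opp.
  rewrite (ge0_integral_opp (f := fun x => (g x)%:E))//.
  by apply/measurable_EFinP; exact: intg_meas ig.
have i1 := intg_norm hf; have i2 := intgD hf i1.
have j1 := intg_opp i1; have j2 := intg_opp i2.
rewrite (_ : (fun x => f (- x)) = fun x => (f (- x) + `|f (- x)|) - `|f (- x)|);
  last by apply/funext => x; rewrite addrK.
rewrite [in RHS](_ : f = fun x => (f x + `|f x|) - `|f x|); last first.
  by apply/funext => x; rewrite addrK.
rewrite !IntB// (pos _ _ i2) ?(pos _ _ i1)// => x.
by have := ler_norm (- f x); rewrite normrN; lra.
Qed.

Lemma intg_refl a (f : RM -> R) : intg mu f -> intg mu (fun x => f (a - x)).
Proof.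
move=> /(intg_shift a) /intg_opp; congr intg.
by apply/funext => x; rewrite addrC.
Qed.

Lemma Int_refl a (f : RM -> R) : intg mu f ->
  \int[mu]_x f (a - x) = \int[mu]_x f x.
Proof.
move=> hf; rewrite -(Int_shift a hf) -(Int_opp (intg_shift a hf)).
by congr Rintegral; apply/funext => x; rewrite addrC.
Qed.

Lemma sqi_shift a (f : RM -> R) : sqi mu f -> sqi mu (fun x => f (x + a)).
Proof.
move=> [mf hf]; split; last exact: intg_shift hf.
have ma : measurable_fun setT ((fun x => x + a) : RM -> RM) by apply: measurable_funD.
exact: (measurableT_comp mf ma).
Qed.

Lemma measurable_addp (f : RM -> R) : mble f ->
  mble2 (fun p => f (p.1 + p.2)).
Proof.
move=> mf; have ma : measurable_fun setT ((fun p => p.1 + p.2) : RM * RM -> RM).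
  by apply: measurable_funD.
exact: (measurableT_comp mf ma).
Qed.

Lemma measurable_fstp (f : RM -> R) : mble f ->
  mble2 (fun p => f p.1).
Proof. by move=> mf; exact: (measurableT_comp mf). Qed.

Lemma measurable_sndp (f : RM -> R) : mble f ->
  mble2 (fun p => f p.2).
Proof. by move=> mf; exact: (measurableT_comp mf). Qed.

Lemma measurable_shift_set a (A : set RM) : measurable A ->
  measurable [set x : RM | A (x + a)].
Proof.
move=> mA; rewrite -[X in measurable X]setTI.
have mD : measurable_fun setT ((fun x => x + a) : RM -> RM).
  by apply: measurable_funD.
exact: (mD measurableT _ mA).
Qed.

Lemma mu_shift a (A : set RM) : measurable A -> mu [set x | A (x + a)] = mu A.
Proof.
move=> mA; have mB := measurable_shift_set a mA.
rewrite -[in RHS](@setIT _ A) -integral_indic//.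
rewrite -(@ge0_integral_shift a (fun x => (\1_A x)%:E)).
- by rewrite -[in LHS](@setIT _ [set x | A (x + a)]) -integral_indic.
- by apply/measurable_EFinP.
- by move=> x; rewrite lee_fin.
Qed.

(** The map [(x, y) |-> (x, x + y)] pulls null sets back to null sets, because
    translations preserve Lebesgue measure. This is how almost everywhere
    convergence passes to difference quotients. *)
Lemma ae_prod (P : R -> Prop) : {ae mu, forall x, P x} ->
  {ae (mu \x mu)%E, forall p, P p.1 /\ P (p.1 + p.2)}.
Proof.
move=> [A [mA A0 sA]].
have mB : measurable [set p : RM * RM | A p.1].
  rewrite -[X in measurable X]setTI.
  have mF : measurable_fun setT (fst : RM * RM -> RM) by exact: measurable_fst.
  exact: (mF measurableT _ mA).
have mC : measurable [set p : RM * RM | A (p.1 + p.2)].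
  rewrite -[X in measurable X]setTI.
  have mD : measurable_fun setT ((fun p => p.1 + p.2) : RM * RM -> RM).
    by apply: measurable_funD.
  exact: (mD measurableT _ mA).
have z (B : set (RM * RM)) : measurable B ->
    (forall y, mu [set x | B (x, y)] = 0%E) -> (mu \x mu)%E B = 0%E.
  move=> mB' h.
  have -> : (mu \x mu)%E B = (\int[(mu \x mu)%E]_p (\1_B p)%:E)%E.
    by rewrite integral_indic// setIT.
  rewrite (@fubini_tonelli2 _ _ _ _ _ mu mu)//; last 1 first.
    by apply/measurable_EFinP.
  rewrite [X in _ = X](_ : _ = \int[mu]_y 0)%E; last by rewrite integral0.
  apply: eq_integral => y _; rewrite /fubini_G.
  rewrite -[RHS](h y) -[in RHS](setIT [set x | B (x, y)]) -integral_indic//.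
  rewrite -[X in measurable X]setTI.
  exact: (@pair2_measurable _ _ RM RM y measurableT _ mB').
exists ([set p : RM * RM | A p.1] `|` [set p : RM * RM | A (p.1 + p.2)]); split.
- exact: measurableU.
- rewrite null_set_setU//; first by apply: z => // y; rewrite -[RHS]A0.
  apply: z => // y; rewrite -[RHS]A0; exact: mu_shift.
- move=> p /= h; apply: contrapT => /not_orP[h1 h2]; apply: h; split.
    by apply: contrapT => h3; apply/h1/sA.
  by apply: contrapT => h3; apply/h2/sA.
Qed.

Lemma ae_imp (P Q : R -> Prop) : (forall x, P x -> Q x) ->
  {ae mu, forall x, P x} -> {ae mu, forall x, Q x}.
Proof.
move=> PQ [A [mA A0 sA]]; exists A; split => // x /= nQ.
by apply: sA => /= /PQ.
Qed.

Lemma ae_all (P : nat -> R -> Prop) : (forall n, {ae mu, forall x, P n x}) ->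
  {ae mu, forall x, forall n, P n x}.
Proof.
move=> h; have {h} : mu.-negligible (\bigcup_n [set x | ~ P n x]).
  by apply: negligible_bigcup => n; exact: h.
move=> [A [mA A0 sA]]; exists A; split => // x /= /existsNP[n hn].
by apply: sA; exists n.
Qed.

End Affine.

(** * Smooth functions with compact support *)

Section Smooth.
Context {R : realType}.
Implicit Types (f g : R -> R) (a b c x y M S : R).

Lemma derivable_is_derive f (x : R) : derivable f x 1 -> is_derive x (1 : R) f (derive1 f x).
Proof. by move=> h; apply: DeriveDef => //; rewrite derive1E. Qed.

Lemma is_derive_derive1 f g : (forall x : R, is_derive x (1 : R) f (g x)) -> derive1 f = g.
Proof. by move=> h; apply/funext => x; rewrite derive1E; have := h x => -[]. Qed.

Lemma is_deriveDf f g x a b : is_derive x (1 : R) f a -> is_derive x (1 : R) g b ->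
  is_derive x (1 : R) (fun y => f y + g y) (a + b).
Proof. by move=> hf hg; exact: (is_deriveD hf hg). Qed.

Lemma is_deriveMf f g x a b : is_derive x (1 : R) f a -> is_derive x (1 : R) g b ->
  is_derive x (1 : R) (fun y => f y * g y) (f x * b + g x * a).
Proof. by move=> hf hg; exact: (is_deriveM hf hg). Qed.

Lemma is_derive_affine a b x : is_derive x (1 : R) (fun y => a * y + b) a.
Proof.
have h := is_deriveD (is_deriveM (is_derive_cst a x 1) (is_derive_id x 1)) (is_derive_cst b x 1).
by apply: (is_derive_eq h); rewrite scaler0 !addr0 /GRing.scale/= mulr1.
Qed.

Lemma is_derive_comp_affine f a b c x : is_derive (a * x + b) (1 : R) f c ->
  is_derive x (1 : R) (fun y => f (a * y + b)) (a * c).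
Proof.
move=> hf; have h := @is_derive1_comp _ f (fun y => a * y + b) x _ _ hf (is_derive_affine a b x).
by apply: (is_derive_eq h); rewrite mulrC.
Qed.

Lemma derive1Sn n f : derive1n n.+1 f = derive1n n (derive1 f).
Proof. by rewrite /derive1n iterSr. Qed.

(** [n + 1] derivatives, defined by recursion on the derivative rather than through
    iterated derivatives: closure under products and compositions is then an
    induction. *)
Fixpoint Cn n f : Prop := (forall x, derivable f x (1 : R)) /\
  (if n is n'.+1 then Cn n' (derive1 f) else True).

Definition smooth f : Prop := forall n, Cn n f.

Lemma Cn_derivable n f : Cn n f -> forall x, derivable f x (1 : R).
Proof. by case: n => [|n] []. Qed.

Lemma CnW n f : Cn n.+1 f -> Cn n f.
Proof. by elim: n f => [|n ih] f [h1 h2]; split => //; exact: ih. Qed.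

Lemma Cn_intro n f g : (forall x : R, is_derive x (1 : R) f (g x)) -> Cn n g -> Cn n.+1 f.
Proof.
move=> h hg; split; first by move=> x; have [] := h x.
by rewrite (is_derive_derive1 h).
Qed.

Lemma smoothP f : smooth f <-> forall n x, derivable (derive1n n f) x (1 : R).
Proof.
split=> [h n|h n].
  elim: n f h => [|n ih] f h x; first exact: Cn_derivable (h 0%N) x.
  by rewrite derive1Sn; apply: ih => k; have [] := h k.+1.
elim: n f h => [|n ih] f h; first by split => // x; exact: h 0%N x.
split; first by move=> x; exact: h 0%N x.
by apply: ih => k x; rewrite -derive1Sn.
Qed.

Lemma smooth_derive f : smooth f -> smooth (derive1 f).
Proof. by move=> h n; have [] := h n.+1. Qed.

Lemma smooth_is_derive f (x : R) : smooth f -> is_derive x (1 : R) f (derive1 f x).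
Proof. by move=> h; apply: derivable_is_derive; exact: Cn_derivable (h 0%N) x. Qed.

Lemma Cn_cst n c : Cn n (fun=> c : R).
Proof.
elim: n c => [|n ih] c; first by split => // x; exact: derivable_cst.
by apply: Cn_intro (ih 0) => x; exact: is_derive_cst.
Qed.

Lemma CnD n f g : Cn n f -> Cn n g -> Cn n (fun x => f x + g x).
Proof.
elim: n f g => [|n ih] f g [f1 f2] [g1 g2].
  split=> [x|//].
  by have [] := is_deriveDf (derivable_is_derive (f1 x)) (derivable_is_derive (g1 x)).
apply: Cn_intro (ih _ _ f2 g2) => x.
by apply: is_deriveDf; exact: derivable_is_derive.
Qed.

Lemma CnM n f g : Cn n f -> Cn n g -> Cn n (fun x => f x * g x).
Proof.
have dM n' f' g' x : Cn n' f' -> Cn n' g' -> is_derive x (1 : R)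
    (fun x => f' x * g' x) (f' x * derive1 g' x + g' x * derive1 f' x).
  by move=> hf hg; apply: is_deriveMf; apply: derivable_is_derive;
    [exact: Cn_derivable hf x|exact: Cn_derivable hg x].
elim: n f g => [|n ih] f g hf hg.
  by split=> [x|//]; have [] := dM _ _ _ x hf hg.
have [f1 f2] := hf; have [g1 g2] := hg.
apply: (Cn_intro (fun x => dM _ _ _ x hf hg)).
by apply: CnD; apply: ih => //; exact: CnW.
Qed.

Lemma CnZ n c f : Cn n f -> Cn n (fun x => c * f x).
Proof. by move=> hf; apply: CnM => //; exact: Cn_cst. Qed.

Lemma Cn_affine n a b f : Cn n f -> Cn n (fun x => f (a * x + b)).
Proof.
elim: n f => [|n ih] f [f1 f2].
  split=> [x|//].
  by have [] := is_derive_comp_affine (derivable_is_derive (f1 (a * x + b))).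
apply: (Cn_intro _ (CnZ a (ih _ f2))) => x.
exact: is_derive_comp_affine (derivable_is_derive (f1 (a * x + b))).
Qed.

Definition vanish S f : Prop := forall x, S < `|x| -> f x = 0.

(** A subset of the line has compact closure exactly when it is bounded. *)
Lemma test_funP f : test_fun f <-> smooth f /\ exists S, vanish S f.
Proof.
split=> [[/smoothP sf cf]|[/smoothP sf [S vS]]]; split => //.
  have [M [_ hM]] := compact_bounded cf; exists (M + 1) => x xM.
  apply/eqP/negPn/negP => fx; move: xM; rewrite ltNge => /negP; apply.
  by apply: (hM (M + 1)); [rewrite ltrDl|exact: subset_closure].
apply: (@subclosed_compact _ _ `[- S, S]) => //; first exact: closed_closure.
  exact: segment_compact.
have cS : closed `[- S, S]%classic by apply: interval_closed.
rewrite [X in _ `<=` X]((closure_id _).1 cS); apply: closure_subset => x /= fx.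
by rewrite in_itv/= -ler_norml leNgt; apply/negP => /vS h; rewrite h eqxx in fx.
Qed.

Lemma test_smooth f : test_fun f -> smooth f.
Proof. by move=> /test_funP[]. Qed.

Lemma vanish_derive S f : vanish S f -> vanish S (derive1 f).
Proof.
move=> vS x Sx.
rewrite derive1E (@near_eq_derive _ _ _ f (cst 0)) ?derive_cst ?oner_neq0//.
have : nbhs x [set y | S < `|y|].
  apply: open_nbhs_nbhs; split => //.
  apply: (@open_comp _ _ (fun y : R => `|y|) [set z | S < z]).
    by move=> y _; exact: norm_continuous.
  exact: open_gt.
by apply: filterS => y /= /vS ->.
Qed.

Lemma test_fun_derive f : test_fun f -> test_fun (derive1 f).
Proof.
move=> /test_funP[sf [S vS]]; apply/test_funP; split; first exact: smooth_derive.
by exists S; exact: vanish_derive.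
Qed.

Lemma test_funD f g : test_fun f -> test_fun g -> test_fun (fun x => f x + g x).
Proof.
move=> /test_funP[sf [S vS]] /test_funP[sg [S' vS']].
apply/test_funP; split; first by move=> n; exact: CnD.
exists (Num.max S S') => x; rewrite gt_max => /andP[h1 h2].
by rewrite vS// vS'// addr0.
Qed.

Lemma test_funZ c f : test_fun f -> test_fun (fun x => c * f x).
Proof.
move=> /test_funP[sf [S vS]].
apply/test_funP; split; first by move=> n; exact: CnZ.
by exists S => x h; rewrite vS// mulr0.
Qed.

Lemma test_funB f g : test_fun f -> test_fun g -> test_fun (fun x => f x - g x).
Proof.
move=> hf /(test_funZ (-1)) /(test_funD hf); congr test_fun.
by apply/funext => x; rewrite mulN1r.
Qed.

Lemma test_fun_affine a b f : a != 0 -> test_fun f -> test_fun (fun x => f (a * x + b)).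
Proof.
move=> a0 /test_funP[sf [S vS]].
apply/test_funP; split; first by move=> n; exact: Cn_affine.
exists ((S + `|b|) / `|a|) => x h; apply: vS.
have := ler_normB (a * x + b) b; rewrite addrK normrM.
by move: h; rewrite ltr_pdivrMr ?normr_gt0// mulrC; lra.
Qed.

Lemma test_fun_shift b f : test_fun f -> test_fun (fun x => f (x + b)).
Proof.
move=> /(@test_fun_affine 1 b _ (oner_neq0 _)).
by under eq_fun do rewrite mul1r.
Qed.

Lemma test_fun_refl b f : test_fun f -> test_fun (fun x => f (b - x)).
Proof.
move=> hf; have := @test_fun_affine (-1) b _ _ hf.
rewrite oppr_eq0 oner_eq0 => /(_ isT); congr test_fun.
by apply/funext => x; rewrite mulN1r addrC.
Qed.

Lemma smooth_continuous f : smooth f -> continuous f.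
Proof.
move=> sf x; apply: differentiable_continuous; apply/derivable1_diffP.
exact: Cn_derivable (sf 0%N) x.
Qed.

Lemma test_bounded f : test_fun f -> exists M, 0 < M /\ forall x, `|f x| <= M.
Proof.
move=> /test_funP[sf [S vS]].
have cf : {within `[- S, S], continuous f}.
  exact/continuous_subspaceT/smooth_continuous.
have [M [_ hM]] := compact_bounded (continuous_compact cf (segment_compact (a := - S) (b := S))).
exists (Num.max (M + 1) 1); split; first by rewrite lt_max ltr01 orbT.
move=> x; rewrite le_max; apply/orP.
have [xS|xS] := leP `|x| S; last by right; rewrite vS// normr0.
left; apply: (hM (M + 1)); first by rewrite ltrDl.
by exists x => //=; rewrite in_itv/= -ler_norml.
Qed.

Notation mu := (@lebesgue_measure R).
Notation RM := (measurableTypeR R).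
Notation mble f := (measurable_fun (@setT RM) (f : RM -> R)).

Lemma test_mble f : test_fun f -> mble f.
Proof. by move=> /test_smooth/smooth_continuous/continuous_measurable_fun. Qed.

Lemma intg_vanish f M S : mble f -> (forall x, `|f x| <= M) -> vanish S f ->
  intg mu f.
Proof.
move=> mf fM vS; apply: (@intg_le _ RM R mu f (fun x => M * \1_(`[- S, S]%classic) x)) => //.
  apply: intgZ; rewrite /intg; apply: integrable_indic_itv.
move=> x; rewrite indicE; case: (boolP (x \in _)) => h; first by rewrite mulr1.
rewrite mulr0 vS ?normr0// ltNge; apply/negP => xS; move/negP: h; apply.
by rewrite inE/= in_itv/= -ler_norml.
Qed.

Lemma test_intg f : test_fun f -> intg mu f.
Proof.
move=> tf; have [M [_ fM]] := test_bounded tf; have [_ [S vS]] := (test_funP f).1 tf.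
exact: intg_vanish (test_mble tf) fM vS.
Qed.

(** * Convolution with a test function *)

Definition convol (k f : R -> R) (x : R) : R := \int[mu]_y (k y * f (x - y)).

Lemma mble_refl a f : mble f -> mble (fun y => f (a - y)).
Proof.
move=> mf; have ma : measurable_fun setT ((fun x => a - x) : RM -> RM).
  by apply: measurable_funB.
exact: (measurableT_comp mf ma).
Qed.

(** Differentiation under the integral: [M |k|] dominates. *)
Lemma conv_is_derive k f M x : intg mu k -> smooth f ->
  (forall y, `|f y| <= M) -> (forall y, `|derive1 f y| <= M) ->
  is_derive (x : R) (1 : R) (convol k f) (convol k (derive1 f) x).
Proof.
move=> ik sf fM dM.
have mk := intg_meas ik.
have mf g : smooth g -> mble g by move=> /smooth_continuous/continuous_measurable_fun.
have M0 : 0 <= M by apply: le_trans (fM 0).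
pose F (x y : R) := k y * f (x - y).
have dF (y z : R) : is_derive z (1 : R) (F ^~ y) (k y * derive1 f (z - y)).
  have := is_derive_comp_affine (a := 1) (b := - y) (x := z) (f := f).
  rewrite mul1r => /(_ _ (smooth_is_derive (z - y) sf)) dc.
  have h := is_deriveMf (is_derive_cst (k y) z 1) dc.
  rewrite /F (_ : (fun x => k y * f (x - y)) = (fun x => cst (k y) x * f (1 * x - y))).
    by apply: (is_derive_eq h); rewrite mulr0 addr0 mul1r.
  by apply/funext => t; rewrite mul1r.
have iF (z : R) : intg mu (F z).
  rewrite /F (_ : (fun _ => _) = (fun y => f (z - y) * k y)); last first.
    by apply/funext => y; rewrite mulrC.
  by apply: (@intg_bddM _ _ _ _ M) => //; apply: mble_refl; exact: mf.
have Fd : forall z y : R, `]x - 1, x + 1[%classic z -> setT y -> derivable (F ^~ y) z 1.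
  by move=> z y _ _; have [] := dF y z.
have h1 : `]x - 1, x + 1[%classic x by rewrite /= in_itv/=; apply/andP; split; lra.
have iG : intg mu (fun y => M * `|k y|) by apply: intgZ; exact: intg_norm.
have G0 y : 0 <= M * `|k y| by rewrite mulr_ge0.
have FG : forall z y : R, `]x - 1, x + 1[%classic z -> setT y ->
    `|partial1of2 F z y| <= M * `|k y|.
  move=> z y _ _; rewrite /partial1of2 derive1E; have [_ ->] := dF y z.
  by rewrite normrM mulrC ler_wpM2r.
apply: DeriveDef.
  exact: (@derivable_under_integral R _ _ mu F setT measurableT x (x - 1) (x + 1) h1
    (fun z _ => iF z) Fd _ G0 iG FG).
rewrite -derive1E.
have -> := @differentiation_under_integral R _ _ mu F setT measurableT x (x - 1) (x + 1) h1
    (fun z _ => iF z) Fd _ G0 iG FG.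
congr Rintegral; apply/funext => y.
by rewrite /partial1of2 derive1E; have [_ ->] := dF y x.
Qed.

Lemma conv_smooth k f : intg mu k -> test_fun f -> smooth (convol k f).
Proof.
move=> ik tf n; elim: n f tf => [|n ih] f tf.
  have [M [_ fM]] := test_bounded tf.
  have [M' [_ dM]] := test_bounded (test_fun_derive tf).
  split=> // x; have [] := @conv_is_derive k f (Num.max M M') x ik (test_smooth tf) _ _ => //.
    by move=> y; rewrite le_max fM.
  by move=> y; rewrite le_max dM orbT.
have [M [_ fM]] := test_bounded tf.
have [M' [_ dM]] := test_bounded (test_fun_derive tf).
apply: Cn_intro (ih _ (test_fun_derive tf)) => x.
apply: (@conv_is_derive k f (Num.max M M') x ik (test_smooth tf)).
  by move=> y; rewrite le_max fM.
by move=> y; rewrite le_max dM orbT.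
Qed.

Lemma vanish_conv S S' k f : vanish S k -> vanish S' f -> vanish (S + S') (convol k f).
Proof.
move=> vk vf x hx; rewrite /convol -[RHS](Int0 mu); congr Rintegral.
apply/funext => y; have [yS|yS] := ltP S `|y|; first by rewrite vk// mul0r.
rewrite vf ?mulr0//; have := ler_normD (x - y) y; rewrite subrK; lra.
Qed.

(** Smoothness of a convolution comes from the test function, its compact
    support from both factors. *)
Lemma test_conv S k f : intg mu k -> vanish S k -> test_fun f ->
  test_fun (convol k f).
Proof.
move=> ik vk tf; have [_ [S' vf]] := (test_funP f).1 tf.
apply/test_funP; split; first exact: conv_smooth.
by exists (S + S'); exact: vanish_conv.
Qed.

End Smooth.

(** * A smooth bump and the associated mollifiers *)

Section Bump.
Context {R : realType}.
Implicit Types (f g : R -> R) (a b c x y M S : R).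
Notation mu := (@lebesgue_measure R).
Notation RM := (measurableTypeR R).
Notation mble f := (measurable_fun (@setT RM) (f : RM -> R)).

(** The family is stable under differentiation up to linear combinations, which
    is what makes [flat_exp 0] smooth at the origin. *)
Definition flat_exp (k : nat) x : R :=
  if 0 < x then expR (- x^-1) * x^-1 ^+ k else 0.

(** Quantitative flatness at the origin: the exponential series beats every power. *)
Lemma flat_exp_le k x : `|flat_exp k x| <= (k.+1)`!%:R * `|x|.
Proof.
rewrite /flat_exp; case: ifPn => [x0|_]; last by rewrite normr0 mulr_ge0.
rewrite ger0_norm; last by rewrite mulr_ge0 ?expR_ge0// exprn_ge0// invr_ge0 ltW.
rewrite (gtr0_norm x0) expRN mulrC ler_pdivrMr ?expR_gt0//.
have := @expR_ge1Dxn R (x^-1) k; rewrite invr_ge0 ltW// => /(_ isT) h.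
have {}h : x^-1 ^+ k.+1 <= (k.+1)`!%:R * expR x^-1.
  by rewrite mulrC -ler_pdivrMr ?ltr0n ?fact_gt0//; lra.
rewrite mulrAC -ler_pdivrMr//; apply: le_trans h.
by rewrite exprSr.
Qed.

Lemma is_derive_near f g x a : (forall y, 0 < y * x -> f y = g y) -> x != 0 ->
  is_derive x (1 : R) f a -> is_derive x (1 : R) g a.
Proof.
move=> fg x0; apply: near_eq_is_derive.
have : nbhs x [set y | 0 < y * x].
  apply: open_nbhs_nbhs; split; last by rewrite /= -expr2 exprn_even_gt0.
  apply: (@open_comp _ _ (fun y : R => y * x) [set z | 0 < z]).
    by move=> y _; exact: mulrr_continuous.
  exact: open_gt.
by apply: filterS => y /= /fg.
Qed.

Lemma flat_exp_derive k x : is_derive x (1 : R) (flat_exp k)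
  (flat_exp k.+2 x - k%:R * flat_exp k.+1 x).
Proof.
have [x0|x0|->] := ltgtP x 0.
- apply: (@is_derive_near (fun=> 0)); last 2 first.
  + by rewrite lt_eqF.
  + have -> : flat_exp k.+2 x - k%:R * flat_exp k.+1 x = 0.
      by rewrite /flat_exp !(ltNge 0) !(ltW x0)/= mulr0 subrr.
    exact: is_derive_cst.
  by move=> y; rewrite nmulr_lgt0// => y0; rewrite /flat_exp ltNge (ltW y0).
- have xn := lt0r_neq0 x0.
  apply: (@is_derive_near (fun y => expR (- y^-1) * y^-1 ^+ k)) => //.
    by move=> y; rewrite pmulr_lgt0// => y0; rewrite /flat_exp y0.
  have dV : is_derive x (1 : R) (fun y => y^-1) (- x^-1 ^+ 2).
    have h := @is_deriveV R id x 1 1 xn (is_derive_id x 1).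
    by apply: (is_derive_eq h); rewrite /GRing.scale/= mulr1 exprVn.
  have dN : is_derive x (1 : R) (fun y => - y^-1) (x^-1 ^+ 2).
    by have h := is_deriveN dV; apply: (is_derive_eq h); rewrite opprK.
  have dE : is_derive x (1 : R) (fun y => expR (- y^-1)) (x^-1 ^+ 2 * expR (- x^-1)).
    have h := @is_derive1_comp _ expR (fun y => - y^-1) x _ _ (is_derive_expR (- x^-1)) dN.
    by apply: (is_derive_eq h); rewrite mulrC.
  have dX : is_derive x (1 : R) (fun y => y^-1 ^+ k) (- (k%:R * x^-1 ^+ k.+1)).
    have h := @is_deriveX _ _ (fun y : R => y^-1) k x 1 _ dV.
    rewrite (_ : (fun y => y^-1 ^+ k) = (fun y : R => y^-1) ^+ k); last first.
      by apply/funext => y; rewrite fctE.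
    apply: (is_derive_eq h); rewrite /GRing.scale/= mulrN; congr (- _).
    clear h; case: k => [|k]; first by rewrite !mul0r.
    by rewrite -mulrA -exprD addn2.
  have h := is_deriveMf dE dX.
  apply: (is_derive_eq h); rewrite /flat_exp x0.
  by rewrite !exprS; ring.
- have -> : flat_exp k.+2 0 - k%:R * flat_exp k.+1 0 = 0 :> R.
    by rewrite /flat_exp ltxx mulr0 subrr.
  have c : (fun t : R => t^-1 *: (flat_exp k (t *: 1 + 0) - flat_exp k 0)) @ 0^' --> (0 : R).
    apply/cvgrPdist_le => e e0.
    have C0 : 0 < (k.+2)`!%:R :> R by rewrite ltr0n fact_gt0.
    have : \forall t \near (0 : R)^', `|t| <= e / (k.+2)`!%:R.
      by apply: dnbhs0_le; rewrite divr_gt0.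
    move=> hn; near=> t.
    have t0 : t != 0 by near: t; exact: nbhs_dnbhs_neq.
    rewrite sub0r normrN addr0 /GRing.scale/= mulr1.
    have -> : t^-1 * (flat_exp k t - flat_exp k 0) = flat_exp k.+1 t.
      by rewrite /flat_exp ltxx subr0; case: ifP => _; [rewrite exprS; ring|rewrite mulr0].
    apply: le_trans (flat_exp_le k.+1 t) _.
    by rewrite mulrC -ler_pdivlMr//; near: t.
  apply: DeriveDef; first by apply/cvg_ex; exists 0; exact: c.
  exact/cvg_lim.
Unshelve. all: end_near. Qed.

Lemma flat_exp_smooth k : smooth (flat_exp k).
Proof.
move=> n; elim: n k => [|n ih] k.
  by split=> [x|//]; have [] := flat_exp_derive k x.
apply: Cn_intro (fun x => flat_exp_derive k x) _.
have := CnD (ih k.+2) (CnZ (- k%:R) (ih k.+1)); congr Cn.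
by apply/funext => x; rewrite mulNr.
Qed.

Definition bump x : R := flat_exp 0 (1 + x) * flat_exp 0 (1 - x).

Lemma flat_exp_ge0 k x : 0 <= flat_exp k x.
Proof.
rewrite /flat_exp; case: ifPn => // x0.
by rewrite mulr_ge0 ?expR_ge0// exprn_ge0// invr_ge0 ltW.
Qed.

Lemma bump_ge0 x : 0 <= bump x.
Proof. by rewrite mulr_ge0 ?flat_exp_ge0. Qed.

Lemma bumpN x : bump (- x) = bump x.
Proof. by rewrite /bump opprK mulrC. Qed.

Lemma bump_test : test_fun bump.
Proof.
apply/test_funP; split.
  move=> n; apply: CnM.
    have := @Cn_affine R n 1 1 _ (flat_exp_smooth 0 n); congr Cn.
    by apply/funext => x; rewrite mul1r addrC.
  have := @Cn_affine R n (-1) 1 _ (flat_exp_smooth 0 n); congr Cn.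
  by apply/funext => x; rewrite mulN1r addrC.
exists 1 => x; rewrite lter_normr => /orP[h|h].
  by rewrite /bump /flat_exp [0 < 1 - x]ltNge subr_le0 (ltW h)/= mulr0.
by rewrite /bump /flat_exp [0 < 1 + x]ltNge -{1}[x]opprK subr_le0 (ltW h)/= mul0r.
Qed.

Lemma Int_bump_gt0 : 0 < \int[mu]_x bump x.
Proof.
pose c := expR (- 2) * expR (- 2) : R.
have c0 : 0 < c by rewrite mulr_gt0 ?expR_gt0.
have hb x : x \in `[- 2^-1, 2^-1]%classic -> c <= bump x.
  rewrite inE/= in_itv/= => /andP[h1 h2].
  have flat_ge y : 2^-1 <= y -> expR (- 2) <= flat_exp 0 y.
    move=> hy; have y0 : 0 < y by apply: lt_le_trans hy; rewrite invr_gt0.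
    rewrite /flat_exp y0 expr0 mulr1 ler_expR lerN2 -[leRHS]invrK lef_pV2 ?posrE ?invr_gt0//.
  by apply: ler_pM; rewrite ?expR_ge0//; apply: flat_ge; lra.
have mI : measurable (`[- 2^-1, 2^-1]%classic : set RM) by [].
have iI : intg mu (fun x => c * \1_(`[- 2^-1, 2^-1]%classic) x).
  by apply: intgZ; exact: integrable_indic_itv.
apply: (@lt_le_trans _ _ (\int[mu]_x (c * \1_(`[- 2^-1, 2^-1]%classic) x))).
  rewrite IntZ; last exact: integrable_indic_itv.
  have hm : mu (`[- 2^-1, 2^-1]%classic : set RM) = 1%:E.
    by rewrite lebesgue_measure_itv/= lte_fin ifT -?EFinD; [congr EFin; field|lra].
  have -> : \int[mu]_x \1_(`[- 2^-1, 2^-1]%classic) x = 1.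
    by rewrite /Rintegral integral_indic// setIT; exact: (congr1 fine hm).
  by rewrite mulr1.
apply: Int_le => //; first exact/test_intg/bump_test.
move=> x; rewrite indicE; case: (boolP (_ \in _)) => [/hb|_]; first by rewrite mulr1.
by rewrite mulr0 bump_ge0.
Qed.

Definition moll (n : nat) x : R :=
  n.+1%:R / (\int[mu]_x bump x) * bump (n.+1%:R * x).

Lemma moll_test n : test_fun (moll n).
Proof.
apply: test_funZ; have := @test_fun_affine R n.+1%:R 0 _ _ bump_test.
rewrite pnatr_eq0 => /(_ isT); congr test_fun.
by apply/funext => x; rewrite addr0.
Qed.

Lemma moll_ge0 n x : 0 <= moll n x.
Proof. by rewrite mulr_ge0 ?bump_ge0// divr_ge0// ltW// Int_bump_gt0. Qed.

Lemma mollN n x : moll n (- x) = moll n x.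
Proof. by rewrite /moll mulrN bumpN. Qed.

Lemma Int_moll n : \int[mu]_x moll n x = 1.
Proof.
have n0 : 0 < n.+1%:R :> R by [].
rewrite IntZ; last first.
  have := @intg_affine R n.+1%:R 0 _ n0 (test_intg bump_test); congr intg.
  by apply/funext => x; rewrite addr0.
rewrite (_ : \int[mu]_x bump (n.+1%:R * x) = n.+1%:R^-1 * \int[mu]_x bump x).
  have h := lt0r_neq0 Int_bump_gt0; have n1 := lt0r_neq0 n0.
  by rewrite mulrACA divff// mulVf// mul1r.
rewrite -(@Int_affine R n.+1%:R 0 _ n0 (test_intg bump_test)).
by congr Rintegral; apply/funext => x; rewrite addr0.
Qed.

Lemma vanish_moll n : vanish n.+1%:R^-1 (moll n).
Proof.
move=> x hx; rewrite /moll; have n0 : 0 < n.+1%:R :> R by [].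
have {}hx : 1 < `|n.+1%:R * x|.
  by rewrite normrM (gtr0_norm n0) mulrC -ltr_pdivrMr// div1r.
have -> : bump (n.+1%:R * x) = 0; last by rewrite mulr0.
move: hx; rewrite lter_normr => /orP[h|h].
  by rewrite /bump /flat_exp [0 < 1 - _]ltNge subr_le0 (ltW h)/= mulr0.
by rewrite /bump /flat_exp [0 < 1 + _]ltNge -{1}[_ * x]opprK subr_le0 (ltW h)/= mul0r.
Qed.

Lemma moll_le : exists C, 0 < C /\ forall n x, moll n x <= C * n.+1%:R.
Proof.
have [M [M0 hM]] := test_bounded bump_test.
exists (M / \int[mu]_x bump x); split; first by rewrite divr_gt0// Int_bump_gt0.
move=> n x; rewrite /moll mulrC [leRHS]mulrAC -[leRHS]mulrA.
apply: ler_wpM2r; first by rewrite divr_ge0// ltW// Int_bump_gt0.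
by apply: le_trans (hM _); exact: ler_norm.
Qed.

(** * Almost everywhere convergence of mollifications *)

Definition locint f : Prop := mble f /\
  forall S, intg mu (fun x => f x * \1_(`[- S, S]%classic) x).

Lemma bounded_locint f M : mble f -> (forall x, `|f x| <= M) -> locint f.
Proof.
move=> mf fM; split=> // S; apply: (@intg_bddM _ RM R mu M) => //.
exact: integrable_indic_itv.
Qed.

Lemma sqi_locint f : sqi mu f -> locint f.
Proof.
move=> hf; split; first exact: hf.1.
move=> S; apply: sqi_mul => //; split; first exact: measurable_indic.
have := @integrable_indic_itv R (- S) S true false; congr intg.
by apply/funext => x /=; rewrite indicE; case: (_ \in _); rewrite ?expr0n ?expr1n.
Qed.

Lemma locint_intg_test f g : locint f -> test_fun g -> intg mu (fun x => g x * f x).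
Proof.
move=> [mf lf] tg; have [M [_ gM]] := test_bounded tg.
have [_ [S vS]] := (test_funP g).1 tg.
have := @intg_bddM _ RM R mu M g _ (test_mble tg) (lf S) gM; congr intg.
apply/funext => x; rewrite indicE; case: (boolP (_ \in _)) => h; first by rewrite mulr1.
rewrite vS ?mul0r// ltNge; apply/negP => xS; move/negP: h; apply.
by rewrite inE/= in_itv/= -ler_norml.
Qed.

Lemma locint_locally f : locint f -> locally_integrable setT f.
Proof.
move=> [mf lf]; split; [exact: mf|exact: openT|].
move=> K _ cK; have [M [_ hM]] := compact_bounded cK.
have mK : measurable (K : set RM) by exact: compact_measurable.
rewrite integral_mkcond.
have /integrableP[_] := lf (M + 1); apply: le_lt_trans.
apply: ge0_le_integral => //.
- by move=> x _; rewrite /patch; case: ifP => // _; rewrite lee_fin.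
- apply/(measurable_restrictT _ _).1 => //.
  by apply/measurable_EFinP/measurableT_comp => //; exact: measurable_funS mf.
- do 2 apply: measurableT_comp => //.
  by apply: measurable_funM => //; exact: measurable_indic.
- move=> x _; rewrite /patch; case: ifPn => [xK|_] /=; rewrite lee_fin//.
  rewrite indicE mem_set ?mulr1//= in_itv/= -ler_norml.
  by apply: (hM (M + 1)); [rewrite ltrDl|rewrite inE in xK].
Qed.

Lemma conv_symE (k f : R -> R) x : intg mu (fun y => (k y * f (x - y) : R)) ->
  convol k f x = \int[mu]_y ((k (x - y) * f y) : R).
Proof.
move=> h; rewrite /convol -(Int_refl x h); congr Rintegral.
by apply/funext => y; rewrite opprB addrCA subrr addr0.
Qed.

Lemma locint_conv f g x : locint f -> test_fun g ->
  intg mu (fun y => g y * f (x - y)).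
Proof.
move=> lf tg.
have := intg_refl x (locint_intg_test lf (test_fun_refl x tg)); congr intg.
by apply/funext => y; rewrite opprB addrCA subrr addr0.
Qed.

(** At a Lebesgue point the error is at most a constant times the mean of
    [|f - f x|] over the ball of radius [2 / (n + 1)]. *)
Lemma conv_moll_cvg f : locint f ->
  {ae mu, forall x, (fun n => convol (moll n) f x) @ \oo --> f x}.
Proof.
move=> lf; have hae := lebesgue_differentiation (locint_locally lf).
apply: ae_imp hae => x.
have [C [C0 hC]] := moll_le.
rewrite /lebesgue_pt => hl.
pose r n : R := 2 / n.+1%:R.
have r0 n : 0 < r n by rewrite divr_gt0.
have cr : r @ \oo --> (0 : R).
  rewrite -[X in _ --> X](mulr0 2); apply: cvgMr; exact: cvg_harmonic.
have cr' : r @ \oo --> 0^'+.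
  move=> U; rewrite /at_right /within/= => /cr hU.
  have : \forall n \near \oo, 0 < r n -> U (r n) by exact: hU.
  by apply: filterS => n; exact.
(* [davg f x r] is the mean of [|f - f x|] over the ball of radius [r]. *)
have hd : (fun n => davg f x (r n)) @ \oo --> 0%E by exact: cvg_comp cr' hl.
have mf := lf.1.
have key n : (`|convol (moll n) f x - f x|%:E <= (4 * C)%:E * davg f x (r n))%E.
  have i1 := locint_conv x lf (moll_test n).
  have i2 : intg mu (fun y => moll n y * f x).
    have := intgZ (f x) (test_intg (moll_test n)); congr intg.
    by apply/funext => y; rewrite mulrC.
  have -> : convol (moll n) f x - f x = \int[mu]_z (moll n (x - z) * (f z - f x)).
    have -> : f x = \int[mu]_y (moll n y * f x).
      rewrite (_ : (fun y => _) = (fun y => f x * moll n y)); last first.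
        by apply/funext => y; rewrite mulrC.
      by rewrite IntZ ?Int_moll ?mulr1//; exact/test_intg/moll_test.
    rewrite /convol -IntB// -(Int_refl x (intgB i1 i2)).
    congr Rintegral; apply/funext => z.
    rewrite opprB addrCA subrr addr0 -mulrBr.
    rewrite (_ : (fun y => _) = (fun y => f x * moll n y)); last first.
      by apply/funext => y; rewrite mulrC.
    by rewrite IntZ ?Int_moll ?mulr1//; exact/test_intg/moll_test.
  have iF : intg mu (fun z => moll n (x - z) * (f z - f x)).
    have := intg_refl x (intgB i1 i2); congr intg; apply/funext => z.
    by rewrite opprB addrCA subrr addr0 -mulrBr.
  have mB : measurable (ball x (r n) : set RM) by exact: measurable_ball.
  have mfx : mble (fun z => `|f z - f x|).
    by apply: measurableT_comp => //; apply: measurable_funB.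
  rewrite EFin_normr_Rintegral//; apply: le_trans (le_abse_integral _ _ _) _ => //.
    by apply/measurable_EFinP; exact: intg_meas iF.
  rewrite /davg /iavg lebesgue_measure_ball ?(ltW (r0 n))//.
  rewrite inver ifF; last by apply/negbTE; rewrite mulrn_eq0/= gt_eqF.
  rewrite muleA -EFinM.
  rewrite -ge0_integralZl//; last 2 first.
  - apply/measurable_EFinP; apply: measurable_funS mfx => //.
  - by rewrite lee_fin !mulr_ge0// ?(ltW C0)// invr_ge0 mulrn_wge0// ltW.
  rewrite [leRHS]integral_mkcond; apply: ge0_le_integral => //.
  - by apply: measurableT_comp => //; apply/measurable_EFinP; exact: intg_meas iF.
  - apply/(measurable_restrictT _ _).1 => //.
    apply/measurable_EFinP; apply: measurable_funS (measurable_funM _ mfx) => //.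
  - move=> z _; rewrite /patch; case: ifPn => zB.
      rewrite /= -EFinM lee_fin normrM ler_wpM2r// ger0_norm ?moll_ge0//.
      apply: le_trans (hC n (x - z)) _; rewrite le_eqVlt; apply/orP; left; apply/eqP.
      have n1 : n.+1%:R != 0 :> R by rewrite pnatr_eq0.
      by rewrite /r mulr2n; move: n.+1%:R n1 => w n1; field; rewrite ?n1.
    rewrite (_ : moll n (x - z) = 0); first by rewrite mul0r /= normr0.
    apply: vanish_moll; rewrite ltNge; apply/negP => h; move/negP: zB; apply.
    rewrite inE /ball/=; apply: le_lt_trans h _.
    by rewrite /r -[ltLHS]mul1r ltr_pM2r ?invr_gt0// ltr1n.
apply/cvgrPdist_le => e e0.
have c4 : (fun n => (4 * C)%:E * davg f x (r n))%E @ \oo --> 0%E.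
  by rewrite -(mule0 (4 * C)%:E); apply: cvgeZl.
have : \forall n \near \oo, ((4 * C)%:E * davg f x (r n) < e%:E)%E.
  have nb : nbhs (0%E : \bar R) [set z | (z < e%:E)%E].
    apply: open_nbhs_nbhs; split; first exact: open_ereal_lt_ereal.
    by rewrite /= lte_fin.
  exact: (c4 _ nb).
apply: filterS => n hn; rewrite distrC -lee_fin.
exact: le_trans (key n) (ltW hn).
Qed.

End Bump.

(** * Second differences *)

Section SecondDifference.
Context {R : realType}.
Implicit Types (f g : R -> R) (a b c s t x y M S K C : R).
Notation mu := (@lebesgue_measure R).
Notation RM := (measurableTypeR R).
Notation mble f := (measurable_fun (@setT RM) (f : RM -> R)).
Notation mble2 f := (measurable_fun (@setT (RM * RM)) (f : RM * RM -> R)).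

Definition dlt t f x : R := f x - (f (x + t) + f (x - t)) / 2.

Lemma mvt_bound f g a x : (forall y, is_derive (y : R) (1 : R) f (g y)) ->
  exists2 t : R, 0 <= t <= 1 & f (x + a) - f x = a * g (x + t * a).
Proof.
move=> fg.
have cf : continuous f.
  by move=> y; apply: differentiable_continuous; apply/derivable1_diffP; have [] := fg y.
have [a0|a0|a0] := ltgtP 0 a.
- have [|c] := @MVT_segment R f g x (x + a) _ (fun y _ => fg y) (continuous_subspaceT cf).
    by rewrite lerDl ltW.
  rewrite in_itv/= => /andP[h1 h2] h; exists ((c - x) / a).
    by rewrite ler_pdivlMr// ler_pdivrMr// mul0r; lra.
  by rewrite h divfK ?gt_eqF// [x + (c - x)]addrC subrK; ring.
- have [|c] := @MVT_segment R f g (x + a) x _ (fun y _ => fg y) (continuous_subspaceT cf).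
    by rewrite gerDl ltW.
  rewrite in_itv/= => /andP[h1 h2] h; exists ((c - x) / a).
    by rewrite ler_ndivlMr// ler_ndivrMr// mul0r; lra.
  by rewrite divfK ?lt_eqF// [x + (c - x)]addrC subrK -opprB h; ring.
- by exists 0; [rewrite lexx ler01|rewrite -a0 addr0 subrr mul0r].
Qed.

(** The mean value theorem, three times. *)
Lemma dlt_le f f1 f2 s x K : (forall y : R, is_derive y (1 : R) f (f1 y)) ->
  (forall y : R, is_derive y (1 : R) f1 (f2 y)) ->
  (forall y, `|y - x| <= `|s| -> `|f2 y| <= K) -> `|dlt s f x| <= K * s ^+ 2.
Proof.
move=> h1 h2 hK.
have [t1 /andP[t10 t11] e1] := mvt_bound s x h1.
have [t2 /andP[t20 t21] e2] := mvt_bound (- s) x h1.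
set y1 := x + t1 * s in e1; set y2 := x + t2 * - s in e2.
have [t3 /andP[t30 t31] e3] := mvt_bound (y1 - y2) y2 h2.
set y3 := y2 + t3 * (y1 - y2) in e3.
have s0 := normr_ge0 s.
have d12 : `|y1 - y2| <= 2 * `|s|.
  have -> : y1 - y2 = (t1 + t2) * s by rewrite /y1 /y2; ring.
  by rewrite normrM ger0_norm ?addr_ge0//; nra.
have e : y2 + (y1 - y2) = y1 by ring.
rewrite e in e3.
have -> : dlt s f x = - (s * ((y1 - y2) * f2 y3)) / 2.
  by rewrite -e3 /dlt; move: e1 e2; lra.
have hy3 : `|f2 y3| <= K.
  apply: hK; have -> : y3 - x = (t3 * t1 - (1 - t3) * t2) * s.
    by rewrite /y3 /y1 /y2; ring.
  rewrite normrM -[leRHS]mul1r ler_wpM2r// ler_norml.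
  have q1 : t3 * t1 <= t3 by rewrite ler_piMr.
  have q2 : (1 - t3) * t2 <= 1 - t3 by rewrite ler_piMr// subr_ge0.
  have q3 : 0 <= t3 * t1 by rewrite mulr_ge0.
  have q4 : 0 <= (1 - t3) * t2 by rewrite mulr_ge0// subr_ge0.
  by lra.
have s2 : s ^+ 2 = `|s| ^+ 2 by rewrite real_normK// num_real.
rewrite s2 normrM normrN !normrM [`|2^-1|]ger0_norm ?invr_ge0//.
have := normr_ge0 (y1 - y2); have := normr_ge0 (f2 y3).
move: d12 hy3 s0; move: `|s| `|y1 - y2| `|f2 y3| => p q r q2 rK p0 r0 q0.
have : q * r <= 2 * p * K by apply: ler_pM.
by nra.
Qed.

(** The weight absorbs the supports: it is integrable, and its values at
    distance at most one are comparable. *)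
Definition wgt x : R := (1 + x ^+ 2)^-1.

Lemma wgt_gt0 x : 0 < wgt x.
Proof. by rewrite invr_gt0 ltr_wpDr// sqr_ge0. Qed.

Lemma wgt_le1 x : wgt x <= 1.
Proof. by rewrite invf_le1 ?lerDl ?sqr_ge0// ltr_wpDr// sqr_ge0. Qed.

(** Nonnegative weights whose values at distance at most one are comparable: a
    pointwise bound by such a weight survives the local mean value theorem. *)
Definition slow (W : R -> R) := (forall x, 0 <= W x) /\
  forall x y, `|y - x| <= 1 -> W y <= 3 * W x.

Lemma slow_wgt : slow wgt.
Proof.
split=> [x|x y hxy]; first exact/ltW/wgt_gt0.
have hx : 0 < 1 + x ^+ 2 by rewrite ltr_wpDr// sqr_ge0.
have hy : 0 < 1 + y ^+ 2 by rewrite ltr_wpDr// sqr_ge0.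
rewrite /wgt ler_pdivlMr// mulrC ler_pdivrMr//.
move: hxy; rewrite ler_norml => /andP[? ?].
have : (y - x) ^+ 2 <= 1 by nra.
have h2 := sqr_ge0 (2 * y - x); move=> h1.
have e2 : x ^+ 2 = 2 * y ^+ 2 + 2 * (y - x) ^+ 2 - (2 * y - x) ^+ 2 by ring.
by rewrite e2; have := sqr_ge0 y; lra.
Qed.

Definition sum3 t (W : R -> R) x := W x + W (x + t) + W (x - t).

Lemma slow_sum3 t W : slow W -> slow (sum3 t W).
Proof.
move=> [W0 hW]; split=> [x|x y hxy]; first by rewrite /sum3 !addr_ge0.
have h1 := hW _ _ hxy.
have h2 : W (y + t) <= 3 * W (x + t).
  by apply: hW; rewrite (_ : y + t - (x + t) = y - x)//; ring.
have h3 : W (y - t) <= 3 * W (x - t).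
  by apply: hW; rewrite (_ : y - t - (x - t) = y - x)//; ring.
by rewrite /sum3; lra.
Qed.

Lemma slowZ C W : 0 <= C -> slow W -> slow (fun x => C * W x).
Proof.
move=> C0 [W0 hW]; split=> [x|x y /hW h]; first by rewrite mulr_ge0.
by rewrite mulrCA ler_wpM2l.
Qed.

(** The gain of a second difference: quadratic for small steps, bounded for large
    ones. *)
Definition bmin s : R := Num.min 1 (s ^+ 2).

Lemma bmin_ge0 s : 0 <= bmin s.
Proof. by rewrite le_min ler01 sqr_ge0. Qed.

(** For steps at most one the second derivative is used, for larger ones the size of
    [f]. *)
Lemma dlt_slow f f1 f2 W s x : (forall y : R, is_derive y (1 : R) f (f1 y)) ->
  (forall y : R, is_derive y (1 : R) f1 (f2 y)) -> slow W ->
  (forall x, `|f x| <= W x) -> (forall x, `|f2 x| <= W x) ->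
  `|dlt s f x| <= 3 * bmin s * sum3 s W x.
Proof.
move=> h1 h2 [W0 hW] fW f2W; have p0 := W0 x; have p1 := W0 (x + s); have p2 := W0 (x - s).
have [s1|s1] := leP `|s| 1.
  have hK y : `|y - x| <= `|s| -> `|f2 y| <= 3 * W x.
    by move=> h; apply: le_trans (f2W y) _; apply: hW; exact: le_trans h s1.
  have s2 : s ^+ 2 <= 1 by rewrite -(real_normK (num_real s)) expr_le1.
  apply: le_trans (dlt_le h1 h2 hK) _.
  rewrite /bmin min_r// /sum3; have := sqr_ge0 s; nra.
have s2 : 1 <= s ^+ 2 by rewrite -(real_normK (num_real s)) expr_ge1// ltW.
rewrite /bmin min_l// mulr1 /dlt /sum3.
apply: le_trans (ler_normB _ _) _; rewrite normrM [`|2^-1|]ger0_norm ?invr_ge0//.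
have := ler_normD (f (x + s)) (f (x - s)).
have := fW x; have := fW (x + s); have := fW (x - s); lra.
Qed.

Lemma test_wgt f : test_fun f -> exists C : R, 0 <= C /\ forall x, `|f x| <= C * wgt x.
Proof.
move=> tf; have [M [M0 fM]] := test_bounded tf.
have [_ [S vS]] := (test_funP f).1 tf.
exists (M * (1 + S ^+ 2)); split; first by rewrite mulr_ge0 ?ltW// ltr_wpDr// sqr_ge0.
move=> x; rewrite /wgt ler_pdivlMr ?ltr_wpDr ?sqr_ge0//.
have [xS|xS] := ltP S `|x|.
  by rewrite vS// normr0 mul0r mulr_ge0 ?ltW// ltr_wpDr// sqr_ge0.
apply: ler_pM => //; first by rewrite addr_ge0// sqr_ge0.
by rewrite lerD2l -(real_normK (num_real x)) lerXn2r// nnegrE// (le_trans _ xS).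
Qed.

Lemma dlt_derive f f1 t x : (forall y : R, is_derive y (1 : R) f (f1 y)) ->
  is_derive x (1 : R) (dlt t f) (dlt t f1 x).
Proof.
move=> h.
have h1 : is_derive x (1 : R) (fun x => f (1 * x + t)) (1 * f1 (x + t)).
  by apply: is_derive_comp_affine; rewrite mul1r.
have h2 : is_derive x (1 : R) (fun x => f (1 * x - t)) (1 * f1 (x - t)).
  by apply: is_derive_comp_affine; rewrite mul1r.
have h3 := is_deriveMf (is_derive_cst (- 2^-1 : R) x 1) (is_deriveDf h1 h2).
have h4 := is_deriveDf (h x) h3.
rewrite (_ : dlt t f = fun y => f y + cst (- 2^-1 : R) y * (f (1 * y + t) + f (1 * y - t))).
  by apply: (is_derive_eq h4); rewrite /dlt/= !mul1r; ring.
by apply/funext => y; rewrite /dlt/= !mul1r; ring.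
Qed.

Lemma test_dlt t f : test_fun f -> test_fun (dlt t f).
Proof.
move=> tf; have := test_funB tf (test_funZ (2^-1)
  (test_funD (test_fun_shift t tf) (test_fun_shift (- t) tf))).
by congr test_fun; apply/funext => x; rewrite /dlt mulrC.
Qed.

Lemma test_derivatives f : test_fun f -> exists f1 f2, [/\ test_fun f2,
  (forall y : R, is_derive y (1 : R) f (f1 y)) &
  (forall y : R, is_derive y (1 : R) f1 (f2 y))].
Proof.
move=> tf; exists (derive1 f), (derive1 (derive1 f)).
have t1 := test_fun_derive tf; split; first exact: test_fun_derive.
  by move=> y; exact: smooth_is_derive (test_smooth tf).
by move=> y; exact: smooth_is_derive (test_smooth t1).
Qed.

Lemma dlt_test_le f : test_fun f -> exists C : R, 0 <= C /\
  forall s x, `|dlt s f x| <= C * bmin s * sum3 s wgt x.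
Proof.
move=> tf; have [f1 [f2 [t2 h1 h2]]] := test_derivatives tf.
have [C [C0 fC]] := test_wgt tf; have [C' [C0' fC']] := test_wgt t2.
have CC : 0 <= C + C' by rewrite addr_ge0.
exists (3 * (C + C')); split; first by rewrite mulr_ge0.
move=> s x; have := dlt_slow s x h1 h2 (slowZ CC slow_wgt) _ _.
rewrite /sum3 -!mulrDr mulrACA mulrA; apply => y.
  by apply: le_trans (fC y) _; rewrite ler_wpM2r//; [exact/ltW/wgt_gt0|rewrite lerDl].
by apply: le_trans (fC' y) _; rewrite ler_wpM2r//; [exact/ltW/wgt_gt0|rewrite lerDr].
Qed.

Lemma dlt_dlt_test_le f : test_fun f -> exists C : R, 0 <= C /\
  forall s t x, `|dlt s (dlt t f) x| <=
    C * bmin s * bmin t * sum3 s (sum3 t wgt) x.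
Proof.
move=> tf; have [f1 [f2 [t2 h1 h2]]] := test_derivatives tf.
have [C [C0 fC]] := dlt_test_le tf; have [C' [C0' fC']] := dlt_test_le t2.
have CC : 0 <= C + C' by rewrite addr_ge0.
exists (3 * (C + C')); split; first by rewrite mulr_ge0.
move=> s t x.
have CCt : 0 <= (C + C') * bmin t by rewrite mulr_ge0// bmin_ge0.
have sw := slow_sum3 t slow_wgt.
have := @dlt_slow _ _ _ _ s x (fun y => dlt_derive t y h1) (fun y => dlt_derive t y h2)
  (slowZ CCt sw) _ _.
have -> : sum3 s (fun x => (C + C') * bmin t * sum3 t wgt x) x =
  (C + C') * bmin t * sum3 s (sum3 t wgt) x by rewrite {1 3}/sum3; ring.
rewrite (_ : 3 * bmin s * ((C + C') * bmin t * sum3 s (sum3 t wgt) x) =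
  3 * (C + C') * bmin s * bmin t * sum3 s (sum3 t wgt) x); last by ring.
apply => y.
  apply: le_trans (fC t y) _; rewrite ler_wpM2r ?sw.1// ler_wpM2r ?bmin_ge0//.
  by rewrite lerDl.
apply: le_trans (fC' t y) _; rewrite ler_wpM2r ?sw.1// ler_wpM2r ?bmin_ge0//.
by rewrite lerDr.
Qed.

End SecondDifference.

(** * Explicit integrals *)

Section Explicit.
Context {R : realType}.
Implicit Types (f g F : R -> R) (a b c s t x y M S K C e : R).
Notation mu := (@lebesgue_measure R).
Notation RM := (measurableTypeR R).
Notation mble f := (measurable_fun (@setT RM) (f : RM -> R)).

Lemma continuous_mble f : continuous f -> mble f.
Proof. exact: continuous_measurable_fun. Qed.

Lemma ge0_intg f v : mble f -> (forall x, 0 <= f x) ->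
  (\int[mu]_x (f x)%:E = v%:E)%E -> intg mu f /\ \int[mu]_x f x = v.
Proof.
move=> mf f0 key.
have if_ : intg mu f.
  apply/integrableP; split; first exact/measurable_EFinP.
  have -> : (\int[mu]_x `|(EFin \o f) x| = \int[mu]_x (f x)%:E)%E.
    by apply: eq_integral => x _ /=; rewrite ger0_norm.
  by rewrite key ltry.
by split=> //; apply/EFin_inj; rewrite -Int_EFin.
Qed.

(** Reduction of an integral over the line to a primitive on the half-line. *)
Lemma even_FTC f F l : (forall x, 0 <= f x) -> continuous f ->
  (forall x, f (- x) = f x) -> F x @[x --> +oo] --> l ->
  continuous F ->
  (forall x : R, 0 < x -> is_derive x (1 : R) F (f x)) ->
  intg mu f /\ \int[mu]_x f x = 2 * (l - F 0).
Proof.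
move=> f0 cf ef Fl cF dF.
apply: ge0_intg => //; first exact: continuous_mble.
rewrite ge0_symfun_integralT//; last by move=> x; rewrite /= ef.
rewrite -set_itvcy (@ge0_continuous_FTC2y _ _ F _ l)//.
- exact: continuous_subspaceT.
- by move=> x x0; have [] := dF x x0.
- by apply: cvg_at_right_filter; exact: cF.
- move=> x; rewrite in_itv/= andbT => x0.
  by rewrite derive1E; have [] := dF x x0.
Qed.

Lemma wgt_integral : intg mu wgt /\ \int[mu]_x (wgt x : R) = pi.
Proof.
have cw : continuous (wgt : R -> R) by exact: continuous_oneDsqrV.
apply: ge0_intg.
- exact: continuous_mble.
- by move=> x; exact/ltW/wgt_gt0.
rewrite ge0_symfun_integralT//.
- by rewrite -set_itvcy integral0y_oneDsqr -EFinM; congr EFin; field.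
- by move=> x; exact/ltW/wgt_gt0.
- by move=> x; rewrite /wgt/= sqrrN.
Qed.

Lemma intg_wgt : intg mu wgt. Proof. by case: wgt_integral. Qed.

Lemma Int_wgt : \int[mu]_x (wgt x : R) = pi. Proof. by case: wgt_integral. Qed.

(** The factor [1 + cos] instead of [cos] makes the integrand nonnegative, so that a
    primitive also gives integrability. *)
Lemma exp_cos_aux e a : 0 < e ->
  intg mu (fun x => expR (- (e * `|x|)) * (1 + cos (a * x))) /\
  \int[mu]_x (expR (- (e * `|x|)) * (1 + cos (a * x))) =
    2 * (e / (e ^+ 2 + a ^+ 2) + e^-1).
Proof.
move=> e0; have en := lt0r_neq0 e0.
have D0 : 0 < e ^+ 2 + a ^+ 2 by rewrite ltr_wpDr ?sqr_ge0// exprn_gt0.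
have Dn := lt0r_neq0 D0.
pose H x := (a * sin (a * x) - e * cos (a * x)) / (e ^+ 2 + a ^+ 2) - e^-1.
pose F x := expR (- e * x) * H x.
have dE (x : R) : is_derive x (1 : R) (fun y => expR (- e * y)) (- e * expR (- e * x)).
  have := @is_derive_comp_affine R expR (- e) 0 _ x (is_derive_expR _).
  by rewrite addr0; under eq_fun do rewrite addr0.
have dc (x : R) : is_derive x (1 : R) (fun y => cos (a * y)) (a * - sin (a * x)).
  have := @is_derive_comp_affine R (@cos R) a 0 _ x (is_derive_cos _).
  by rewrite addr0; under eq_fun do rewrite addr0.
have ds (x : R) : is_derive x (1 : R) (fun y => sin (a * y)) (a * cos (a * x)).
  have := @is_derive_comp_affine R (@sin R) a 0 _ x (is_derive_sin _).
  by rewrite addr0; under eq_fun do rewrite addr0.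
have dH (x : R) : is_derive x (1 : R) H
    ((a * (a * cos (a * x)) + e * (a * sin (a * x))) / (e ^+ 2 + a ^+ 2)).
  have h1 := is_deriveMf (is_derive_cst (a / (e ^+ 2 + a ^+ 2)) x 1) (ds x).
  have h2 := is_deriveMf (is_derive_cst (- (e / (e ^+ 2 + a ^+ 2))) x 1) (dc x).
  have h := is_deriveDf (is_deriveDf h1 h2) (is_derive_cst (- e^-1) x 1).
  rewrite (_ : H = (fun y => cst (a / (e ^+ 2 + a ^+ 2)) y * sin (a * y) +
    cst (- (e / (e ^+ 2 + a ^+ 2))) y * cos (a * y) + cst (- e^-1) y)); last first.
    by apply/funext => y; rewrite /H /=; ring.
  by apply: (is_derive_eq h); rewrite /=; ring.
have dF (x : R) : is_derive x (1 : R) F (expR (- e * x) * (1 + cos (a * x))).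
  by apply: (is_derive_eq (is_deriveMf (dE x) (dH x))); rewrite /H; field; exact/andP.
have cF : continuous F.
  by move=> y; apply: differentiable_continuous; apply/derivable1_diffP; have [] := dF y.
have cc b : continuous (fun x => cos (b * x)).
  move=> x; apply: (@continuous_comp _ _ _ ( *%R b) (@cos R)); first exact: mulrl_continuous.
  exact: continuous_cos.
have Hb x : `|H x| <= (`|a| + e) / (e ^+ 2 + a ^+ 2) + e^-1.
  have e1 : 0 <= e^-1 by rewrite invr_ge0 ltW.
  have D1 : 0 <= (e ^+ 2 + a ^+ 2)^-1 by rewrite invr_ge0 ltW.
  rewrite /H; apply: le_trans (ler_normB _ _) _; rewrite (ger0_norm e1) lerD2r.
  rewrite normrM (ger0_norm D1) ler_wpM2r//; apply: le_trans (ler_normB _ _) _.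
  by rewrite !normrM (gtr0_norm e0) lerD// ler_piMr ?sin_max ?cos_max// ltW.
have Fl : F x @[x --> +oo] --> (0 : R).
  apply/cvgrPdist_le => d d0.
  pose B := (`|a| + e) / (e ^+ 2 + a ^+ 2) + e^-1.
  have B0 : 0 < B.
    have e1 : 0 < e^-1 by rewrite invr_gt0.
    apply: ltr_wpDl => //; apply: divr_ge0; last exact: ltW.
    by apply: addr_ge0 => //; exact: ltW.
  near=> x.
  have hx : B / d / e <= x by near: x; apply: nbhs_pinfty_ge; exact: num_real.
  rewrite sub0r normrN /F normrM (gtr0_norm (expR_gt0 _)).
  apply: (@le_trans _ _ (expR (- e * x) * B)).
    by rewrite ler_wpM2l ?expR_ge0.
  rewrite -ler_pdivlMr// mulNr expRN invf_ple ?posrE ?expR_gt0 ?divr_gt0//.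
  rewrite invf_div; apply: le_trans (expR_ge1Dx _); rewrite ler_wpDl//.
  by rewrite [e * x]mulrC -ler_pdivrMr.
have ef x : expR (- (e * `|- x|)) * (1 + cos (a * - x)) =
    expR (- (e * `|x|)) * (1 + cos (a * x)).
  by rewrite normrN mulrN cosN.
have [] := @even_FTC (fun x => expR (- (e * `|x|)) * (1 + cos (a * x))) F 0 _ _ ef Fl cF.
- by move=> x; rewrite mulr_ge0 ?expR_ge0//; have := cos_geN1 (a * x); lra.
- move=> x; apply: cvgM.
    apply: (@continuous_comp _ _ _ (fun x => - (e * `|x|)) expR); last exact: continuous_expR.
    apply: cvgN; apply: cvgMr; exact: norm_continuous.
  by apply: cvgD; [exact: cvg_cst|exact: cc].
- by move=> x x0; rewrite (gtr0_norm x0) -mulNr; exact: dF.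
move=> h1 h2; split => //; rewrite h2 /F /H !mulr0 sin0 cos0 expR0.
by field; exact/andP.
Unshelve. all: end_near. Qed.

Lemma exp_cos e a : 0 < e ->
  intg mu (fun x => expR (- (e * `|x|)) * cos (a * x)) /\
  \int[mu]_x (expR (- (e * `|x|)) * cos (a * x)) = 2 * e / (e ^+ 2 + a ^+ 2).
Proof.
move=> e0; have en := lt0r_neq0 e0.
have D0 : 0 < e ^+ 2 + a ^+ 2 by rewrite ltr_wpDr ?sqr_ge0// exprn_gt0.
have Dn := lt0r_neq0 D0.
have [i1 e1] := exp_cos_aux a e0; have [i2 e2] := exp_cos_aux 0 e0.
have E : (fun x => expR (- (e * `|x|)) * cos (a * x)) =
  (fun x => expR (- (e * `|x|)) * (1 + cos (a * x)) -
     2^-1 * (expR (- (e * `|x|)) * (1 + cos (0 * x)))).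
  by apply/funext => x; rewrite mul0r cos0; field.
rewrite E; split; first by apply: intgB => //; exact: intgZ.
rewrite IntB//; last exact: intgZ.
by rewrite IntZ// e1 e2 expr0n addr0; field; exact/andP.
Qed.

Lemma intg_exp e : 0 < e -> intg mu (fun x => expR (- (e * `|x|))).
Proof.
move=> e0; have [h _] := exp_cos 0 e0; move: h; congr intg.
by apply/funext => x; rewrite mul0r cos0 mulr1.
Qed.

(** The critical decay: the kernel of order [1/2] at infinity. *)
Definition jdec x : R := (1 + `|x|) `^ (- (3 / 2)).

Lemma powR_continuous p : continuous (fun x => (1 + `|x|) `^ p : R).
Proof.
move=> x; apply: (@continuous_comp _ _ _ (fun x => 1 + `|x|) (fun y => y `^ p)).
  by apply: cvgD; [exact: cvg_cst|exact: norm_continuous].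
have x0 : 0 < 1 + `|x| by rewrite ltr_wpDr.
apply: differentiable_continuous; apply/derivable1_diffP.
by have [] := @is_derive1_powR R p _ x0.
Qed.

Lemma jdec_gt0 x : 0 < jdec x.
Proof. by rewrite powR_gt0// ltr_wpDr. Qed.

Lemma intg_jdec : intg mu jdec.
Proof.
pose F x : R := - 2 * (1 + `|x|) `^ (- 2^-1).
have Fl : F x @[x --> +oo] --> (0 : R).
  apply/cvgrPdist_le => d d0; near=> x.
  have x0 : 0 <= x by near: x; apply: nbhs_pinfty_ge; exact: num_real.
  have hx : (d^-1 * 2) ^+ 2 <= x by near: x; apply: nbhs_pinfty_ge; exact: num_real.
  have x1 : 0 < 1 + x by rewrite ltr_wpDr.
  rewrite sub0r normrN normrM normrN [`|2|]ger0_norm// (ger0_norm x0).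
  rewrite ger0_norm ?powR_ge0// powRN powR12_sqrt ?(ltW x1)//.
  rewrite ler_pdivrMr ?sqrtr_gt0// -ler_pdivrMl//.
  rewrite -[leLHS]ger0_norm; last by rewrite mulr_ge0// invr_ge0 ltW.
  by rewrite -sqrtr_sqr ler_wsqrtr// ler_wpDl.
have ef x : jdec (- x) = jdec x by rewrite /jdec normrN.
have cF : continuous F.
  by move=> x; apply: cvgMr; exact: powR_continuous.
have [] // := @even_FTC jdec F 0 _ _ ef Fl cF.
- by move=> x; exact/ltW/jdec_gt0.
- exact: powR_continuous.
move=> x x0; have x1 : 0 < 1 * x + 1 by rewrite mul1r addr_gt0.
have h1 := is_derive_comp_affine (@is_derive1_powR R (- 2^-1) _ x1).
have h := is_deriveMf (is_derive_cst (- 2 : R) x 1) h1.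
apply: (@is_derive_near _ (fun y => cst (- 2 : R) y * (1 * y + 1) `^ (- 2^-1))).
- move=> y; rewrite pmulr_lgt0// => y0.
  by rewrite /F/= (gtr0_norm y0) mul1r addrC.
- by rewrite gt_eqF.
- apply: (is_derive_eq h); rewrite /= mulr0 addr0 /jdec (gtr0_norm x0) !mul1r.
  rewrite mulrA mulrNN mulfV// mul1r addrC; congr (_ `^ _); by field.
Unshelve. all: end_near. Qed.

Lemma Int_gt0 f a b c : a < b -> 0 < c -> intg mu f -> (forall x, 0 <= f x) ->
  (forall x, a <= x <= b -> c <= f x) -> 0 < \int[mu]_x f x.
Proof.
move=> ab c0 if_ f0 fc.
have mI : measurable (`[a, b]%classic : set RM) by [].
have hm : mu (`[a, b]%classic : set RM) = (b - a)%:E.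
  by rewrite lebesgue_measure_itv/= lte_fin ab.
have iI := @integrable_indic_itv R a b true false.
apply: (@lt_le_trans _ _ (\int[mu]_x (c * \1_(`[a, b]%classic) x))).
  rewrite IntZ// mulr_gt0// (_ : \int[mu]_x _ = b - a) ?subr_gt0//.
  by rewrite /Rintegral integral_indic// setIT; exact: (congr1 fine hm).
apply: Int_le => //; first exact: intgZ.
move=> x; rewrite indicE; case: (boolP (_ \in _)) => [h|_]; last by rewrite mulr0.
by rewrite mulr1 fc//; move: h; rewrite inE/= in_itv.
Qed.

(** * The kernels [|t|^(-1-a)] *)

Definition kap a t : R := `|t| `^ (- (1 + a)).

Lemma kap_ge0 a t : 0 <= kap a t. Proof. exact: powR_ge0. Qed.

Lemma kapN a t : kap a (- t) = kap a t. Proof. by rewrite /kap normrN. Qed.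

Lemma mble_kap a : mble (kap a).
Proof.
apply: (measurableT_comp (@measurable_powR R (- (1 + a)))).
exact: (@normr_measurable R setT).
Qed.

Lemma mble_bmin : mble bmin.
Proof. by apply: measurable_minr => //; apply: measurable_funX. Qed.

(** The orders [a] in [[1/2, 1]] are treated at once: near the origin the gain [t^2]
    compensates [|t|^(-1-a)] as [a <= 1], at infinity [a >= 1/2] gives the decay. *)
Lemma kap_bmin_le a t : 2^-1 <= a -> a <= 1 -> kap a t * bmin t <= 4 * jdec t.
Proof.
move=> a2 a1; have j0 := jdec_gt0 t.
have [->|t0] := eqVneq t 0.
  by rewrite /bmin expr0n/= min_r// mulr0 mulr_ge0// ltW// jdec_gt0.
have nt0 : 0 < `|t| by rewrite normr_gt0.
have jE : jdec t = ((1 + `|t|) `^ (3 / 2))^-1 by rewrite /jdec powRN.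
have h2 : 2 `^ (3 / 2) <= 4 :> R.
  have -> : 4 = 2 `^ 2 :> R by rewrite powR_mulrn//; ring.
  by apply: ler_powR; [rewrite ler1n|lra].
have p1 : 0 < 1 + `|t| by rewrite ltr_wpDr.
have [t1|t1] := leP `|t| 1.
  have s2 : t ^+ 2 <= 1 by rewrite -(real_normK (num_real t)) expr_le1.
  rewrite /bmin min_r// -(real_normK (num_real t)) -powR_mulrn// /kap -powRD; last first.
    by rewrite (lt0r_neq0 nt0) implybT.
  apply: (@le_trans _ _ 1).
    rewrite -[leRHS](powRr0 `|t|); apply: ger_powR; first by rewrite nt0.
    by lra.
  rewrite jE ler_pdivlMr ?powR_gt0// mul1r; apply: le_trans h2.
  by apply: ge0_ler_powR; rewrite ?nnegrE//; lra.
have s2 : 1 <= t ^+ 2 by rewrite -(real_normK (num_real t)) expr_ge1// ltW.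
rewrite /bmin min_l// mulr1 /kap.
apply: (@le_trans _ _ (`|t| `^ (- (3 / 2)))).
  by apply: ler_powR; [exact: ltW|lra].
rewrite jE powRN; rewrite ler_pdivlMr ?powR_gt0// mulrC ler_pdivrMr ?powR_gt0//.
apply: (@le_trans _ _ ((2 * `|t|) `^ (3 / 2))).
  by apply: ge0_ler_powR; rewrite ?nnegrE ?mulr_ge0//; lra.
by rewrite powRM// ler_wpM2r// powR_ge0.
Qed.

Lemma intg_kap_bmin a : 2^-1 <= a -> a <= 1 -> intg mu (fun t => kap a t * bmin t).
Proof.
move=> a2 a1; apply: (@intg_le _ RM R mu _ (fun t => 4 * jdec t)).
- by apply: measurable_funM; [exact: mble_kap|exact: mble_bmin].
- exact/intgZ/intg_jdec.
- move=> t; rewrite ger0_norm; first exact: kap_bmin_le.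
  by rewrite mulr_ge0 ?kap_ge0 ?bmin_ge0.
Qed.

Lemma oneBcos_ge0 x : 0 <= 1 - cos x :> R.
Proof. by rewrite subr_ge0 cos_le1. Qed.

(** [1 - cos] is the second difference of [cos] at the origin. *)
Lemma oneBcos_le x : 1 - cos x <= 2 * bmin x.
Proof.
have dc (y : R) : is_derive y (1 : R) (@cos R) (- sin y) by exact: is_derive_cos.
have ds (y : R) : is_derive y (1 : R) (fun y => - sin y) (- cos y).
  by have := is_deriveN (is_derive_sin y).
have h : `|dlt x (@cos R) 0| <= 1 * x ^+ 2.
  by apply: (dlt_le dc ds) => y _; rewrite normrN cos_max.
rewrite /bmin /dlt add0r sub0r cos0 cosN in h *.
rewrite (_ : 1 - _ = 1 - cos x) in h; last by field.
rewrite ger0_norm ?oneBcos_ge0// mul1r in h.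
by have hc := cos_geN1 x; have hs := sqr_ge0 x; have [h1|h1] := leP 1 (x ^+ 2); lra.
Qed.

(** The constant relating the kernel [kap a] to the symbol [|xi|^a]. *)
Definition kcst a : R := \int[mu]_t (kap a t * (1 - cos t)).

Lemma mble_oneBcos c : mble (fun t => 1 - cos (c * t)).
Proof.
apply: measurable_funB => //; apply: continuous_mble => x.
apply: (@continuous_comp _ _ _ ( *%R c) (@cos R)); first exact: mulrl_continuous.
exact: continuous_cos.
Qed.

Lemma intg_kcst a : 2^-1 <= a -> a <= 1 -> intg mu (fun t => kap a t * (1 - cos t)).
Proof.
move=> a2 a1; apply: (@intg_le _ RM R mu _ (fun t => 2 * (kap a t * bmin t))).
- apply: measurable_funM; first exact: mble_kap.
  by have := mble_oneBcos 1; under eq_fun do rewrite mul1r.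
- exact/intgZ/intg_kap_bmin.
- move=> t; rewrite ger0_norm ?mulr_ge0 ?kap_ge0 ?oneBcos_ge0//.
  by rewrite mulrCA ler_wpM2l ?kap_ge0// oneBcos_le.
Qed.

Lemma kcst_gt0 a : 2^-1 <= a -> a <= 1 -> 0 < kcst a.
Proof.
move=> a2 a1; have p0 := @pi_gt0 R.
apply: (@Int_gt0 _ (pi / 2) pi (kap a pi)).
- by rewrite ltr_pdivrMr// mulr_natr mulr2n ltrDl.
- by rewrite powR_gt0// normr_gt0 gt_eqF.
- exact: intg_kcst.
- by move=> t; rewrite mulr_ge0 ?kap_ge0 ?oneBcos_ge0.
move=> t /andP[t1 t2]; have t0 : 0 < t by apply: lt_le_trans t1; rewrite divr_gt0.
rewrite -[leLHS]mulr1; apply: ler_pM; rewrite ?kap_ge0//.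
  rewrite /kap !powRN lef_pV2 ?posrE ?powR_gt0 ?normr_gt0 ?gt_eqF//.
  by rewrite !gtr0_norm//; apply: ge0_ler_powR; rewrite ?nnegrE//; lra.
have -> : cos t = - cos (t - pi) by rewrite -[in LHS](subrK pi t) cosDpi.
rewrite opprK lerDl cos_ge0_pihalf//; apply/andP; split; lra.
Qed.

(** Homogeneity: the symbol of the kernel [kap a] is [|xi|^a], up to the
    constant [kcst a]. *)
Lemma kcst_scale a c : 2^-1 <= a -> a <= 1 ->
  intg mu (fun t => kap a t * (1 - cos (t * c))) /\
  \int[mu]_t (kap a t * (1 - cos (t * c))) = `|c| `^ a * kcst a.
Proof.
move=> a2 a1; have [->|c0] := eqVneq c 0.
  rewrite (_ : (fun t => _) = fun=> 0); last first.
    by apply/funext => t; rewrite mulr0 cos0 subrr mulr0.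
  rewrite Int0 normr0 powR0 ?mul0r; first by split => //; exact: intg0.
  by rewrite gt_eqF//; lra.
have n0 : 0 < `|c| by rewrite normr_gt0.
have E : (fun t => kap a t * (1 - cos (t * c))) =
    (fun t => `|c| `^ (1 + a) * (kap a (`|c| * t + 0) * (1 - cos (`|c| * t + 0)))).
  apply/funext => t; rewrite addr0 mulrA; congr (_ * (1 - _)).
    rewrite /kap normrM normr_id powRM// mulrA -powRD; last by rewrite (lt0r_neq0 n0) implybT.
    by rewrite subrr powRr0 mul1r.
  by rewrite mulrC; have [h|h] := leP 0 c; [rewrite ger0_norm|rewrite ltr0_norm// mulNr cosN].
have ik := intg_kcst a2 a1; have ia := intg_affine 0 n0 ik.
rewrite E; split; first exact: intgZ.
rewrite IntZ// (Int_affine 0 n0 ik) /kcst mulrA; congr (_ * _).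
rewrite addrC powRD; last by rewrite (lt0r_neq0 n0) implybT.
by rewrite powRr1// mulfK// gt_eqF.
Qed.

End Explicit.

(** * The Fourier side *)

Section FourierSide.
Context {R : realType}.
Implicit Types (f g phi : R -> R) (a b c s t x y xi M S K C e : R).
Notation mu := (@lebesgue_measure R).
Notation RM := (measurableTypeR R).
Notation mble f := (measurable_fun (@setT RM) (f : RM -> R)).
Notation mble2 f := (measurable_fun (@setT (RM * RM)) (f : RM * RM -> R)).

(** The real part of [e^(i x xi)] times the Fourier transform of [phi] at [xi]. *)
Definition Phi phi x xi : R := \int[mu]_y (phi y * cos ((x - y) * xi)).

(** [Afrac a phi] is the operator of symbol [|xi|^a] applied to [phi]. *)
Definition Afrac a phi x : R :=
  (2 * pi)^-1 * \int[mu]_xi (`|xi| `^ a * Phi phi x xi).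

Lemma mble_cosM x xi : mble (fun y => cos ((x - y) * xi)).
Proof.
apply: continuous_mble => y.
apply: (@continuous_comp _ _ _ (fun y => (x - y) * xi) (@cos R)).
  by apply: cvgMl; apply: cvgB => //; exact: cvg_cst.
exact: continuous_cos.
Qed.

Lemma intg_Phi phi x xi : intg mu phi -> intg mu (fun y => phi y * cos ((x - y) * xi)).
Proof.
move=> ip; rewrite (_ : (fun y => _) = fun y => cos ((x - y) * xi) * phi y); last first.
  by apply/funext => y; rewrite mulrC.
apply: (@intg_bddM _ RM R mu 1) => //; first exact: mble_cosM.
by move=> y; exact: cos_max.
Qed.

(** The addition formula for the cosine turns the complex product into [Phi]. *)
Lemma frac_lap_testE s phi x : intg mu phi -> frac_lap_test s phi x = Afrac (2 * s) phi x.
Proof.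
move=> ip; have mp := intg_meas ip; rewrite /frac_lap_test /inv_fourier /Afrac /=.
rewrite mul0r subr0; congr (_ * _); congr Rintegral; apply/funext => xi /=.
rewrite /fourier /cintegral /expi /=.
have ic : intg mu (fun y => cos (- (xi * y)) * phi y).
  have := intg_Phi 0 xi ip; congr intg; apply/funext => y.
  by rewrite sub0r mulrC; congr (cos _ * _); ring.
have is_ : intg mu (fun y => sin (- (xi * y)) * phi y).
  apply: (@intg_bddM _ RM R mu 1) => //; last by move=> y; exact: sin_max.
  apply: continuous_mble => y.
  apply: (@continuous_comp _ _ _ (fun y => - (xi * y)) (@sin R)).
    by apply: cvgN; apply: cvgMr.
  exact: continuous_sin.
rewrite (_ : \int[mu]_x0 (cos (- (xi * x0)) * phi x0 - sin (- (xi * x0)) * 0) =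
  \int[mu]_y (cos (- (xi * y)) * phi y)); last first.
  by congr Rintegral; apply/funext => y; rewrite mulr0 subr0.
rewrite (_ : \int[mu]_x0 (cos (- (xi * x0)) * 0 + sin (- (xi * x0)) * phi x0) =
  \int[mu]_y (sin (- (xi * y)) * phi y)); last first.
  by congr Rintegral; apply/funext => y; rewrite mulr0 add0r.
set A := \int[mu]_y (cos _ * _); set B := \int[mu]_y (sin _ * _).
transitivity (`|xi| `^ (2 * s) * (cos (x * xi) * A - sin (x * xi) * B)); first by ring.
congr (_ * _); rewrite /A /B -!IntZ// -IntB; [|exact: intgZ..].
congr Rintegral; apply/funext => y.
by rewrite cosN sinN mulrBl cosB [y * xi]mulrC; ring.
Qed.

(** The second difference in [x] acts by its symbol [1 - cos (t xi)]. *)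
Lemma Phi_cos phi t x xi : intg mu phi ->
  dlt t (fun z => Phi phi z xi) x = (1 - cos (t * xi)) * Phi phi x xi.
Proof.
move=> ip; rewrite /dlt -IntZ; last exact: intg_Phi.
rewrite -[Phi phi (x + t) xi + _]IntD; [|exact: intg_Phi..].
rewrite mulrC -IntZ; last by apply: intgD; exact: intg_Phi.
rewrite -IntB; [|exact: intg_Phi|by apply/intgZ/intgD; exact: intg_Phi].
congr Rintegral; apply/funext => y.
rewrite (_ : (x + t - y) * xi = (x - y) * xi + t * xi); last by ring.
rewrite (_ : (x - t - y) * xi = (x - y) * xi - t * xi); last by ring.
by rewrite cosD cosB; field.
Qed.

Lemma Phi_dlt phi t x xi : intg mu phi ->
  Phi (dlt t phi) x xi = (1 - cos (t * xi)) * Phi phi x xi.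
Proof.
move=> ip; rewrite -Phi_cos// /Phi /dlt.
have i1 := intg_Phi x xi ip.
have i2 := intg_shift t (intg_Phi (x + t) xi ip).
have i3 := intg_shift (- t) (intg_Phi (x - t) xi ip).
rewrite -(Int_shift t (intg_Phi (x + t) xi ip)).
rewrite -(Int_shift (- t) (intg_Phi (x - t) xi ip)).
rewrite -IntD// mulrC -IntZ; last exact: intgD.
rewrite -IntB//; last exact/intgZ/intgD.
congr Rintegral; apply/funext => y.
rewrite (_ : x + t - (y + t) = x - y); last by ring.
rewrite (_ : x - t - (y - t) = x - y); last by ring.
by field.
Qed.

Lemma Phi_le phi x xi : intg mu phi -> `|Phi phi x xi| <= \int[mu]_y `|phi y|.
Proof.
move=> ip; apply: Int_abs; [exact: intg_Phi|exact: intg_norm|] => y.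
by rewrite normrM ler_piMr// cos_max.
Qed.

Lemma Int_sum3 t W : intg mu W -> intg mu (sum3 t W) /\
  \int[mu]_x (sum3 t W x) = 3 * \int[mu]_x W x.
Proof.
move=> iW; have i1 := intg_shift t iW; have i2 := intg_shift (- t) iW.
rewrite /sum3; split; first by apply: intgD => //; exact: intgD.
rewrite IntD//; last exact: intgD.
by rewrite IntD// !Int_shift//; ring.
Qed.

Lemma Int_dlt_test phi : test_fun phi -> exists C : R, 0 <= C /\
  forall s, \int[mu]_x `|dlt s phi x| <= C * bmin s.
Proof.
move=> tp; have [C [C0 hC]] := dlt_test_le tp.
exists (C * (3 * pi)); split; first by rewrite !mulr_ge0// pi_ge0.
move=> s; have [i3 e3] := Int_sum3 s (@intg_wgt R).
rewrite -Int_wgt mulrAC -e3 -IntZ//.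
apply: Int_le; [exact/intg_norm/test_intg/test_dlt|exact: intgZ|] => x.
exact: hC.
Qed.

Lemma Int_dlt_dlt_test phi : test_fun phi -> exists C : R, 0 <= C /\
  forall s t, \int[mu]_x `|dlt s (dlt t phi) x| <= C * bmin s * bmin t.
Proof.
move=> tp; have [C [C0 hC]] := dlt_dlt_test_le tp.
exists (C * (3 * (3 * pi))); split; first by rewrite !mulr_ge0// pi_ge0.
move=> s t; have [i3 e3] := Int_sum3 t (@intg_wgt R).
have [i9 e9] := Int_sum3 s i3.
rewrite (_ : C * (3 * (3 * pi)) * bmin s * bmin t =
  C * bmin s * bmin t * \int[mu]_x sum3 s (sum3 t wgt) x); last first.
  by rewrite e9 e3 Int_wgt; ring.
rewrite -IntZ//; apply: Int_le; [|exact: intgZ|by move=> x; exact: hC].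
exact/intg_norm/test_intg/test_dlt/test_dlt.
Qed.

Lemma bmin_pi_le xi : xi != 0 -> bmin (pi / xi) <= (1 + pi ^+ 2) * wgt xi.
Proof.
move=> x0; have p2 : 0 < xi ^+ 2 by rewrite exprn_even_gt0.
have q0 := sqr_ge0 (pi : R); have w0 : 0 < 1 + xi ^+ 2 by rewrite ltr_wpDr// ltW.
rewrite /wgt ler_pdivlMr// /bmin expr_div_n.
have [h|h] := leP (xi ^+ 2) (pi ^+ 2).
  apply: (@le_trans _ _ (1 * (1 + xi ^+ 2))); last by lra.
  by rewrite ler_wpM2r ?(ltW w0)// ge_min lexx.
apply: (@le_trans _ _ (pi ^+ 2 / xi ^+ 2 * (1 + xi ^+ 2))).
  by rewrite ler_wpM2r ?(ltW w0)// ge_min lexx orbT.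
rewrite mulrAC ler_pdivrMr//; nra.
Qed.

(** Testing the identity [Phi_dlt] with [t = pi / xi], where [1 - cos (t xi) = 2],
    turns the smallness of second differences into decay in [xi]. *)
Lemma Phi_decay phi x : test_fun phi -> exists C : R, 0 <= C /\
  forall xi, `|Phi phi x xi| <= C * wgt xi ^+ 2.
Proof.
move=> tp; have [C [C0 hC]] := Int_dlt_dlt_test tp.
have ip := test_intg tp.
pose C1 := \int[mu]_y `|phi y|.
have C10 : 0 <= C1 by apply: Int_ge0.
have P0 : 0 <= (1 + pi ^+ 2) ^+ 2 :> R by exact: sqr_ge0.
exists (C * (1 + pi ^+ 2) ^+ 2 + C1); split; first by rewrite addr_ge0// mulr_ge0.
move=> xi; have [->|x0] := eqVneq xi 0.
  rewrite /wgt expr0n addr0 invr1 expr1n mulr1.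
  apply: le_trans (Phi_le x 0 ip) _; by rewrite lerDr mulr_ge0.
have w2 : 0 <= wgt xi ^+ 2 by exact: sqr_ge0.
have e2 : 1 - cos (pi / xi * xi) = 2 by rewrite divfK// cospi opprK.
have E : Phi (dlt (pi / xi) (dlt (pi / xi) phi)) x xi = 4 * Phi phi x xi.
  by rewrite !Phi_dlt// ?e2; [ring|exact/test_intg/test_dlt].
have := Phi_le x xi (test_intg (test_dlt (pi / xi) (test_dlt (pi / xi) tp))).
rewrite E normrM ger0_norm// => h1.
have h2 := le_trans h1 (hC _ _).
have hb := bmin_pi_le x0; have b0 := bmin_ge0 (pi / xi : R).
have h3 : bmin (pi / xi) * bmin (pi / xi) <= (1 + pi ^+ 2) ^+ 2 * wgt xi ^+ 2.
  by rewrite -exprMn expr2 ler_pM.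
have h4 : C * bmin (pi / xi) * bmin (pi / xi) <= C * ((1 + pi ^+ 2) ^+ 2 * wgt xi ^+ 2).
  by rewrite -mulrA ler_wpM2l.
have h5 : 0 <= C1 * wgt xi ^+ 2 by rewrite mulr_ge0.
have n0 := normr_ge0 (Phi phi x xi).
rewrite mulrDl -mulrA; lra.
Qed.

Lemma powR_wgt_le a xi : 0 <= a -> a <= 2 -> `|xi| `^ a * wgt xi <= 1.
Proof.
move=> a0 a2; have w0 : 0 < 1 + xi ^+ 2 by rewrite ltr_wpDr// sqr_ge0.
rewrite /wgt ler_pdivrMr// mul1r.
have [->|x0] := eqVneq xi 0.
  rewrite normr0 expr0n addr0 /powR eqxx; by case: (a == 0); rewrite ?ler01.
have n0 : 0 < `|xi| by rewrite normr_gt0.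
have [x1|x1] := leP `|xi| 1.
  apply: (@le_trans _ _ 1); last by rewrite lerDl sqr_ge0.
  by rewrite -[leRHS](powRr0 `|xi|); apply: ger_powR; rewrite ?n0.
apply: (@le_trans _ _ (xi ^+ 2)); last by rewrite lerDr.
rewrite -(real_normK (num_real xi)) -powR_mulrn//.
by apply: ler_powR => //; exact: ltW.
Qed.

Lemma mble_Phi phi x : mble phi -> mble (Phi phi x).
Proof.
move=> mp.
have mF : mble2 (fun p => phi p.2 * cos ((x - p.2) * p.1)).
  apply: measurable_funM; first exact: (measurableT_comp mp).
  apply: (measurableT_comp (continuous_mble (@continuous_cos R))).
  by apply: measurable_funM => //; apply: measurable_funB.
exact: (@measurable_Int1 _ _ _ _ _ mu _ mF).
Qed.

Lemma mble_normpow a : mble (fun xi => `|xi| `^ a).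
Proof.
apply: (measurableT_comp (@measurable_powR R a)); exact: (@normr_measurable R setT).
Qed.

Lemma intg_powR_Phi a phi x : test_fun phi -> 0 <= a -> a <= 2 ->
  intg mu (fun xi => `|xi| `^ a * Phi phi x xi).
Proof.
move=> tp a0 a2; have [C [C0 hC]] := Phi_decay x tp.
apply: (@intg_le _ RM R mu _ (fun xi => C * wgt xi)).
- by apply: measurable_funM; [exact: mble_normpow|apply: mble_Phi; exact: test_mble].
- exact/intgZ/intg_wgt.
- move=> xi; rewrite normrM (ger0_norm (powR_ge0 _ _)).
  have h := powR_wgt_le xi a0 a2; have w0 := ltW (wgt_gt0 xi).
  have p0 := powR_ge0 `|xi| a.
  apply: (@le_trans _ _ (`|xi| `^ a * (C * wgt xi ^+ 2))); first by rewrite ler_wpM2l.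
  rewrite (_ : _ * (C * _) = C * wgt xi * (`|xi| `^ a * wgt xi)); last by ring.
  by rewrite ler_piMr// mulr_ge0.
Qed.

Lemma intg_Phi_xi phi x : test_fun phi -> intg mu (Phi phi x).
Proof.
move=> tp; have := intg_powR_Phi x tp (lexx 0) (ler0n _ 2); congr intg.
by apply/funext => xi; rewrite powRr0 mul1r.
Qed.

(** Abel summation: the multiplier [exp (- e |xi|)] produces the Poisson
    kernel. *)
Lemma Abel_Phi phi x e : 0 < e -> test_fun phi ->
  \int[mu]_xi (expR (- (e * `|xi|)) * Phi phi x xi) =
  2 * \int[mu]_s (wgt s * phi (e * s + x)).
Proof.
move=> e0 tp; have ip := test_intg tp; have mp := test_mble tp.
have iE := intg_exp e0.
pose F (p : R * R) : R := expR (- (e * `|p.1|)) * (phi p.2 * cos ((x - p.2) * p.1)).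
have mE : mble (fun xi => expR (- (e * `|xi|))) := intg_meas iE.
have mF : mble2 F.
  apply: measurable_funM; first exact: (measurableT_comp mE).
  apply: measurable_funM; first exact: (measurableT_comp mp).
  apply: (measurableT_comp (continuous_mble (@continuous_cos R))).
  by apply: measurable_funM => //; apply: measurable_funB.
have iF : intg (mu \x mu)%E F.
  apply: (@intg_prod1 _ _ _ _ _ mu mu F (fun xi => expR (- (e * `|xi|)) * \int[mu]_y `|phi y|)) => //.
  - have := intgZ (\int[mu]_y `|phi y|) iE; congr intg; apply/funext => xi.
    by rewrite mulrC.
  - by move=> xi; rewrite /F /=; apply: intgZ; exact: intg_Phi.
  - move=> xi; rewrite -IntZ; last exact: intg_norm.
    apply: Int_le.
    + by apply: intg_norm; rewrite /F /=; apply: intgZ; exact: intg_Phi.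
    + by apply: intgZ; exact: intg_norm.
    + move=> y; rewrite /F /= !normrM (ger0_norm (expR_ge0 _)) ler_wpM2l ?expR_ge0//.
      by rewrite ler_piMr// cos_max.
transitivity (\int[mu]_xi \int[mu]_y F (xi, y)).
  by congr Rintegral; apply/funext => xi; rewrite /F /= IntZ//; exact: intg_Phi.
rewrite (Int_swap iF) /F /=.
pose g y : R := 2 * e / (e ^+ 2 + (x - y) ^+ 2) * phi y.
(* [2 e / (e^2 + (x - y)^2)] is the Fourier transform of [exp (- e |xi|)]. *)
transitivity (\int[mu]_y g y).
  congr Rintegral; apply/funext => y.
  have [i1 e1] := exp_cos (x - y) e0.
  rewrite /g -e1 mulrC -IntZ//; congr Rintegral; apply/funext => xi.
  by rewrite mulrCA.
have D0 y : 0 < e ^+ 2 + (x - y) ^+ 2 by rewrite ltr_wpDr ?sqr_ge0// exprn_gt0.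
have ig : intg mu g.
  apply: (@intg_bddM _ RM R mu (2 * e / e ^+ 2)) => //.
    apply: continuous_mble => y; apply: cvgMr; apply: cvgV.
      exact: lt0r_neq0.
    apply: cvgD; first exact: cvg_cst.
    rewrite expr2; under eq_fun do rewrite expr2.
    by apply: cvgM; apply: cvgB => //; exact: cvg_cst.
  move=> y; rewrite ger0_norm ?divr_ge0 ?mulr_ge0 ?(ltW e0) ?(ltW (D0 y))//.
  rewrite ler_wpM2l ?mulr_ge0 ?(ltW e0)// lef_pV2 ?posrE ?exprn_gt0//.
  by rewrite lerDl sqr_ge0.
have h := Int_affine x e0 ig.
have -> : \int[mu]_y g y = e * \int[mu]_s g (e * s + x) by rewrite h mulrA divff ?mul1r// gt_eqF.
have iw : intg mu (fun s => wgt s * phi (e * s + x)).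
  have [M [M0 hM]] := test_bounded tp.
  have := @intg_bddM _ RM R mu M (fun s => phi (e * s + x)) wgt
    (intg_meas (intg_affine x e0 ip)) (@intg_wgt R) (fun s => hM _).
  by congr intg; apply/funext => s; rewrite mulrC.
rewrite -IntZ; last exact: intg_affine.
rewrite -IntZ//; congr Rintegral; apply/funext => s.
have w0 : 1 + s ^+ 2 != 0 by rewrite lt0r_neq0// ltr_wpDr// sqr_ge0.
rewrite /g /wgt (_ : e ^+ 2 + (x - (e * s + x)) ^+ 2 = e ^+ 2 * (1 + s ^+ 2)); last by ring.
by field; rewrite w0 gt_eqF.
Qed.

Lemma cvg_inv_nat : (fun n => n.+1%:R^-1 : R) @ \oo --> (0 : R).
Proof. exact: cvg_harmonic. Qed.

(** The two sides of [Abel_Phi] converge by dominated convergence as the parameter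
    tends to zero, to the inverse Fourier integral and to a multiple of [phi x]. *)
Lemma Fourier_inversion phi x : test_fun phi -> Afrac 0 phi x = phi x.
Proof.
move=> tp; rewrite /Afrac.
have -> : (fun xi => `|xi| `^ 0 * Phi phi x xi) = Phi phi x.
  by apply/funext => xi; rewrite powRr0 mul1r.
have iP := intg_Phi_xi x tp; have mp := test_mble tp.
have e0 n : 0 < n.+1%:R^-1 :> R by rewrite invr_gt0.
have c1 : (fun n => \int[mu]_xi (expR (- (n.+1%:R^-1 * `|xi|)) * Phi phi x xi)) @ \oo
    --> \int[mu]_xi (Phi phi x xi).
  have [|||||_ c] := @dct _ RM R mu (fun n xi => expR (- (n.+1%:R^-1 * `|xi|)) * Phi phi x xi)
    (Phi phi x) (fun xi => `|Phi phi x xi|).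
  - move=> n; apply: measurable_funM; first exact: intg_meas (intg_exp (e0 n)).
    exact: mble_Phi.
  - exact: mble_Phi.
  - apply: aeW => xi; rewrite -[X in _ --> X]mul1r; apply: cvgMl.
    have h : (fun n => expR (- (n.+1%:R^-1 * `|xi|))) @ \oo --> expR (- (0 * `|xi|)).
      apply: continuous_cvg; first exact: continuous_expR.
      by apply: cvgN; apply: cvgMl; exact: cvg_inv_nat.
    by move: h; rewrite mul0r oppr0 expR0.
  - exact: intg_norm.
  - move=> n xi; rewrite normrM (ger0_norm (expR_ge0 _)) ler_piMl//.
  - exact: c.
have [M [M0 hM]] := test_bounded tp.
have c2 : (fun n => 2 * \int[mu]_s (wgt s * phi (n.+1%:R^-1 * s + x))) @ \oo
    --> 2 * \int[mu]_s (wgt s * phi x).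
  apply: cvgMr.
  have [|||||_ c] := @dct _ RM R mu (fun n s => wgt s * phi (n.+1%:R^-1 * s + x))
    (fun s => wgt s * phi x) (fun s => M * wgt s).
  - move=> n; apply: measurable_funM; first exact: intg_meas (@intg_wgt R).
    exact: intg_meas (intg_affine x (e0 n) (test_intg tp)).
  - by apply: measurable_funM => //; exact: intg_meas (@intg_wgt R).
  - apply: aeW => s; apply: cvgMr.
    apply: (@cvg_comp _ _ _ (fun n : nat => n.+1%:R^-1 * s + x) phi _ (nbhs x)); last first.
      exact: (smooth_continuous (test_smooth tp)).
    have h : (fun n => n.+1%:R^-1 * s + x : R) @ \oo --> 0 * s + x.
      by apply: cvgD; [apply: cvgMl; exact: cvg_inv_nat|exact: cvg_cst].
    by move: h; rewrite mul0r add0r.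
  - exact/intgZ/intg_wgt.
  - move=> n s; rewrite normrM ger0_norm ?(ltW (wgt_gt0 s))// mulrC.
    by rewrite ler_wpM2r// ltW// wgt_gt0.
  - exact: c.
have E : (fun n => \int[mu]_xi (expR (- (n.+1%:R^-1 * `|xi|)) * Phi phi x xi)) =
    (fun n => 2 * \int[mu]_s (wgt s * phi (n.+1%:R^-1 * s + x))).
  by apply/funext => n; rewrite Abel_Phi.
rewrite -E in c2; have -> := cvg_unique (@Rhausdorff R) c1 c2.
rewrite (_ : \int[mu]_s (wgt s * phi x) = pi * phi x).
  have p2 : 2 * pi != 0 :> R by rewrite mulf_neq0// lt0r_neq0// pi_gt0.
  by rewrite [2 * (_ * _)]mulrA mulKf.
rewrite -Int_wgt mulrC -IntZ; last exact: intg_wgt.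
by congr Rintegral; apply/funext => s; rewrite mulrC.
Qed.

(** Fubini's theorem in [(t, xi)] and the homogeneity [kcst_scale]: integrating second
    differences against [kap a] raises the order by [a]. *)
Lemma Afrac_kernel s a phi x : test_fun phi -> 0 <= s -> 2^-1 <= a -> a <= 1 ->
  s + a <= 2 ->
  intg mu (fun t => kap a t * dlt t (Afrac s phi) x) /\
  \int[mu]_t (kap a t * dlt t (Afrac s phi) x) = kcst a * Afrac (s + a) phi x.
Proof.
move=> tp s0 a2 a1 sa; have ip := test_intg tp.
have s2 : s <= 2 by lra.
have sa0 : 0 <= s + a by lra.
pose F (p : R * R) : R := kap a p.1 * (1 - cos (p.1 * p.2)) * (`|p.2| `^ s * Phi phi x p.2).
have mP := mble_Phi x (test_mble tp).
have mF : mble2 F.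
  apply: measurable_funM.
    apply: measurable_funM; first exact: (measurableT_comp (mble_kap a)).
    apply: measurable_funB => //.
    apply: (measurableT_comp (continuous_mble (@continuous_cos R))).
    by apply: measurable_funM.
  apply: measurable_funM; first exact: (measurableT_comp (mble_normpow s)).
  exact: (measurableT_comp mP).
have pw xi : `|xi| `^ s * `|xi| `^ a = `|xi| `^ (s + a).
  by rewrite powRD//; apply/implyP => /eqP; lra.
have iF : intg (mu \x mu)%E F.
  apply: (@intg_prod2 _ _ _ _ _ mu mu F (fun xi => kcst a * `| `|xi| `^ (s + a) * Phi phi x xi|)) => //.
  - by apply/intgZ/intg_norm; exact: intg_powR_Phi.
  - move=> xi; have [h _] := @kcst_scale R a xi a2 a1.
    have := intgZ (`|xi| `^ s * Phi phi x xi) h; congr intg; apply/funext => t.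
    by rewrite mulrC.
  - move=> xi; have [h e] := @kcst_scale R a xi a2 a1.
    rewrite (_ : (fun t => `|F (t, xi)|) = (fun t => `| `|xi| `^ s * Phi phi x xi| *
      (kap a t * (1 - cos (t * xi))))); last first.
      apply/funext => t; rewrite /F/= normrM mulrC; congr (_ * _).
      by rewrite ger0_norm// mulr_ge0 ?kap_ge0 ?oneBcos_ge0.
    rewrite IntZ// e !normrM !(ger0_norm (powR_ge0 _ _)) -pw le_eqVlt; apply/orP; left.
    by apply/eqP; ring.
have E t : kap a t * dlt t (Afrac s phi) x = (2 * pi)^-1 * \int[mu]_xi F (t, xi).
  have i1 y := intg_powR_Phi y tp s0 s2.
  have R3 p q A B C : q * (p * A - (p * B + p * C) / 2) = p * (q * (A - 2^-1 * (B + C))).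
    by ring.
  rewrite /dlt /Afrac R3; apply: f_equal.
  rewrite -IntD// -IntZ; last exact: intgD.
  rewrite -IntB//; last exact/intgZ/intgD.
  rewrite -IntZ; last exact/intgB/intgZ/intgD.
  congr Rintegral; apply/funext => xi; rewrite /F /= -mulrA; congr (_ * _).
  by rewrite mulrCA -Phi_cos// /dlt; ring.
have -> : (fun t => kap a t * dlt t (Afrac s phi) x) =
  (fun t => (2 * pi)^-1 * \int[mu]_xi F (t, xi)) by exact/funext.
split; first by apply: intgZ; exact: intg_Int1 iF.
rewrite IntZ; last exact: intg_Int1 iF.
rewrite (Int_swap iF) /Afrac mulrCA; congr (_ * _).
rewrite -IntZ; last exact: intg_powR_Phi.
congr Rintegral; apply/funext => xi; have [h e] := @kcst_scale R a xi a2 a1.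
rewrite -pw; transitivity (`|xi| `^ s * Phi phi x xi * (`|xi| `^ a * kcst a)); last by ring.
rewrite -e -IntZ//; congr Rintegral; apply/funext => t.
by rewrite /F /= mulrC.
Qed.

End FourierSide.

(** * The quarter Laplacian on test functions and on bounded functions *)

Section Transfer.
Context {R : realType}.
Implicit Types (f g u phi W : R -> R) (a b c s t x y M S K C e : R).
Notation mu := (@lebesgue_measure R).
Notation RM := (measurableTypeR R).
Notation mble f := (measurable_fun (@setT RM) (f : RM -> R)).
Notation mble2 f := (measurable_fun (@setT (RM * RM)) (f : RM * RM -> R)).

Lemma L2_sqi g : L2 g <-> sqi mu g.
Proof.
split=> [h|[mg ig]].
  split; last exact: Lfun2_integrable_sqr h.
  by move: h; rewrite /L2 inE => /andP[]; rewrite inE.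
rewrite /L2 inE; apply/andP; split; rewrite inE//=.
rewrite /finite_norm unlock /=; apply: poweR_lty.
move: ig => /integrableP[_]; congr (is_true (_ < _)%E).
apply: eq_integral => x _ /=.
by rewrite powR_mulrn// real_normK ?num_real// ger0_norm// sqr_ge0.
Qed.

Lemma seq_unique (w : nat -> R) a b : w @ \oo --> a -> w @ \oo --> b -> a = b.
Proof. by move=> wa wb; apply: (cvg_unique (@Rhausdorff R) wa wb). Qed.

Lemma mulVKC a b c : c != 0 -> c^-1 * (a * (c * b)) = a * b.
Proof. by move=> c0; rewrite mulrCA mulKf. Qed.

Lemma mul_dltE a b c e : e * (a - (b + c) / 2) = e * a - (e * b + e * c) / 2.
Proof. by ring. Qed.

Lemma Int_mulVK (a b g u : R -> R) c : c != 0 ->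
  intg mu (fun x => g x * a x) -> intg mu (fun x => u x * b x) ->
  \int[mu]_x (g x * (c * a x)) = \int[mu]_x (u x * (c * b x)) ->
  \int[mu]_x (g x * a x) = \int[mu]_x (u x * b x).
Proof.
move=> c0 ig iu h; apply: (mulfI c0); rewrite -!IntZ//.
rewrite -[LHS]/(\int[mu]_x _) (_ : (fun x => _) = (fun x => g x * (c * a x))); last first.
  by apply/funext => x; rewrite mulrCA.
by rewrite h; congr Rintegral; apply/funext => x; rewrite mulrCA.
Qed.

Local Opaque Afrac kcst.

(** The projection onto [[0, 1]], used to build Lipschitz cutoffs. *)
Definition clamp x : R := Num.max 0 (Num.min 1 x).

Lemma clamp_ge0 x : 0 <= clamp x. Proof. by rewrite /clamp le_max lexx. Qed.

Lemma clamp_le1 x : clamp x <= 1. Proof. by rewrite /clamp ge_max ler01 ge_min lexx. Qed.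

Lemma clamp_eq1 x : 1 <= x -> clamp x = 1.
Proof. by move=> x1; rewrite /clamp min_l// max_r. Qed.

Lemma clamp_eq0 x : x <= 0 -> clamp x = 0.
Proof. by move=> x0; rewrite /clamp min_r ?max_l//; lra. Qed.

Lemma clamp_lip x y : `|clamp x - clamp y| <= `|x - y|.
Proof.
rewrite /clamp /Num.max /Num.min; repeat case: ifP; move=> *;
  rewrite ler_norml; have := ler_norm (x - y); have := ler_norm (y - x);
  rewrite (distrC y); lra.
Qed.

Lemma mble_clamp f : mble f -> mble (fun x => clamp (f x)).
Proof. by move=> mf; apply: measurable_maxr => //; exact: measurable_minr. Qed.

Notation kh := (kap (2^-1 : R)).
Notation ch := (kcst (2^-1 : R)).

Let h12 : 2^-1 <= 2^-1 :> R. Proof. by []. Qed.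
Let h21 : 2^-1 <= 1 :> R. Proof. lra. Qed.

(** The kernel of order [1/2] truncated to a bounded set that avoids the origin, by
    Lipschitz cutoffs so that it is visibly measurable. *)
Definition kn (n : nat) t : R :=
  kh t * (clamp (n.+1%:R * `|t| - 1) * clamp (n.+1%:R - `|t|)).

Lemma kn_ge0 n t : 0 <= kn n t.
Proof. by rewrite !mulr_ge0 ?kap_ge0 ?clamp_ge0. Qed.

Lemma kn_le n t : kn n t <= kh t.
Proof.
by rewrite ler_piMr ?kap_ge0// mulr_ile1 ?clamp_ge0 ?clamp_le1.
Qed.

Lemma knN n t : kn n (- t) = kn n t.
Proof. by rewrite /kn kapN normrN. Qed.

Lemma mble_norm : mble (fun t => `|t|).
Proof. exact: (@normr_measurable R setT). Qed.

Lemma mble_kn n : mble (kn n).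
Proof.
apply: measurable_funM; first exact: mble_kap.
apply: measurable_funM; apply: mble_clamp; apply: measurable_funB => //.
by apply: measurable_funM => //; exact: mble_norm.
Qed.

Lemma vanish_kn n : vanish n.+1%:R (kn n).
Proof. by move=> t h; rewrite /kn (@clamp_eq0 (_ - `|t|)) ?mulr0//; lra. Qed.

Lemma kn_bmin n t : kn n t <= n.+1%:R ^+ 2 * (kh t * bmin t).
Proof.
have N1 : 1 <= n.+1%:R :> R by rewrite ler1n.
have k0 := kap_ge0 2^-1 t; have b0 := bmin_ge0 t.
have [h|h] := leP (n.+1%:R * `|t|) 1.
  rewrite /kn (@clamp_eq0 (_ - 1)); last by lra.
  by rewrite mul0r mulr0 !mulr_ge0.
apply: le_trans (kn_le n t) _; rewrite mulrCA ler_peMr// /bmin.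
have N2 : 1 <= n.+1%:R ^+ 2 :> R by rewrite exprn_ege1.
rewrite /Num.min; case: ifP => _; first by rewrite mulr1.
by rewrite -exprMn -real_normK ?num_real// normrM (ger0_norm (ler0n R n.+1)) exprn_ege1// ltW.
Qed.

Lemma intg_kn n : intg mu (kn n).
Proof.
apply: (@intg_le _ RM R mu _ _ (mble_kn n) (intgZ (n.+1%:R ^+ 2) (intg_kap_bmin h12 h21))).
by move=> t; rewrite ger0_norm ?kn_ge0// kn_bmin.
Qed.

Lemma kn_cvg t : (fun n => kn n t) @ \oo --> kh t.
Proof.
have [->|t0] := eqVneq t 0.
  have k0 : kh 0 = 0.
    by rewrite /kap normr0 /powR eqxx; case: eqP => // h; exfalso; lra.
  by under eq_fun do rewrite /kn k0 mul0r; rewrite k0; exact: cvg_cst.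
have nt : 0 < `|t| by rewrite normr_gt0.
apply: cvg_near_cst; exists (Num.trunc (2 / `|t| + `|t| + 1)) => // n /= hn.
have h := truncnS_gt (2 / `|t| + `|t| + 1).
have h1 : 2 / `|t| + `|t| + 1 <= n.+1%:R.
  by apply: le_trans (ltW h) _; rewrite ler_nat ltnS.
have h2 : 0 < 2 / `|t| by rewrite divr_gt0.
rewrite /kn !clamp_eq1 ?mulr1//; first by lra.
have : 2 / `|t| * `|t| <= n.+1%:R * `|t| by rewrite ler_wpM2r ?normr_ge0//; lra.
rewrite divfK ?gt_eqF//; lra.
Qed.

(** Truncations of [D] (up to a constant) that preserve test functions. *)
Definition Dn n f x : R := \int[mu]_t (kn n t * dlt t f x).

Lemma mble_shiftl f x : mble f -> mble (fun t => f (x + t)).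
Proof. by move=> mf; apply: (measurableT_comp mf); exact: measurable_funD. Qed.

Lemma mble_sum3 W x : mble W -> mble (fun t => sum3 t W x).
Proof.
move=> mW; apply: measurable_funD; last exact: mble_refl.
by apply: measurable_funD => //; exact: mble_shiftl.
Qed.

Lemma mble_dlt f x : mble f -> mble (fun t => dlt t f x).
Proof.
move=> mf; apply: measurable_funB => //; apply: measurable_funM => //.
by apply: measurable_funD; [exact: mble_shiftl|exact: mble_refl].
Qed.

(** Evenness of the kernel merges the two translates of the second difference. *)
Lemma DnE n phi : test_fun phi ->
  Dn n phi = (fun x => (\int[mu]_t kn n t) * phi x - convol (kn n) phi x).
Proof.
move=> tp; apply/funext => x; have [M [M0 hM]] := test_bounded tp.
have mp := test_mble tp; have ik := intg_kn n.
have im : intg mu (fun t => kn n t * phi (x - t)).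
  have := @intg_bddM _ RM R mu M (fun t => phi (x - t)) _ (mble_refl x mp) ik (fun t => hM _).
  by congr intg; apply/funext => t; rewrite mulrC.
have ip : intg mu (fun t => kn n t * phi (x + t)).
  have := @intg_bddM _ RM R mu M (fun t => phi (x + t)) _ (mble_shiftl x mp) ik (fun t => hM _).
  by congr intg; apply/funext => t; rewrite mulrC.
have e : \int[mu]_t (kn n t * phi (x + t)) = convol (kn n) phi x.
  rewrite -Int_opp//; congr Rintegral; apply/funext => t; by rewrite knN.
rewrite /Dn (_ : (fun t => kn n t * dlt t phi x) = (fun t => phi x * kn n t -
  2^-1 * (kn n t * phi (x + t) + kn n t * phi (x - t)))); last first.
  by apply/funext => t; rewrite /dlt; field.
rewrite IntB ?IntZ ?IntD//; [|exact: intgD|exact: intgZ|exact/intgZ/intgD].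
rewrite e /convol; by field.
Qed.

Lemma Dn_test n phi : test_fun phi -> test_fun (Dn n phi).
Proof.
move=> tp; rewrite DnE//; apply: test_funB; first exact: test_funZ.
exact: (test_conv (intg_kn n) (@vanish_kn n) tp).
Qed.

Lemma Dn_derive n phi x : test_fun phi ->
  is_derive x (1 : R) (Dn n phi) (Dn n (derive1 phi) x).
Proof.
move=> tp; have tp1 := test_fun_derive tp.
have [M [M0 hM]] := test_bounded tp; have [M1 [M10 hM1]] := test_bounded tp1.
rewrite !DnE//.
have d1 := @conv_is_derive R (kn n) phi (M + M1) x (intg_kn n) (test_smooth tp).
have d2 : is_derive (x : R) (1 : R) phi (derive1 phi x).
  exact/smooth_is_derive/test_smooth.
have {}d1 : is_derive (x : R) (1 : R) (convol (kn n) phi) (convol (kn n) (derive1 phi) x).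
  apply: d1 => y; [have := hM y|have := hM1 y]; lra.
have d3 := is_deriveMf (is_derive_cst (\int[mu]_t kn n t) x (1 : R)) d2.
have d4 := is_deriveDf d3 (is_deriveMf (is_derive_cst (-1 : R) x (1 : R)) d1).
rewrite (_ : (fun x => _) = (fun y => cst (\int[mu]_t kn n t) y * phi y +
  cst (-1) y * convol (kn n) phi y)); last by apply/funext => y; rewrite /cst mulN1r.
by apply: (is_derive_eq d4); rewrite /cst; ring.
Qed.

(** The weights [adm] are closed under this averaging, which is the reason why decay
    estimates iterate. *)
Definition avg W x : R := \int[mu]_t (kh t * bmin t * sum3 t W x).

Definition adm K W := [/\ slow W, mble W, intg mu W & forall x, W x <= K].

Lemma adm_wgt : adm 1 wgt.
Proof.
split; [exact: slow_wgt|exact: intg_meas (@intg_wgt R)|exact: intg_wgt|exact: wgt_le1].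
Qed.

Lemma sum3_le K W t x : adm K W -> 0 <= sum3 t W x <= 3 * K.
Proof.
move=> [sW _ _ hW]; rewrite /sum3.
have := hW x; have := hW (x + t); have := hW (x - t).
have := sW.1 x; have := sW.1 (x + t); have := sW.1 (x - t); lra.
Qed.

Lemma intg_avg K W x : adm K W -> intg mu (fun t => kh t * bmin t * sum3 t W x).
Proof.
move=> aW; have [sW mW iW hW] := aW.
have := @intg_bddM _ RM R mu (3 * K) (fun t => sum3 t W x) _ (mble_sum3 x mW)
  (intg_kap_bmin h12 h21).
move=> h; rewrite (_ : (fun t => _) = fun t => sum3 t W x * (kh t * bmin t)); last first.
  by apply/funext => t; rewrite mulrC.
by apply: h => t; have /andP[h0 h1] := sum3_le t x aW; rewrite ger0_norm.
Qed.

Lemma kb_ge0 t : 0 <= kh t * bmin t.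
Proof. by rewrite mulr_ge0 ?kap_ge0 ?bmin_ge0. Qed.

Lemma adm_avg K W : adm K W ->
  adm (3 * K * \int[mu]_t (kh t * bmin t)) (avg W).
Proof.
move=> aW; have [sW mW iW hW] := aW; have ik := @intg_kap_bmin R _ h12 h21.
pose F (p : R * R) : R := kh p.2 * bmin p.2 * sum3 p.2 W p.1.
have mF : mble2 F.
  apply: measurable_funM.
    by apply: (measurableT_comp (intg_meas ik)).
  apply: measurable_funD; last first.
    by apply: (measurableT_comp mW); exact: measurable_funB.
  by apply: measurable_funD; [exact: measurable_fstp|exact: measurable_addp].
have iF : intg (mu \x mu)%E F.
  apply: (@intg_prod2 _ _ _ _ _ mu mu F (fun t => 3 * (\int[mu]_x W x) * (kh t * bmin t))) => //.
  - exact: intgZ.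
  - by move=> t; rewrite /F /=; apply: intgZ; exact: (Int_sum3 t iW).1.
  - move=> t; rewrite (_ : (fun x => `|F (x, t)|) = (fun x => F (x, t))); last first.
      apply/funext => x; rewrite ger0_norm// /F /= mulr_ge0 ?kb_ge0//.
      by have /andP[] := sum3_le t x aW.
    have [i3 e3] := Int_sum3 t iW.
    by rewrite /F /= IntZ// e3 mulrC.
split.
- split=> [x|x y xy].
    by apply: Int_ge0 => t; rewrite mulr_ge0 ?kb_ge0//; have /andP[] := sum3_le t x aW.
  rewrite /avg -IntZ; last exact: intg_avg aW.
  apply: Int_le; [exact: intg_avg aW|apply: intgZ; exact: intg_avg aW|] => t.
  rewrite mulrCA; apply: ler_wpM2l; first exact: kb_ge0.
  exact: (slow_sum3 t sW).2.
- exact: (@measurable_Int1 _ _ _ _ _ mu _ mF).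
- exact: intg_Int1 iF.
- move=> x; rewrite /avg -IntZ//; apply: Int_le; [exact: intg_avg aW|exact: intgZ|] => t.
  rewrite mulrC; apply: ler_wpM2r; first exact: kb_ge0.
  by have /andP[] := sum3_le t x aW.
Qed.

Lemma intg_kn_dlt n phi x : test_fun phi -> intg mu (fun t => kn n t * dlt t phi x).
Proof.
move=> tp; have [C [C0 hC]] := dlt_test_le tp.
apply: (@intg_le _ RM R mu _ (fun t => C * (kh t * bmin t * sum3 t wgt x))).
- by apply: measurable_funM; [exact: mble_kn|apply: mble_dlt; exact: test_mble].
- exact/intgZ/intg_avg/adm_wgt.
- move=> t; rewrite normrM (ger0_norm (kn_ge0 _ _)).
  apply: le_trans (ler_wpM2l (kn_ge0 _ _) (hC t x)) _.
  have s0 : 0 <= sum3 t wgt x by have /andP[] := sum3_le t x adm_wgt.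
  have b0 := bmin_ge0 t; have k1 := kn_le n t.
  rewrite (_ : C * (_ * _) = kh t * (C * bmin t * sum3 t wgt x)); last by ring.
  by rewrite ler_wpM2r// !mulr_ge0.
Qed.

Lemma Dn_le phi : test_fun phi -> exists C : R, 0 <= C /\
  forall n x, `|Dn n phi x| <= C * avg wgt x.
Proof.
move=> tp; have [C [C0 hC]] := dlt_test_le tp; exists C; split=> // n x.
have ia := intg_avg x adm_wgt.
rewrite /avg -IntZ//; apply: Int_abs; [exact: intg_kn_dlt|exact: intgZ|] => t.
rewrite normrM (ger0_norm (kn_ge0 _ _)).
apply: le_trans (ler_wpM2l (kn_ge0 _ _) (hC t x)) _.
have s0 : 0 <= sum3 t wgt x by have /andP[] := sum3_le t x adm_wgt.
have b0 := bmin_ge0 t; have k1 := kn_le n t.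
rewrite (_ : C * (_ * _) = kh t * (C * bmin t * sum3 t wgt x)); last by ring.
by rewrite ler_wpM2r// !mulr_ge0.
Qed.

Notation D := (Afrac (2^-1 : R)).

Lemma D_kernel phi x : test_fun phi ->
  intg mu (fun t => kh t * dlt t phi x) /\ \int[mu]_t (kh t * dlt t phi x) = ch * D phi x.
Proof.
move=> tp; have [|||h e] := @Afrac_kernel R 0 2^-1 phi x tp (lexx 0); [lra..|].
move: h e; rewrite add0r (_ : Afrac 0 phi = phi)//.
by apply/funext => y; exact: Fourier_inversion.
Qed.

Lemma Dn_cvg phi x : test_fun phi -> (fun n => Dn n phi x) @ \oo --> ch * D phi x.
Proof.
move=> tp; have [ik <-] := D_kernel x tp; have [C [C0 hC]] := dlt_test_le tp.
have mp := test_mble tp.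
have [|||||_ c] := @dct _ RM R mu (fun n t => kn n t * dlt t phi x)
  (fun t => kh t * dlt t phi x) (fun t => `|kh t * dlt t phi x|).
- by move=> n; apply: measurable_funM; [exact: mble_kn|exact: mble_dlt].
- exact: intg_meas ik.
- by apply: aeW => t; apply: cvgMl; exact: kn_cvg.
- exact: intg_norm.
- move=> n t; rewrite [leLHS]normrM [leRHS]normrM (ger0_norm (kn_ge0 _ _)) (ger0_norm (kap_ge0 _ _)).
  by rewrite ler_wpM2r// kn_le.
- exact: c.
Qed.

Lemma D_le phi : test_fun phi -> exists C : R, 0 <= C /\
  forall x, `|D phi x| <= C * avg wgt x.
Proof.
move=> tp; have [C [C0 hC]] := Dn_le tp; have c0 := @kcst_gt0 R _ h12 h21.
exists (ch^-1 * C); split; first by rewrite mulr_ge0// invr_ge0 ltW.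
move=> x; rewrite -mulrA ler_pdivlMl// -[X in X * _](ger0_norm (ltW c0)) -normrM.
have h : (fun n => `|Dn n phi x|) @ \oo --> `|ch * D phi x|.
  by apply: cvg_norm; exact: Dn_cvg.
exact: (cvg_seq_le h (fun n => hC n x)).
Qed.

Lemma mble_Int_dlt a phi : mble phi -> mble (fun x => \int[mu]_t (kap a t * dlt t phi x)).
Proof.
move=> mp; have mF : mble2 (fun p => kap a p.2 * dlt p.2 phi p.1).
  apply: measurable_funM; first by apply: (measurableT_comp (mble_kap a)).
  apply: measurable_funB; first exact: measurable_fstp.
  apply: measurable_funM => //; apply: measurable_funD; first exact: measurable_addp.
  by apply: (measurableT_comp mp); exact: measurable_funB.
exact: (@measurable_Int1 _ _ _ _ _ mu _ mF).
Qed.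

Lemma mble_D phi : test_fun phi -> mble (D phi).
Proof.
move=> tp; have c0 := @kcst_gt0 R _ h12 h21.
have := mble_Int_dlt 2^-1 (test_mble tp).
move=> /(measurable_funM (measurable_cst ch^-1)); congr measurable_fun.
by apply/funext => x /=; rewrite (D_kernel x tp).2 mulKf// gt_eqF.
Qed.

Lemma Lap_kernel phi x : test_fun phi ->
  intg mu (fun t => kap 1 t * dlt t phi x) /\
  \int[mu]_t (kap 1 t * dlt t phi x) = kcst 1 * Afrac 1 phi x.
Proof.
move=> tp; have [||||h e] := @Afrac_kernel R 0 1 phi x tp; [lra..|].
move: h e; rewrite add0r (_ : Afrac 0 phi = phi)//.
by apply/funext => y; exact: Fourier_inversion.
Qed.

(** The estimates for [Dn n phi] are uniform in [n] and hold for its second derivative as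
    well, since [Dn] commutes with derivatives; a second application of the second
    difference therefore gains again. *)
Lemma dlt_Dn_le phi : test_fun phi -> exists C : R, 0 <= C /\
  forall n s x, `|dlt s (Dn n phi) x| <= C * bmin s * sum3 s (avg wgt) x.
Proof.
move=> tp; have tp1 := test_fun_derive tp; have tp2 := test_fun_derive tp1.
have [C [C0 hC]] := Dn_le tp; have [C2 [C20 hC2]] := Dn_le tp2.
have [sa _ _ _] := adm_avg adm_wgt.
exists (3 * (C + C2)); split; first by rewrite mulr_ge0// addr_ge0.
move=> n s x; have h : 0 <= C + C2 by rewrite addr_ge0.
have := @dlt_slow R (Dn n phi) _ _ (fun x => (C + C2) * avg wgt x) s x
  (fun y => Dn_derive n y tp) (fun y => Dn_derive n y tp1) (slowZ h sa).
rewrite (_ : 3 * (C + C2) * bmin s * sum3 s (avg wgt) x =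
  3 * bmin s * sum3 s (fun x => (C + C2) * avg wgt x) x); last by rewrite /sum3; ring.
by apply=> y; [have := hC n y|have := hC2 n y]; have := sa.1 y; nra.
Qed.

Lemma D_Dn_le phi : test_fun phi -> exists C : R, 0 <= C /\
  forall n x, `|D (Dn n phi) x| <= C * avg (avg wgt) x.
Proof.
move=> tp; have [C [C0 hC]] := dlt_Dn_le tp; have c0 := @kcst_gt0 R _ h12 h21.
have aa := adm_avg adm_wgt.
exists (ch^-1 * C); split; first by rewrite mulr_ge0// invr_ge0 ltW.
move=> n x; rewrite -mulrA ler_pdivlMl// -[X in X * _](ger0_norm (ltW c0)) -normrM.
have [i e] := D_kernel x (Dn_test n tp); rewrite -e.
have ia := intg_avg x aa.
rewrite /avg -IntZ//; apply: Int_abs => //; [exact: intgZ|] => t.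
rewrite normrM (ger0_norm (kap_ge0 _ _)).
apply: le_trans (ler_wpM2l (kap_ge0 _ _) (hC n t x)) _.
by rewrite le_eqVlt; apply/orP; left; apply/eqP; rewrite /avg; ring.
Qed.

(** The composition of two operators of order [1/2] is the operator of order [1]. *)
Lemma D_Dn_cvg phi x : test_fun phi ->
  (fun n => D (Dn n phi) x) @ \oo --> ch * Afrac 1 phi x.
Proof.
move=> tp; have [C [C0 hC]] := dlt_Dn_le tp; have c0 := @kcst_gt0 R _ h12 h21.
have aa := adm_avg adm_wgt.
have [||||ik ek] := @Afrac_kernel R 2^-1 2^-1 phi x tp; [lra..|].
rewrite (_ : 2^-1 + 2^-1 = 1) in ek; last by field.
have [|||||_ c] := @dct _ RM R mu (fun n t => kh t * dlt t (Dn n phi) x)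
  (fun t => kh t * (ch * dlt t (D phi) x)) (fun t => C * (kh t * bmin t * sum3 t (avg wgt) x)).
- move=> n; exact: intg_meas (D_kernel x (Dn_test n tp)).1.
- have := intg_meas (intgZ ch ik); congr measurable_fun; apply/funext => t.
  by rewrite mulrCA.
- apply: aeW => t; apply: cvgMr.
  rewrite (_ : ch * _ = ch * D phi x - (ch * D phi (x + t) + ch * D phi (x - t)) / 2).
    by apply: cvgB; [exact: Dn_cvg|apply: cvgMl; apply: cvgD; exact: Dn_cvg].
  exact: mul_dltE.
- exact/intgZ/(intg_avg x aa).
- move=> n t; rewrite normrM (ger0_norm (kap_ge0 _ _)).
  apply: le_trans (ler_wpM2l (kap_ge0 _ _) (hC n t x)) _.
  by rewrite le_eqVlt; apply/orP; left; apply/eqP; ring.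
- rewrite (_ : \int[mu]_t _ = ch * (ch * Afrac 1 phi x)) in c; last first.
    rewrite -ek -IntZ//; congr Rintegral; apply/funext => t; by rewrite mulrCA.
  have {}c := @cvgMr _ _ _ _ _ (ch^-1) _ c.
  rewrite (mulKf (lt0r_neq0 c0)) in c.
  rewrite (_ : (fun n => D (Dn n phi) x) =
    (fun n => ch^-1 * \int[mu]_t (kh t * dlt t (Dn n phi) x))); first exact: c.
  by apply/funext => n; rewrite (D_kernel x (Dn_test n tp)).2 (mulKf (lt0r_neq0 c0)).
Qed.

Lemma sqi_avg K W : adm K W -> sqi mu W.
Proof.
move=> [sW mW iW hW]; split=> //.
have := @intg_bddM _ RM R mu K W W mW iW; apply.
by move=> x; rewrite ger0_norm// (sW.1 x).
Qed.

Lemma D_sqi phi : test_fun phi -> sqi mu (D phi) /\ intg mu (D phi).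
Proof.
move=> tp; have [C [C0 hC]] := D_le tp; have aa := adm_avg adm_wgt.
have [sW mW iW hW] := aa; have i := intgZ C iW.
have h : intg mu (D phi) by apply: intg_le i hC; exact: mble_D.
split=> //; split; first exact: mble_D.
have [_ i2] := sqiZ C (sqi_avg aa); apply: intg_le i2 _.
  by apply: measurable_funX; exact: mble_D.
move=> x; rewrite ger0_norm ?sqr_ge0// -real_normK ?num_real//.
by rewrite ler_sqr ?nnegrE// ?mulr_ge0// sW.1.
Qed.

Lemma mble_Afrac1 phi : test_fun phi -> mble (Afrac 1 phi).
Proof.
move=> tp; have c0 : 0 < kcst 1 :> R by apply: kcst_gt0; lra.
have := mble_Int_dlt 1 (test_mble tp).
move=> /(measurable_funM (measurable_cst (kcst 1)^-1)); congr measurable_fun.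
by apply/funext => x /=; rewrite (Lap_kernel x tp).2 mulKf// gt_eqF.
Qed.

Lemma frac_lap_D phi : test_fun phi -> frac_lap_test (1 / 4) phi = D phi.
Proof.
move=> tp; apply/funext => x; rewrite frac_lap_testE; last exact: test_intg.
by rewrite (_ : 2 * (1 / 4) = 2^-1)//; field.
Qed.

(** The relation defining [g] as the quarter Laplacian of [u] tests against
    [D phi] for smooth compactly supported [phi]; it may be applied to [Dn n phi],
    and [n] be sent to infinity. *)
Lemma lap14_transfer u g M phi : mble u -> (forall x, `|u x| <= M) ->
  is_lap14 u g -> test_fun phi ->
  intg mu (fun x => u x * Afrac 1 phi x) /\
  \int[mu]_x (g x * D phi x) = \int[mu]_x (u x * Afrac 1 phi x).
Proof.
move=> mu_ hu [/L2_sqi sg eg] tp; have c0 := @kcst_gt0 R _ h12 h21.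
have M0 : 0 <= M by apply: le_trans (hu 0); exact: normr_ge0.
have [C [C0 hC]] := Dn_le tp; have [C' [C'0 hC']] := D_Dn_le tp.
have aa := adm_avg adm_wgt; have aaa := adm_avg aa.
have [_ _ iaa _] := aaa.
have [mg ig] := sg.
have [|||||_ c1] := @dct _ RM R mu (fun n x => g x * Dn n phi x)
  (fun x => g x * (ch * D phi x)) (fun x => `|g x * (C * avg wgt x)|).
- by move=> n; apply: measurable_funM => //; apply: test_mble; exact: Dn_test.
- by apply: measurable_funM => //; apply: measurable_funM => //; exact: mble_D.
- by apply: aeW => x; apply: cvgMr; exact: Dn_cvg.
- by apply: intg_norm; apply: sqi_mul => //; apply: sqiZ; exact: sqi_avg aa.
- move=> n x; rewrite !normrM ler_wpM2l// ?normr_ge0//.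
  by apply: le_trans (hC n x) _; rewrite -normrM ler_norm.
- have [|||||i2 c2] := @dct _ RM R mu (fun n x => u x * D (Dn n phi) x)
    (fun x => u x * (ch * Afrac 1 phi x)) (fun x => M * (C' * avg (avg wgt) x)).
  + by move=> n; apply: measurable_funM => //; apply: mble_D; exact: Dn_test.
  + by apply: measurable_funM => //; apply: measurable_funM => //; exact: mble_Afrac1.
  + by apply: aeW => x; apply: cvgMr; exact: D_Dn_cvg.
  + exact/intgZ/intgZ.
  + by move=> n x; rewrite normrM ler_pM.
  + have E : (fun n => \int[mu]_x (g x * Dn n phi x)) =
        (fun n => \int[mu]_x (u x * D (Dn n phi) x)).
      apply/funext => n; have := eg _ (Dn_test n tp).
      by rewrite /regular_distr /frac_lap /regular_distr (frac_lap_D (Dn_test n tp)).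
    rewrite -E in c2; have e := seq_unique c1 c2.
    have i3 : intg mu (fun x => u x * Afrac 1 phi x).
      have := intgZ (ch^-1) i2; congr intg; apply/funext => x.
      exact: (@mulVKC (u x) (Afrac 1 phi x) ch (lt0r_neq0 c0)).
    split; first exact: i3.
    apply: (Int_mulVK (lt0r_neq0 c0) _ i3 e).
    exact: sqi_mul sg (D_sqi tp).1.
Qed.

End Transfer.

(** * The Gagliardo form *)

Section Gagliardo.
Context {R : realType}.
Implicit Types (f g u phi psi W : R -> R) (a b c s t x y M S K C L e r : R).
Notation mu := (@lebesgue_measure R).
Notation RM := (measurableTypeR R).
Notation mm := (@lebesgue_measure R \x @lebesgue_measure R)%E.
Notation mble f := (measurable_fun (@setT RM) (f : RM -> R)).
Notation mble2 f := (measurable_fun (@setT (RM * RM)) (f : RM * RM -> R)).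
Notation D := (Afrac (2^-1 : R)).
Local Opaque Afrac kcst.

(** Increments are indexed by position and step, so that translations act on the
    first variable only. *)
Definition dq f (p : R * R) : R := (f (p.1 + p.2) - f p.1) / p.2.

Definition gag f g : R := \int[mm]_p (dq f p * dq g p).

Definition fingag f : Prop := sqi mm (dq f).

Lemma kap1E t : kap 1 t = t^-1 ^+ 2.
Proof.
have [->|t0] := eqVneq t 0.
  rewrite /kap normr0 invr0 expr0n /powR eqxx; case: eqP => //= h; exfalso; lra.
rewrite /kap powRN -[1 + 1]/(2%:R) powR_mulrn// real_normK ?num_real//.
by rewrite exprVn.
Qed.

Lemma mble_inv : mble (fun t => t^-1).
Proof.
rewrite (_ : (fun t => t^-1) = fun t => t * kap 1 t).
  by apply: measurable_funM => //; exact: mble_kap.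
apply/funext => t; have [->|t0] := eqVneq t 0; first by rewrite invr0 mul0r.
by rewrite kap1E expr2 mulrA mulfV// mul1r.
Qed.

Lemma mble_dq f : mble f -> mble2 (dq f).
Proof.
move=> mf; apply: measurable_funM; last exact: measurable_sndp mble_inv.
by apply: measurable_funB; [exact: measurable_addp|exact: measurable_fstp].
Qed.

Definition ball1 S x : R := \1_(`[- S, S]%classic) x.

Lemma ball1_ge0 S x : 0 <= ball1 S x. Proof. by rewrite /ball1 indicE. Qed.

Lemma ball1_eq1 S x : `|x| <= S -> ball1 S x = 1.
Proof. by move=> h; rewrite /ball1 indicE mem_set//= in_itv/= -ler_norml. Qed.

Lemma intg_ball1 S : intg mu (ball1 S).
Proof. exact: integrable_indic_itv. Qed.

Lemma Int_ball1 S : 0 <= S -> \int[mu]_x ball1 S x = 2 * S.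
Proof.
move=> S0; rewrite /Rintegral integral_indic// setIT.
have : mu `[- S, S]%classic = (2 * S)%:E.
  rewrite lebesgue_measure_itv/= lte_fin; case: ltP => h.
    by rewrite -EFinB; congr EFin; ring.
  by congr EFin; lra.
by move=> h; exact: (congr1 fine h).
Qed.

Lemma Int_ball1_shift S t : 0 <= S -> intg mu (fun x => ball1 S x + ball1 S (x + t)) /\
  \int[mu]_x (ball1 S x + ball1 S (x + t)) = 4 * S.
Proof.
move=> S0; have i1 := intg_ball1 S; have i2 := intg_shift t i1.
by split; [exact: intgD|rewrite IntD// Int_shift// Int_ball1//; ring].
Qed.

Lemma intg_cauchy r : 0 < r -> intg mu (fun t => (r ^+ 2 + t ^+ 2)^-1) /\
  \int[mu]_t ((r ^+ 2 + t ^+ 2)^-1 : R) = pi / r.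
Proof.
move=> r0; have ri : 0 < r^-1 by rewrite invr_gt0.
have E : (fun t => (r ^+ 2 + t ^+ 2)^-1) = (fun t => r^-1 ^+ 2 * wgt (r^-1 * t + 0)).
  apply/funext => t; rewrite /wgt addr0; have h : r != 0 by rewrite gt_eqF.
  have e : 1 + (r^-1 * t) ^+ 2 = r^-1 ^+ 2 * (r ^+ 2 + t ^+ 2) by field.
  by rewrite e invfM mulVKf// expf_neq0// invr_eq0.
rewrite E; have iw := @intg_wgt R; split; first exact/intgZ/intg_affine.
rewrite IntZ; last exact: intg_affine.
by rewrite Int_affine// Int_wgt invrK; field; rewrite gt_eqF.
Qed.

(** For steps shorter than [r] use the Lipschitz bound, for longer ones the sup bound;
    either [x] or [x + t] lies in the support. *)
Lemma dq_lip_le f M S L r x t : (forall y, `|f y| <= M) -> vanish S f ->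
  (forall y z, `|f y - f z| <= L * `|y - z|) -> 0 < r ->
  dq f (x, t) ^+ 2 <=
    (L ^+ 2 * r ^+ 2 + 4 * M ^+ 2) * (r ^+ 2 + t ^+ 2)^-1 * (ball1 S x + ball1 S (x + t)).
Proof.
move=> hM hS hL r0; have q0 : 0 < r ^+ 2 + t ^+ 2 by rewrite ltr_wpDr ?sqr_ge0 ?exprn_gt0.
have A0 : 0 <= (L ^+ 2 * r ^+ 2 + 4 * M ^+ 2) * (r ^+ 2 + t ^+ 2)^-1.
  apply: divr_ge0; last exact: ltW.
  by apply: addr_ge0; apply: mulr_ge0 => //; exact: sqr_ge0.
have [h1|h1] := boolP ((S < `|x|) && (S < `|x + t|)).
  move/andP: h1 => [h1 h2]; rewrite /dq /= !hS// subrr mul0r expr0n /=.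
  by rewrite mulr_ge0 ?addr_ge0 ?ball1_ge0.
apply: (@le_trans _ _ ((L ^+ 2 * r ^+ 2 + 4 * M ^+ 2) * (r ^+ 2 + t ^+ 2)^-1)); last first.
  rewrite ler_peMr//; have b1 := ball1_ge0 S x; have b2 := ball1_ge0 S (x + t).
  by move: h1; rewrite negb_and -!leNgt => /orP[/ball1_eq1 ->|/ball1_eq1 ->]; lra.
rewrite ler_pdivlMr//= /dq /=; have [->|t0] := eqVneq t 0.
  rewrite invr0 mulr0 expr0n /= mul0r.
  by apply: addr_ge0; apply: mulr_ge0 => //; exact: sqr_ge0.
set d := f (x + t) - f x.
have d1 : d ^+ 2 <= L ^+ 2 * t ^+ 2.
  have h := hL (x + t) x; rewrite (_ : x + t - x = t) in h; last by ring.
  rewrite -(real_normK (num_real d)) -(real_normK (num_real t)) -exprMn.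
  by rewrite ler_sqr ?nnegrE// (le_trans _ h).
have d2 : d ^+ 2 <= 4 * M ^+ 2.
  rewrite -(real_normK (num_real d)) (_ : 4 * M ^+ 2 = (M + M) ^+ 2); last by ring.
  have h : `|d| <= M + M by apply: le_trans (ler_normB _ _) _; exact: lerD.
  by rewrite ler_sqr ?nnegrE// (le_trans _ h).
have t2 : 0 < t ^+ 2 by rewrite exprn_even_gt0.
rewrite expr_div_n mulrDr divfK ?gt_eqF//; apply: lerD => //.
by rewrite ler_wpM2r ?sqr_ge0// ler_pdivrMr.
Qed.

Lemma intg_dq_section f M S t : mble f -> (forall y, `|f y| <= M) -> vanish S f ->
  sqi mu (fun x => dq f (x, t)).
Proof.
move=> mf hM hS; have i1 : sqi mu f.
  split=> //; apply: (@intg_vanish R _ (M ^+ 2) S).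
  - exact: measurable_funX.
  - move=> x; rewrite normrX; have h := hM x; have h0 := normr_ge0 (f x).
    by rewrite ler_sqr ?nnegrE// (le_trans h0 h).
  - by move=> x hx; rewrite hS// expr0n.
rewrite /dq /=; have := sqiZ t^-1 (sqiB (sqi_shift t i1) i1); congr sqi.
by apply/funext => x; rewrite mulrC.
Qed.

(** The parameter [r] is a length scale. With [L = 1 / r] and [S] of order [r] the bound
    does not depend on [r], which is the scaling invariance of the energy. *)
Lemma gag_lip f M S L r : mble f -> 0 <= S -> (forall y, `|f y| <= M) -> vanish S f ->
  (forall y z, `|f y - f z| <= L * `|y - z|) -> 0 < r ->
  fingag f /\ \int[mm]_p (dq f p ^+ 2) <= 4 * S * (L ^+ 2 * r ^+ 2 + 4 * M ^+ 2) * (pi / r).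
Proof.
move=> mf S0 hM hS hL r0; have [ic ec] := intg_cauchy r0.
set A := L ^+ 2 * r ^+ 2 + 4 * M ^+ 2.
have m2 : mble2 (fun p => dq f p ^+ 2) by apply: measurable_funX; exact: mble_dq.
have sec t : intg mu (fun x => dq f (x, t) ^+ 2) := (intg_dq_section t mf hM hS).2.
have b t : \int[mu]_x (dq f (x, t) ^+ 2) <= 4 * S * A * (r ^+ 2 + t ^+ 2)^-1.
  have [i e] := Int_ball1_shift t S0.
  rewrite (_ : 4 * S * A * _ = A * (r ^+ 2 + t ^+ 2)^-1 * (4 * S)); last by ring.
  rewrite -e -IntZ//; apply: Int_le => //; first exact: intgZ.
  by move=> x; exact: dq_lip_le.
have i2 : intg mm (fun p => dq f p ^+ 2).
  apply: (@intg_prod2 _ _ _ _ _ mu mu _ (fun t => 4 * S * A * (r ^+ 2 + t ^+ 2)^-1)) => //.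
  - exact: intgZ.
  - move=> t; apply: le_trans (b t); rewrite le_eqVlt; apply/orP; left; apply/eqP.
    by congr Rintegral; apply/funext => x; rewrite ger0_norm// sqr_ge0.
split; first by split => //; exact: mble_dq.
rewrite Int_prod2// -ec -IntZ//; apply: Int_le => //; [exact: intg_Int2 i2|exact: intgZ].
Qed.

Lemma gag_section f g : fingag f -> fingag g ->
  gag f g = \int[mu]_t \int[mu]_x (dq f (x, t) * dq g (x, t)).
Proof. by move=> sf sg; rewrite /gag Int_prod2//; exact: sqi_mul. Qed.

(** Summation by parts for translations. *)
Lemma Int_increments u M psi t : mble u -> (forall x, `|u x| <= M) -> intg mu psi ->
  \int[mu]_x ((u (x + t) - u x) * (psi (x + t) - psi x)) = 2 * \int[mu]_x (u x * dlt t psi x).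
Proof.
move=> mu_ hM ip.
have ib v a : mble v -> (forall x, `|v x| <= M) -> intg mu (fun x => v x * psi (x + a)).
  by move=> mv hv; apply: (@intg_bddM _ RM R mu M v) => //; exact: intg_shift.
have mus : mble (fun x => u (x + t)) by apply: (measurableT_comp mu_); exact: measurable_funD.
have i1 := ib (fun x => u (x + t)) t mus (fun x => hM _).
have i2 := ib (fun x => u (x + t)) 0 mus (fun x => hM _).
have i3 := ib u t mu_ hM; have i4 := ib u 0 mu_ hM; have i5 := ib u (- t) mu_ hM.
have e1 : \int[mu]_x (u (x + t) * psi (x + t)) = \int[mu]_x (u x * psi (x + 0)).
  by rewrite -(Int_shift t i4); congr Rintegral; apply/funext => x; rewrite addr0.
have e2 : \int[mu]_x (u (x + t) * psi (x + 0)) = \int[mu]_x (u x * psi (x - t)).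
  rewrite -(Int_shift t i5); congr Rintegral; apply/funext => x.
  by rewrite addrK addr0.
rewrite (_ : (fun x => (u (x + t) - u x) * (psi (x + t) - psi x)) =
  (fun x => (u (x + t) * psi (x + t) + u x * psi (x + 0)) -
            (u (x + t) * psi (x + 0) + u x * psi (x + t)))); last first.
  by apply/funext => x; rewrite addr0; ring.
rewrite IntB; [|exact: intgD|exact: intgD]; rewrite !IntD// e1 e2.
rewrite (_ : (fun x => u x * dlt t psi x) = (fun x => u x * psi (x + 0) -
  2^-1 * (u x * psi (x + t) + u x * psi (x - t)))); last first.
  by apply/funext => x; rewrite /dlt addr0; field.
rewrite IntB//; last exact/intgZ/intgD.
rewrite IntZ ?IntD//; last exact: intgD.
by field.
Qed.

Lemma kap1_increments u M psi t : mble u -> (forall x, `|u x| <= M) -> intg mu psi ->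
  \int[mu]_x (u x * (kap 1 t * dlt t psi x)) =
  2^-1 * \int[mu]_x (dq u (x, t) * dq psi (x, t)).
Proof.
move=> mu_ hM ip; rewrite /dq /= kap1E.
have ib v : mble v -> (forall x, `|v x| <= M) -> forall w, intg mu w -> intg mu (fun x => v x * w x).
  by move=> mv hv w iw; exact: (@intg_bddM _ RM R mu M v).
have i2 a : intg mu (fun x => psi (x + a)) by exact: intg_shift.
have id : intg mu (dlt t psi).
  apply: intgB => //; have := intgZ 2^-1 (intgD (i2 t) (i2 (- t))); congr intg.
  by apply/funext => x; rewrite mulrC.
have iD : intg mu (fun x => (u (x + t) - u x) * (psi (x + t) - psi x)).
  have mus : mble (fun x => u (x + t)) by apply: (measurableT_comp mu_); exact: measurable_funD.
  have iq : intg mu (fun x => psi (x + t) - psi x) by exact: intgB.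
  have := intgB (ib (fun x => u (x + t)) mus (fun x => hM _) _ iq) (ib u mu_ hM _ iq).
  by congr intg; apply/funext => x; rewrite -mulrBl.
rewrite (_ : (fun x => u x * _) = (fun x => t^-1 ^+ 2 * (u x * dlt t psi x))); last first.
  by apply/funext => x; rewrite mulrCA.
rewrite IntZ; last exact: ib.
rewrite (_ : (fun x => _ / t * _) = (fun x => t^-1 ^+ 2 * ((u (x + t) - u x) * (psi (x + t) - psi x)))).
  by rewrite IntZ// (Int_increments t mu_ hM ip) [RHS]mulrCA mulKf.
by apply/funext => x; ring.
Qed.

Definition cB : R := (2 * kcst 1)^-1.

Lemma kcst1_gt0 : 0 < kcst 1 :> R.
Proof. by apply: kcst_gt0; lra. Qed.

Lemma cB_gt0 : 0 < cB.
Proof. by rewrite invr_gt0 mulr_gt0// kcst1_gt0. Qed.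

(** Fubini's theorem in the singular integral for the half Laplacian, then summation by
    parts at each step [t]. *)
Lemma Lap_form u M phi : mble u -> (forall x, `|u x| <= M) -> test_fun phi ->
  \int[mu]_x (u x * Afrac 1 phi x) =
  cB * \int[mu]_t \int[mu]_x (dq u (x, t) * dq phi (x, t)).
Proof.
move=> mu_ hM tp; have [C [C0 hC]] := Int_dlt_test tp; have mp := test_mble tp.
have M0 : 0 <= M by apply: le_trans (hM 0).
pose F (p : R * R) : R := u p.1 * (kap 1 p.2 * dlt p.2 phi p.1).
have mF : mble2 F.
  apply: measurable_funM; first exact: measurable_fstp.
  apply: measurable_funM; first by apply: (measurableT_comp (mble_kap 1)).
  apply: measurable_funB; first exact: measurable_fstp.
  apply: measurable_funM => //; apply: measurable_funD; first exact: measurable_addp.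
  by apply: (measurableT_comp mp); exact: measurable_funB.
have id t : intg mu (dlt t phi) by apply: test_intg; exact: test_dlt.
have iu t : intg mu (fun x => F (x, t)).
  by rewrite /F /=; apply: (@intg_bddM _ RM R mu M) => //; apply: intgZ.
have ik : intg mu (fun t => kap 1 t * bmin t) by apply: intg_kap_bmin; lra.
have iF : intg mm F.
  apply: (@intg_prod2 _ _ _ _ _ mu mu F (fun t => M * C * (kap 1 t * bmin t))) => //.
    exact: intgZ.
  move=> t; apply: (@le_trans _ _ (M * (kap 1 t * \int[mu]_x `|dlt t phi x|))).
    rewrite -!IntZ//; [|exact/intgZ/intg_norm|exact: intg_norm].
    apply: Int_le; [exact: intg_norm|exact/intgZ/intgZ/intg_norm|] => x.
    rewrite /F /= normrM ler_pM// normrM (ger0_norm (kap_ge0 _ _))//.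
  rewrite -mulrA ler_wpM2l// mulrCA ler_wpM2l ?kap_ge0//.
have k0 := kcst1_gt0.
transitivity ((kcst 1)^-1 * \int[mu]_x \int[mu]_t F (x, t)).
  rewrite -IntZ; last exact: intg_Int1 iF.
  congr Rintegral; apply/funext => x; have [i e] := Lap_kernel x tp.
  by rewrite /F /= IntZ// e (mulVKC _ _ (lt0r_neq0 k0)).
rewrite (Int_swap iF) /F /cB invfM [2^-1 * _]mulrC -mulrA; congr (_ * _).
have E t := kap1_increments t mu_ hM (test_intg tp).
have i2 := intg_Int2 iF.
rewrite -IntZ.
  by congr Rintegral; apply/funext => t; exact: E.
have := intgZ 2 i2; congr intg; apply/funext => t.
transitivity (2 * (2^-1 * \int[mu]_x (dq u (x, t) * dq phi (x, t)))).
  by apply: f_equal; exact: E.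
by rewrite mulVKf.
Qed.

(** The right-hand side is an iterated integral, because the energy of [u] is not known
    to be finite at this stage. *)
Lemma lap14_form u g M phi : mble u -> (forall x, `|u x| <= M) -> is_lap14 u g ->
  test_fun phi ->
  \int[mu]_x (g x * D phi x) = cB * \int[mu]_t \int[mu]_x (dq u (x, t) * dq phi (x, t)).
Proof.
move=> mu_ hM hg tp; rewrite (lap14_transfer mu_ hM hg tp).2.
exact: Lap_form.
Qed.

Lemma test_lip phi : test_fun phi -> exists L : R, 0 <= L /\
  forall y z, `|phi y - phi z| <= L * `|y - z|.
Proof.
move=> tp; have [L [L0 hL]] := test_bounded (test_fun_derive tp).
exists L; split; first exact: ltW.
move=> y z; have h x : is_derive (x : R) (1 : R) phi (derive1 phi x).
  exact/smooth_is_derive/test_smooth.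
have [s _ e] := @mvt_bound R phi (derive1 phi) (y - z) z h.
by move: e; rewrite subrKC => ->; rewrite normrM mulrC ler_wpM2r.
Qed.

Lemma test_data phi : test_fun phi -> exists M S L, [/\ 0 <= S,
  forall y, `|phi y| <= M, vanish S phi & forall y z, `|phi y - phi z| <= L * `|y - z|].
Proof.
move=> tp; have [M [_ hM]] := test_bounded tp; have [_ [S hS]] := (test_funP phi).1 tp.
have [L [_ hL]] := test_lip tp; exists M, (Num.max 0 S), L; split=> //.
  by rewrite le_max lexx.
by move=> x; rewrite gt_max => /andP[_]; exact: hS.
Qed.

Lemma test_fingag phi : test_fun phi -> fingag phi.
Proof.
move=> tp; have [M [S [L [S0 hM hS hL]]]] := test_data tp.
exact: (gag_lip (test_mble tp) S0 hM hS hL ltr01).1.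
Qed.

(** Both sides are integrals over [t] of pairings with a second difference, which is a
    symmetric operator. *)
Lemma D_sym phi psi : test_fun phi -> test_fun psi ->
  \int[mu]_x (D phi x * psi x) = \int[mu]_x (phi x * D psi x).
Proof.
move=> tp tq.
have h12 : 2^-1 <= 2^-1 :> R by []. have h21 : 2^-1 <= 1 :> R by lra.
have ik := @intg_kap_bmin R _ h12 h21.
have c0 := @kcst_gt0 R _ h12 h21.
have key f g : test_fun f -> test_fun g ->
  intg mm (fun p => kap 2^-1 p.2 * dlt p.2 f p.1 * g p.1) /\
  kcst 2^-1 * \int[mu]_x (D f x * g x) =
    \int[mu]_t (kap 2^-1 t * \int[mu]_x (g x * dlt t f x)).
  move=> tf tg; have [C [C0 hC]] := Int_dlt_test tf; have [M [M0 hM]] := test_bounded tg.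
  have mf := test_mble tf; have mg := test_mble tg.
  pose F (p : R * R) : R := kap 2^-1 p.2 * dlt p.2 f p.1 * g p.1.
  have mF : mble2 F.
    apply: measurable_funM; last exact: measurable_fstp.
    apply: measurable_funM; first by apply: (measurableT_comp (mble_kap 2^-1)).
    apply: measurable_funB; first exact: measurable_fstp.
    apply: measurable_funM => //; apply: measurable_funD; first exact: measurable_addp.
    by apply: (measurableT_comp mf); exact: measurable_funB.
  have id t : intg mu (dlt t f) by apply: test_intg; exact: test_dlt.
  have igd t : intg mu (fun x => g x * dlt t f x).
    by apply: (@intg_bddM _ RM R mu M).
  have eF t : (fun x => F (x, t)) = (fun x => kap 2^-1 t * (g x * dlt t f x)).
    by apply/funext => x; rewrite /F /= -mulrA [_ * g x]mulrC.
  have iF : intg mm F.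
    apply: (@intg_prod2 _ _ _ _ _ mu mu F (fun t => M * C * (kap 2^-1 t * bmin t))) => //.
    - exact: intgZ.
    - by move=> t; rewrite eF; exact: intgZ.
    - move=> t; apply: (@le_trans _ _ (M * (kap 2^-1 t * \int[mu]_x `|dlt t f x|))).
        rewrite -!IntZ//; [|exact/intgZ/intg_norm|exact: intg_norm].
        apply: Int_le; [|exact/intgZ/intgZ/intg_norm|] => [|x].
          by apply: intg_norm; rewrite eF; exact: intgZ.
        rewrite /F /= !normrM (ger0_norm (kap_ge0 _ _)) mulrC ler_wpM2r//.
        by rewrite mulr_ge0// kap_ge0.
      by rewrite -mulrA ler_wpM2l ?(ltW M0)// mulrCA ler_wpM2l ?kap_ge0.
  split=> //; rewrite -IntZ.
    transitivity (\int[mu]_x \int[mu]_t F (x, t)).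
      congr Rintegral; apply/funext => x; have [i e] := D_kernel x tf.
      rewrite mulrA -e mulrC -IntZ//; congr Rintegral; apply/funext => t.
      by rewrite /F /= mulrC.
    rewrite (Int_swap iF); congr Rintegral; apply/funext => t.
    by rewrite eF IntZ.
  have [s1 i1] := D_sqi tf.
  have := @intg_bddM _ RM R mu M g (D f) mg i1 hM; congr intg.
  by apply/funext => x; rewrite mulrC.
apply: (mulfI (lt0r_neq0 c0)); rewrite (key _ _ tp tq).2.
have -> : \int[mu]_x (phi x * D psi x) = \int[mu]_x (D psi x * phi x).
  by congr Rintegral; apply/funext => x; rewrite mulrC.
rewrite (key _ _ tq tp).2; congr Rintegral; apply/funext => t; congr (_ * _).
have [M [M0 hM]] := test_bounded tp; have [M' [M'0 hM']] := test_bounded tq.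
apply: (@mulfI _ 2) => //.
rewrite -(Int_increments t (test_mble tq) hM' (test_intg tp)).
rewrite -(Int_increments t (test_mble tp) hM (test_intg tq)).
by congr Rintegral; apply/funext => x; rewrite mulrC.
Qed.

Lemma test_lap14 phi : test_fun phi -> is_lap14 phi (D phi).
Proof.
move=> tp; split; first by apply/L2_sqi; exact: (D_sqi tp).1.
move=> psi tq; rewrite /frac_lap /regular_distr (frac_lap_D tq).
exact: D_sym.
Qed.

(** Plancherel for the quarter Laplacian, in the space variable. *)
Lemma D_form phi psi : test_fun phi -> test_fun psi ->
  \int[mu]_x (D phi x * D psi x) = cB * gag phi psi.
Proof.
move=> tp tq; have [M [_ hM]] := test_bounded tp.
rewrite (lap14_form (test_mble tp) hM (test_lap14 tp) tq) gag_section//; exact: test_fingag.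
Qed.

Lemma D_norm phi : test_fun phi ->
  \int[mu]_x (D phi x ^+ 2) = cB * \int[mm]_p (dq phi p ^+ 2).
Proof. by move=> tp; rewrite -[RHS](D_form tp tp). Qed.

End Gagliardo.

(** * Mollification and the Gagliardo energy *)

Section EnergySpace.
Context {R : realType}.
Implicit Types (f g h u phi psi W : R -> R) (a b c s t x y M S K C L e r : R).
Notation mu := (@lebesgue_measure R).
Notation RM := (measurableTypeR R).
Notation mm := (@lebesgue_measure R \x @lebesgue_measure R)%E.
Notation mble f := (measurable_fun (@setT RM) (f : RM -> R)).
Notation mble2 f := (measurable_fun (@setT (RM * RM)) (f : RM * RM -> R)).
Notation D := (Afrac (2^-1 : R)).
Local Opaque Afrac kcst moll.

Lemma mble_conv k f : mble k -> mble f -> mble (convol k f).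
Proof.
move=> mk mf; have mF : mble2 (fun p => k p.2 * f (p.1 - p.2)).
  apply: measurable_funM; first exact: measurable_sndp.
  by apply: (measurableT_comp mf); exact: measurable_funB.
exact: (@measurable_Int1 _ _ _ _ _ mu _ mF).
Qed.

Lemma moll_intg n : intg mu (moll n : R -> R).
Proof. exact/test_intg/moll_test. Qed.

Lemma intg_conv_bdd k f M x : intg mu k -> mble f -> (forall x, `|f x| <= M) ->
  intg mu (fun y => k y * f (x - y)).
Proof.
move=> ik mf hM.
have := @intg_bddM _ RM R mu M (fun y => f (x - y)) k (mble_refl x mf) ik (fun y => hM _).
by congr intg; apply/funext => y; rewrite mulrC.
Qed.

Lemma conv_bounded n f M x : mble f -> (forall x, `|f x| <= M) ->
  `|convol (moll n) f x| <= M.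
Proof.
move=> mf hM; have ik := moll_intg n.
rewrite -[leRHS]mulr1 -(Int_moll n) -IntZ//.
apply: Int_abs; [exact: intg_conv_bdd mf hM|exact: intgZ|] => y.
by rewrite normrM (ger0_norm (moll_ge0 n y)) mulrC ler_wpM2r ?moll_ge0.
Qed.

(** Jensen's inequality for the probability density [moll n]. *)
Lemma conv_sqr n h M : mble h -> (forall x, `|h x| <= M) ->
  intg mu (fun x => h x ^+ 2) ->
  sqi mu (convol (moll n) h) /\
  \int[mu]_x (convol (moll n) h x ^+ 2) <= \int[mu]_x (h x ^+ 2).
Proof.
move=> mh hM ih; have ik := moll_intg n; have mk := intg_meas ik.
have m2 : mble (fun x => h x ^+ 2) by exact: measurable_funX.
have mc := mble_conv mk mh.
pose F (p : R * R) : R := moll n p.2 * h (p.1 - p.2) ^+ 2.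
have mF : mble2 F.
  apply: measurable_funM; first exact: measurable_sndp.
  by apply: (measurableT_comp m2); exact: measurable_funB.
have ish y : intg mu (fun x => h (x - y) ^+ 2) := intg_shift (- y) ih.
have iF : intg mm F.
  apply: (@intg_prod2 _ _ _ _ _ mu mu F (fun y => (\int[mu]_x (h x ^+ 2)) * moll n y)) => //.
  - exact: intgZ.
  - by move=> y; rewrite /F /=; apply: intgZ; exact: ish.
  - move=> y; rewrite mulrC -(Int_shift (- y) ih) -IntZ//.
    apply: Int_le; [apply: intg_norm; rewrite /F /=; exact: intgZ|exact: intgZ|] => x.
    by rewrite ger0_norm// /F mulr_ge0 ?moll_ge0 ?sqr_ge0.
have pt x : convol (moll n) h x ^+ 2 <= \int[mu]_y F (x, y).
  set m := convol (moll n) h x.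
  have i1 := intg_conv_bdd x ik mh hM.
  have i2 : intg mu (fun y => F (x, y)).
    apply: (intg_conv_bdd (M := M ^+ 2) x ik m2) => y.
    by rewrite normrX; have h1 := hM y; rewrite ler_sqr ?nnegrE// (le_trans _ h1).
  have : 0 <= \int[mu]_y (moll n y * (h (x - y) - m) ^+ 2).
    by apply: Int_ge0 => y; rewrite mulr_ge0 ?moll_ge0 ?sqr_ge0.
  rewrite (_ : (fun y => _) = (fun y => (F (x, y) + m ^+ 2 * moll n y) -
    (2 * m) * (moll n y * h (x - y)))); last by apply/funext => y; rewrite /F /=; ring.
  rewrite IntB; [|by apply: intgD => //; exact: intgZ|exact: intgZ].
  rewrite IntD//; last exact: intgZ.
  rewrite (IntZ (m ^+ 2) ik) (IntZ (2 * m) i1) Int_moll -[\int[mu]_y (moll n y * _)]/m; lra.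
have i1 := intg_Int1 iF.
have s1 : sqi mu (convol (moll n) h).
  split=> //; apply: intg_le i1 _; first exact: measurable_funX.
  by move=> x; rewrite ger0_norm ?sqr_ge0.
split=> //; apply: (@le_trans _ _ (\int[mu]_x \int[mu]_y F (x, y))).
  by apply: Int_le => //; exact: s1.2.
rewrite (Int_swap iF); rewrite [leRHS](_ : _ = (\int[mu]_x (h x ^+ 2)) * \int[mu]_y moll n y); last first.
  by rewrite Int_moll mulr1.
rewrite -IntZ// le_eqVlt; apply/orP; left; apply/eqP.
congr Rintegral; apply/funext => y.
by rewrite /F /= IntZ// [\int[mu]_x (_ (x - y) ^+ 2)](Int_shift (- y) ih) mulrC.
Qed.

(** Mollification commutes with difference quotients in the position variable. *)
Lemma conv_dq n f M x t : mble f -> (forall x, `|f x| <= M) ->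
  dq (convol (moll n) f) (x, t) = convol (moll n) (fun z => dq f (z, t)) x.
Proof.
move=> mf hM; have ik := moll_intg n.
have i1 := intg_conv_bdd x ik mf hM; have i2 := intg_conv_bdd (x + t) ik mf hM.
rewrite /dq /= /convol -IntB// mulrC -IntZ; last exact: intgB.
congr Rintegral; apply/funext => y.
rewrite (_ : x + t - y = x - y + t); last by ring.
by ring.
Qed.

Lemma conv_test n f M S : mble f -> (forall x, `|f x| <= M) -> vanish S f ->
  test_fun (convol (moll n) f).
Proof.
move=> mf hM hS; have -> : convol (moll n) f = convol f (moll n).
  apply/funext => x; rewrite conv_symE; last exact: intg_conv_bdd (moll_intg n) mf hM.
  by rewrite /convol; congr Rintegral; apply/funext => y; rewrite mulrC.
exact: (test_conv (intg_vanish mf hM hS) hS (moll_test n)).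
Qed.

Lemma dq_bounded f M x t : (forall x, `|f x| <= M) -> `|dq f (x, t)| <= 2 * M * `|t^-1|.
Proof.
move=> hM; rewrite normrM ler_wpM2r//= (le_trans (ler_normB _ _))//.
by have := hM (x + t); have := hM x; lra.
Qed.

Lemma vanish_sqi f M S : mble f -> (forall x, `|f x| <= M) -> vanish S f -> sqi mu f.
Proof.
move=> mf hM hS; split=> //; apply: (@intg_vanish R _ (M ^+ 2) S).
- exact: measurable_funX.
- move=> x; rewrite normrX; have h := hM x; have h0 := normr_ge0 (f x).
  by rewrite ler_sqr ?nnegrE// (le_trans h0 h).
- by move=> x hx; rewrite hS// expr0n.
Qed.

(** Jensen's inequality at each step [t]. *)
Lemma conv_gag n f M S : mble f -> (forall x, `|f x| <= M) -> vanish S f -> fingag f ->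
  \int[mm]_p (dq (convol (moll n) f) p ^+ 2) <= \int[mm]_p (dq f p ^+ 2).
Proof.
move=> mf hM hS [m2 i2]; have [mc ic] := test_fingag (conv_test n mf hM hS).
rewrite !Int_prod2//; apply: Int_le; [exact: intg_Int2 ic|exact: intg_Int2 i2|] => t.
have [ms is_] := intg_dq_section t mf hM hS.
have [_ h] := conv_sqr n ms (fun x => dq_bounded x t hM) is_.
apply: le_trans h; rewrite le_eqVlt; apply/orP; left; apply/eqP.
by congr Rintegral; apply/funext => x; rewrite (conv_dq n x t mf hM).
Qed.

(** Convolution with an even kernel is symmetric. *)
Lemma conv_transfer n f g M M' : mble f -> (forall x, `|f x| <= M) -> intg mu g ->
  (forall x, `|g x| <= M') ->
  \int[mu]_x (f x * convol (moll n) g x) = \int[mu]_x (convol (moll n) f x * g x).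
Proof.
move=> mf hM ig hM'; have ik := moll_intg n; have mk := intg_meas ik; have mg := intg_meas ig.
have M0 : 0 <= M by apply: le_trans (hM 0).
pose F (p : R * R) : R := f p.1 * (moll n p.2 * g (p.1 - p.2)).
have mF : mble2 F.
  apply: measurable_funM; first exact: measurable_fstp.
  apply: measurable_funM; first exact: measurable_sndp.
  by apply: (measurableT_comp mg); exact: measurable_funB.
have ish y : intg mu (fun x => g (x - y)) := intg_shift (- y) ig.
have iF : intg mm F.
  apply: (@intg_prod2 _ _ _ _ _ mu mu F (fun y => (M * \int[mu]_x `|g x|) * moll n y)) => //.
  - exact: intgZ.
  - move=> y; rewrite /F /=; apply: (@intg_bddM _ RM R mu M) => //; exact: intgZ.
  - move=> y; rewrite mulrAC -(Int_shift (- y) (intg_norm ig)) -IntZ; last exact: intg_norm.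
    apply: Int_le; [|by apply: intgZ; exact: intg_norm|] => [|x].
      apply: intg_norm; rewrite /F /=.
      by apply: (@intg_bddM _ RM R mu M) => //; exact: intgZ.
    rewrite /F /= normrM [X in _ * X]normrM [X in _ * (X * _)]ger0_norm ?moll_ge0//.
    by rewrite mulrA ler_wpM2r// ler_wpM2r ?moll_ge0.
pose F' (p : R * R) : R := moll n p.2 * f (p.1 + p.2) * g p.1.
have mfa : mble2 (fun p => f (p.1 + p.2)) by exact: measurable_addp.
have mF' : mble2 F'.
  apply: measurable_funM; last exact: measurable_fstp.
  by apply: measurable_funM => //; exact: measurable_sndp.
have eF y : \int[mu]_x F (x, y) = \int[mu]_x F' (x, y).
  have i1 : intg mu (fun x => F (x, y)).
    by rewrite /F /=; apply: (@intg_bddM _ RM R mu M) => //; exact: intgZ.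
  rewrite -(Int_shift y i1); congr Rintegral; apply/funext => x.
  by rewrite /F /F' /= addrK mulrA [f _ * _]mulrC.
have fy y : mble (fun x => f (x + y)).
  by apply: (measurableT_comp mf); exact: measurable_funD.
have iFy y : intg mu (fun x => F' (x, y)).
  rewrite /F' /=; have := intgZ (moll n y) (@intg_bddM _ RM R mu M _ _ (fy y) ig (fun x => hM _)).
  by congr intg; apply/funext => x; rewrite mulrA.
have iF' : intg mm F'.
  apply: (@intg_prod2 _ _ _ _ _ mu mu F' (fun y => (M * \int[mu]_x `|g x|) * moll n y)) => //.
    exact: intgZ.
  move=> y; rewrite mulrAC -IntZ; last exact: intg_norm.
  apply: Int_le; [exact: intg_norm|by apply: intgZ; exact: intg_norm|] => x.
  rewrite /F' /= normrM [X in X * _]normrM [X in X * _ * _]ger0_norm ?moll_ge0//.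
  by rewrite ler_wpM2r// [M * _]mulrC ler_wpM2l ?moll_ge0.
transitivity (\int[mu]_x \int[mu]_y F (x, y)).
  congr Rintegral; apply/funext => x; rewrite /convol -IntZ//.
  exact: intg_conv_bdd mg hM'.
rewrite (Int_swap iF) (_ : (fun y => \int[mu]_x F (x, y)) = (fun y => \int[mu]_x F' (x, y))).
  rewrite -(Int_swap iF'); congr Rintegral; apply/funext => x.
  have ic := intg_conv_bdd x ik mf hM.
  rewrite mulrC /convol -(Int_opp ic) -IntZ; last exact: intg_opp ic.
  congr Rintegral; apply/funext => y.
  by rewrite /F' /= mollN opprK [RHS]mulrC.
by apply/funext => y; exact: eF.
Qed.

End EnergySpace.

(** * Duality with functions of finite energy *)

Section Duality.
Context {R : realType}.
Implicit Types (f g h u phi psi W : R -> R) (a b c s t x y M S K C L e r : R).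
Notation mu := (@lebesgue_measure R).
Notation RM := (measurableTypeR R).
Notation mm := (@lebesgue_measure R \x @lebesgue_measure R)%E.
Notation mble f := (measurable_fun (@setT RM) (f : RM -> R)).
Notation mble2 f := (measurable_fun (@setT (RM * RM)) (f : RM * RM -> R)).
Notation D := (Afrac (2^-1 : R)).
Local Opaque Afrac kcst moll.

Lemma test_sqi phi : test_fun phi -> sqi mu phi.
Proof.
move=> tp; have [M [S [L [S0 hM hS hL]]]] := test_data tp.
exact: vanish_sqi (test_mble tp) hM hS.
Qed.

(** The functions against which the bracket is evaluated, products of test functions
    with bounded functions of finite energy, belong to this class. *)
Definition energy_class psi := [/\ mble psi, exists M, forall x, `|psi x| <= M,
  exists S, vanish S psi & fingag psi].

Lemma dq_cvg_ae (f_ : nat -> R -> R) f : {ae mu, forall x, f_ ^~ x @ \oo --> f x} ->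
  {ae mm, forall p, (fun n => dq (f_ n) p) @ \oo --> dq f p}.
Proof.
move=> /ae_prod[A [mA A0 sA]]; exists A; split=> // p /= np; apply: sA => /= -[h1 h2].
apply: np.
by apply: cvgMl; exact: cvgB.
Qed.

(** Convergence holds almost everywhere, and mollification does not increase the norms. *)
Lemma conv_moll_strong psi : energy_class psi ->
  (fun n => \int[mu]_x ((convol (moll n) psi x - psi x) ^+ 2)) @ \oo --> 0 /\
  (fun n => \int[mm]_p ((dq (convol (moll n) psi) p - dq psi p) ^+ 2)) @ \oo --> 0.
Proof.
move=> [mp [M hM] [S hS] fp]; have ae := conv_moll_cvg (bounded_locint mp hM).
have sp := vanish_sqi mp hM hS; split; apply: ae_cvg_strong => //.
- by move=> n; exact: (conv_sqr n mp hM sp.2).1.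
- by move=> n; exact: (conv_sqr n mp hM sp.2).2.
- by move=> n; exact: test_fingag (conv_test n mp hM hS).
- by move=> n; exact: (conv_gag n mp hM hS fp).
- exact: dq_cvg_ae.
Qed.

Lemma sqr_triangle a b c : (a - b) ^+ 2 <= 2 * (a - c) ^+ 2 + 2 * (b - c) ^+ 2 :> R.
Proof. by have := sqr_ge0 (a + b - 2 * c); nra. Qed.

Lemma strong_cauchy d (T : measurableType d) (m : {measure set T -> \bar R})
  (h_ : nat -> T -> R) (h : T -> R) : (forall n, sqi m (h_ n)) -> sqi m h ->
  (fun n => \int[m]_x ((h_ n x - h x) ^+ 2)) @ \oo --> 0 ->
  forall e, 0 < e -> exists N, forall n p, (N <= n)%N -> (N <= p)%N ->
    \int[m]_x ((h_ n x - h_ p x) ^+ 2) <= e.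
Proof.
move=> sh s hc e e0; have e4 : 0 < e / 4 by rewrite divr_gt0.
move/cvgrPdist_lt: hc => /(_ _ e4)[N _ hN]; exists N => n p Nn Np.
have b k : (N <= k)%N -> \int[m]_x ((h_ k x - h x) ^+ 2) <= e / 4.
  by move=> /hN; rewrite sub0r normrN => /ltW; apply: le_trans; exact: ler_norm.
have ib k := (sqiB (sh k) s).2.
apply: (@le_trans _ _ (\int[m]_x (2 * (h_ n x - h x) ^+ 2 + 2 * (h_ p x - h x) ^+ 2))).
  apply: Int_le; first exact: (sqiB (sh n) (sh p)).2.
    by apply: intgD; apply: intgZ.
  by move=> x; exact: sqr_triangle.
rewrite IntD ?IntZ//; [|exact: intgZ|exact: intgZ].
by have := b _ Nn; have := b _ Np; lra.
Qed.

Lemma D_form_diff phi psi : test_fun phi -> test_fun psi ->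
  \int[mu]_x ((D phi x - D psi x) ^+ 2) = cB * \int[mm]_p ((dq phi p - dq psi p) ^+ 2).
Proof.
move=> tp tq; have [s1 _] := D_sqi tp; have [s2 _] := D_sqi tq.
rewrite (sqr_normB s1 s2) (sqr_normB (test_fingag tp) (test_fingag tq)).
have E (A B C A' B' C' : R) : A = cB * A' -> B = cB * B' -> C = cB * C' ->
  A - 2 * C + B = cB * (A' - 2 * C' + B') by move=> -> -> ->; ring.
exact: E (D_norm tp) (D_norm tq) (D_form tp tq).
Qed.

(** Completeness of [L^2] produces the quarter Laplacian of a function of finite
    energy from those of its mollifications. *)
Lemma energy_lap14 psi : energy_class psi -> exists g, is_lap14 psi g /\
  (fun n => \int[mu]_x ((D (convol (moll n) psi) x - g x) ^+ 2)) @ \oo --> 0.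
Proof.
move=> ep; have [mp [M hM] [S hS] fp] := ep; have [c1 c2] := conv_moll_strong ep.
have tn n := conv_test n mp hM hS; have fn n := test_fingag (tn n).
have sD n : sqi mu (D (convol (moll n) psi)) := (D_sqi (tn n)).1.
have [|g [sg gc]] := @riesz_fischer _ RM R mu (fun n => D (convol (moll n) psi)) sD.
  move=> e e0; have cp := @cB_gt0 R; have e' : 0 < e / cB by rewrite divr_gt0.
  have [N hN] := strong_cauchy fn fp c2 e'; exists N => n p Nn Np.
  rewrite (D_form_diff (tn n) (tn p)) mulrC -ler_pdivlMr//.
  exact: hN.
exists g; split=> //; split; first exact/L2_sqi.
move=> phi tp; rewrite /frac_lap /regular_distr (frac_lap_D tp).
have sp := test_sqi tp; have [sDp _] := D_sqi tp.
have a1 := sqi_cvg_ip sp sD sg gc.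
have sn n : sqi mu (convol (moll n) psi) := test_sqi (tn n).
have a2 := sqi_cvg_ip sDp sn (vanish_sqi mp hM hS) c1.
have E : (fun n => \int[mu]_x (phi x * D (convol (moll n) psi) x)) =
    (fun n => \int[mu]_x (D phi x * convol (moll n) psi x)).
  by apply/funext => n; rewrite -(D_sym tp (tn n)).
rewrite E in a1; have := seq_unique a1 a2.
under eq_Rintegral do rewrite mulrC; move=> ->.
by congr Rintegral; apply/funext => x; rewrite mulrC.
Qed.

(** Two candidates have the same mollifications. *)
Lemma lap14_unique f g g' : is_lap14 f g -> is_lap14 f g' ->
  {ae mu, forall x, g x = g' x}.
Proof.
move=> [/L2_sqi sg eg] [/L2_sqi sg' eg'].
have l := sqi_locint (sqiB sg sg').
apply: ae_imp (conv_moll_cvg l) => x hx.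
have z n : convol (moll n) (fun x => g x - g' x) x = 0.
  rewrite conv_symE; last exact: locint_conv l (moll_test n).
  have tp : test_fun (fun y => moll n (x - y)) by apply: test_fun_refl; exact: moll_test.
  have := eg _ tp; rewrite -(eg' _ tp) /regular_distr => e.
  have sp := test_sqi tp.
  rewrite (_ : (fun y => _) = (fun y => g y * moll n (x - y) - g' y * moll n (x - y))).
    by rewrite IntB ?e ?subrr//; exact: sqi_mul.
  by apply/funext => y; rewrite mulrC mulrBl.
have : (fun n => convol (moll n) (fun x => g x - g' x) x) @ \oo --> (0 : R).
  by rewrite (_ : (fun n => _) = (fun=> 0)); [exact: cvg_cst|exact/funext].
by move=> /(seq_unique hx)/eqP; rewrite subr_eq0 => /eqP.
Qed.

Lemma sqi_Int_ae g g' h : sqi mu g -> sqi mu g' -> sqi mu h ->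
  {ae mu, forall x, g x = g' x} -> \int[mu]_x (h x * g x) = \int[mu]_x (h x * g' x).
Proof.
move=> [mg _] [mg' _] [mh _] e; apply: Int_ae.
- exact: measurable_funM.
- exact: measurable_funM.
- by apply: ae_imp e => x ->.
Qed.

(** Approximation of [psi] by its mollifications; the quarter Laplacians converge strongly
    to the one of [psi] by uniqueness. *)
Lemma form_pairing f g psi h M : mble f -> (forall x, `|f x| <= M) -> fingag f ->
  is_lap14 f g -> energy_class psi -> is_lap14 psi h ->
  \int[mu]_x (g x * h x) = cB * gag f psi.
Proof.
move=> mf hf ff fg ep eh; have [mp [M' hM] [S hS] fp] := ep.
have [_ c2] := conv_moll_strong ep; have [g0 [eg0 c0]] := energy_lap14 ep.
have sg := (L2_sqi _).1 fg.1; have sh := (L2_sqi _).1 eh.1; have sg0 := (L2_sqi _).1 eg0.1.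
have tn n := conv_test n mp hM hS; have fn n := test_fingag (tn n).
have sD n : sqi mu (D (convol (moll n) psi)) := (D_sqi (tn n)).1.
rewrite -(sqi_Int_ae sg0 sh sg (lap14_unique eg0 eh)).
have a1 := sqi_cvg_ip sg sD sg0 c0.
have a2 : (fun n => cB * gag f (convol (moll n) psi)) @ \oo --> cB * gag f psi.
  by apply: cvgMr; exact: sqi_cvg_ip ff fn fp c2.
apply: (seq_unique a1); rewrite (_ : (fun n => _) = fun n => cB * gag f (convol (moll n) psi))//.
apply/funext => n; rewrite (lap14_form mf hf fg (tn n)) gag_section//.
Qed.

(** ** Caccioppoli's inequality *)

Definition chi r x : R := clamp (2 - `|x| / r).

Lemma mble_chi r : mble (chi r).
Proof.
apply: mble_clamp; apply: measurable_funB => //; apply: measurable_funM => //.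
Qed.

Lemma chi_le r x : `|chi r x| <= 1.
Proof. by rewrite ger0_norm ?clamp_ge0 ?clamp_le1. Qed.

Lemma vanish_chi r : 0 < r -> vanish (2 * r) (chi r).
Proof. by move=> r0 x h; apply: clamp_eq0; rewrite subr_le0 ler_pdivlMr// ltW. Qed.

Lemma chi_eq1 r x : 0 < r -> `|x| <= r -> chi r x = 1.
Proof.
move=> r0 h; apply: clamp_eq1; have h2 : `|x| / r <= 1 by rewrite ler_pdivrMr// mul1r.
by lra.
Qed.

Lemma chi_lip r y z : 0 < r -> `|chi r y - chi r z| <= r^-1 * `|y - z|.
Proof.
move=> r0; apply: le_trans (clamp_lip _ _) _.
rewrite (_ : 2 - `|y| / r - _ = r^-1 * (`|z| - `|y|)); last by ring.
rewrite normrM ger0_norm ?invr_ge0 ?(ltW r0)// ler_wpM2l ?invr_ge0 ?(ltW r0)//.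
by rewrite (distrC y); exact: ler_dist_dist.
Qed.

Lemma chi_gag r : 0 < r -> fingag (chi r) /\ \int[mm]_p (dq (chi r) p ^+ 2) <= 40 * pi.
Proof.
move=> r0; have r2 : 0 <= 2 * r by rewrite mulr_ge0// ltW.
have [h1 h2] := gag_lip (mble_chi r) r2 (chi_le r) (vanish_chi r0) (fun y z => chi_lip y z r0) r0.
split=> //; apply: le_trans h2 _; rewrite le_eqVlt; apply/orP; left; apply/eqP.
by field; rewrite gt_eqF.
Qed.

(** The kernel is Lipschitz with compact support, hence continuous in mean under
    translations, at a linear rate. *)
Lemma conv_lip n u M : mble u -> (forall x, `|u x| <= M) -> exists L : R,
  forall y z, `|convol (moll n) u y - convol (moll n) u z| <= L * `|y - z|.
Proof.
move=> mu_ hM; have [_ [S [L [S0 _ hS hL]]]] := test_data (moll_test n : test_fun (moll n : R -> R)).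
have M0 : 0 <= M by apply: le_trans (hM 0).
have ik := @moll_intg R n; have mk := intg_meas ik.
exists (M * L * (4 * S)) => y z.
have i1 x := intg_conv_bdd x ik mu_ hM.
have ir x : intg mu (fun v => moll n (x - v) * u v).
  have := @intg_bddM _ RM R mu M u (fun v => moll n (x - v)) mu_ (intg_refl x ik) hM.
  by congr intg; apply/funext => v; rewrite mulrC.
rewrite (conv_symE (i1 y)) (conv_symE (i1 z)) -IntB//.
have [ib eb] := Int_ball1_shift (z - y) S0.
rewrite -mulrA (mulrC (4 * S)) mulrA -eb -IntZ//.
have ib' := intg_refl y ib; rewrite -(Int_refl y (intgZ _ ib)).
apply: Int_abs => //; first exact: intgB.
  exact: intg_refl (intgZ _ ib).
move=> v; rewrite -mulrBl normrM mulrC.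
have lb : `|moll n (y - v) - moll n (z - v)| <=
    L * `|y - z| * (ball1 S (y - v) + ball1 S (y - v + (z - y))).
  have b1 := ball1_ge0 S (y - v); have b2 := ball1_ge0 S (y - v + (z - y)).
  have e : y - v + (z - y) = z - v by ring.
  have h := hL (y - v) (z - v); rewrite (_ : y - v - (z - v) = y - z) in h; last by ring.
  have h0 : 0 <= L * `|y - z| by apply: le_trans h.
  have [h1|h1] := boolP ((S < `|y - v|) && (S < `|z - v|)).
    move/andP: h1 => [h1 h2]; rewrite !hS// subrr normr0.
    by rewrite mulr_ge0// addr_ge0.
  rewrite e in b2; apply: le_trans h _; rewrite ler_peMr// e.
  by move: h1; rewrite negb_and -!leNgt => /orP[/ball1_eq1 ->|/ball1_eq1 ->]; lra.
rewrite -!mulrA; apply: ler_pM => //; rewrite mulrA; exact: lb.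
Qed.

Lemma lip_fingag f M S L : mble f -> (forall y, `|f y| <= M) -> vanish S f ->
  (forall y z, `|f y - f z| <= L * `|y - z|) -> fingag f.
Proof.
move=> mf hM hS hL; have S0 : 0 <= Num.max 0 S by rewrite le_max lexx.
have hS' : vanish (Num.max 0 S) f by move=> x; rewrite gt_max => /andP[_]; exact: hS.
exact: (gag_lip mf S0 hM hS' hL ltr01).1.
Qed.

Lemma mul_lip f g M M' L L' y z : (forall y, `|f y| <= M) -> (forall y, `|g y| <= M') ->
  (forall y z, `|f y - f z| <= L * `|y - z|) -> (forall y z, `|g y - g z| <= L' * `|y - z|) ->
  `|f y * g y - f z * g z| <= (M * L' + M' * L) * `|y - z|.
Proof.
move=> hf hg lf lg.
rewrite (_ : _ - _ = f y * (g y - g z) + g z * (f y - f z)); last by ring.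
apply: le_trans (ler_normD _ _) _; rewrite !normrM mulrDl -!mulrA.
by apply: lerD; apply: ler_pM.
Qed.

Lemma dqM f g p : dq (fun x => f x * g x) p = f (p.1 + p.2) * dq g p + g p.1 * dq f p.
Proof. by rewrite /dq; ring. Qed.

(** A quadratic inequality for [X]: the energy [X] is bounded by a multiple of its square
    root, up to lower order terms. *)
Lemma cacc_arith X I J Y A b : X = I + J -> `|J| <= b -> I ^+ 2 <= A * Y ->
  Y <= 2 * X + 2 * b -> 0 <= A -> X <= 4 * A + 3 * b :> R.
Proof.
move=> eX; rewrite ler_norml => /andP[J1 J2] hI hY A0; rewrite leNgt; apply/negP => h.
have b0 : 0 <= b by lra.
have h1 : A * Y <= A * (4 * (X - b)) by apply: ler_wpM2l => //; lra.
have h2 : (X - b) ^+ 2 <= I ^+ 2 by rewrite ler_sqr ?nnegrE; lra.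
have h3 : (X - b) ^+ 2 <= A * (4 * (X - b)) by lra.
have h4 : 0 < X - b by lra.
have : (X - b) * (X - b) <= (4 * A) * (X - b) by move: h3; rewrite expr2; lra.
rewrite ler_pM2r//; lra.
Qed.

(** The identity
    [(d (chi f))^2 = d f * d (chi^2 f) + f f_+ (d chi)^2] lets the equation be
    tested with [chi^2 f], where [f] is a mollification of [u]. *)
Lemma cutoff_energy u g M n r : mble u -> (forall x, `|u x| <= M) -> is_lap14 u g -> 0 < r ->
  let h := fun x => chi r x * convol (moll n) u x in
  fingag h /\ \int[mm]_p (dq h p ^+ 2) <=
    4 * (cB^-1 * \int[mu]_x (g x ^+ 2)) + 3 * (M ^+ 2 * (40 * pi)).
Proof.
move=> mu_ hM ug r0 h; have ik := @moll_intg R n; have mk := intg_meas ik.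
have M0 : 0 <= M by apply: le_trans (hM 0).
have cp := @cB_gt0 R; have sg := (L2_sqi _).1 ug.1.
pose f := convol (moll n) u; pose psi x := chi r x * h x.
have mf : mble f by exact: mble_conv.
have hf x : `|f x| <= M by exact: conv_bounded.
have [L hL] := conv_lip n mu_ hM.
have mchi := mble_chi r; have lchi := fun y z => chi_lip y z r0.
have mh : mble h by exact: measurable_funM.
have bmul v x : (forall x, `|v x| <= M) -> `|chi r x * v x| <= M.
  by move=> hv; rewrite normrM -[leRHS]mul1r ler_pM// chi_le.
have hh x : `|h x| <= M by exact: bmul.
have hp x : `|psi x| <= M by exact: bmul.
have mp : mble psi by exact: measurable_funM.
have vh : vanish (2 * r) h by move=> x hx; rewrite /h vanish_chi// mul0r.
have vp : vanish (2 * r) psi by move=> x hx; rewrite /psi vanish_chi// mul0r.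
have lh := fun y z => mul_lip y z (chi_le r) hf lchi hL.
have lp := fun y z => mul_lip y z (chi_le r) hh lchi lh.
have [fc bc] := chi_gag r0.
have fh : fingag h := lip_fingag mh hh vh lh.
have fp : fingag psi := lip_fingag mp hp vp lp.
split=> //.
(* The remainder has no derivative of [f], so that it is bounded by the energy of [chi]. *)
have key p : dq h p ^+ 2 = dq f p * dq psi p + f (p.1 + p.2) * f p.1 * dq (chi r) p ^+ 2.
  by rewrite /psi /h -/f /dq; ring.
have mff : mble2 (fun p => f (p.1 + p.2) * f p.1).
  by apply: measurable_funM; [exact: measurable_addp|exact: measurable_fstp].
have iJ : intg mm (fun p => f (p.1 + p.2) * f p.1 * dq (chi r) p ^+ 2).
  apply: (@intg_bddM _ (RM * RM)%type R mm (M * M)) => //; first exact: fc.2.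
  by move=> p; rewrite normrM ler_pM.
have iI : intg mm (fun p => dq f p * dq psi p).
  rewrite (_ : (fun p => _) = (fun p => dq h p ^+ 2 - f (p.1 + p.2) * f p.1 * dq (chi r) p ^+ 2)).
    by apply: intgB => //; exact: fh.2.
  by apply/funext => p; rewrite key addrK.
apply: (@cacc_arith _ (\int[mm]_p (dq f p * dq psi p))
  (\int[mm]_p (f (p.1 + p.2) * f p.1 * dq (chi r) p ^+ 2)) (\int[mm]_p (dq psi p ^+ 2))).
- by rewrite -IntD//; congr Rintegral; apply/funext => p; exact: key.
- apply: (@le_trans _ _ (M ^+ 2 * \int[mm]_p (dq (chi r) p ^+ 2))); last first.
    by rewrite ler_wpM2l ?sqr_ge0.
  rewrite -IntZ; last exact: fc.2.
  apply: Int_abs => //; first by apply: intgZ; exact: fc.2.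
  move=> p; rewrite normrM [X in X * _]normrM [X in _ * X <= _]ger0_norm ?sqr_ge0//.
  rewrite (expr2 M).
  by rewrite ler_wpM2r ?sqr_ge0// ler_pM.
- have tphi := conv_test n mp hp vp.
  have e : \int[mu]_x (g x * D (convol (moll n) psi) x) = cB * \int[mm]_p (dq f p * dq psi p).
    have e0 := lap14_form mu_ hM ug tphi; have e1 := Int_prod2 iI.
    rewrite e0 e1; apply: f_equal; congr Rintegral; apply/funext => t.
    have [ms is_] := intg_dq_section t mp hp vp.
    have i1 : intg mu (fun x => dq psi (x, t)).
      have ip := intg_vanish mp hp vp.
      have := intgZ t^-1 (intgB (intg_shift t ip) ip); congr intg.
      by apply/funext => x; rewrite mulrC.
    have mdu : mble (fun x => dq u (x, t)).
      rewrite /dq /=; apply: measurable_funM => //; apply: measurable_funB => //.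
      by apply: (measurableT_comp mu_); exact: measurable_funD.
    have T := conv_transfer n mdu (fun x => dq_bounded x t hM) i1 (fun x => dq_bounded x t hp).
    transitivity (\int[mu]_x (dq u (x, t) * convol (moll n) (fun z => dq psi (z, t)) x)).
      by congr Rintegral; apply/funext => x; rewrite (conv_dq n x t mp hp).
    by rewrite T; congr Rintegral; apply/funext => x; rewrite -(conv_dq n x t mu_ hM).
  have [sD _] := D_sqi tphi.
  have := cauchy_schwarz sg sD; rewrite e (D_norm tphi) => h1.
  have h2 := conv_gag n mp hp vp fp.
  have G0 : 0 <= \int[mu]_x (g x ^+ 2) by apply: Int_ge0 => x; exact: sqr_ge0.
  have h3 : \int[mu]_x (g x ^+ 2) * (cB * \int[mm]_p (dq (convol (moll n) psi) p ^+ 2)) <=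
     \int[mu]_x (g x ^+ 2) * (cB * \int[mm]_p (dq psi p ^+ 2)).
    by apply: ler_wpM2l => //; apply: ler_wpM2l => //; exact: ltW.
  have c2 : 0 < cB ^+ 2 :> R by rewrite exprn_gt0.
  have h4 := le_trans h1 h3.
  rewrite -(ler_pM2l c2) -exprMn; apply: le_trans h4 _.
  rewrite le_eqVlt; apply/orP; left; apply/eqP.
  set G := \int[mu]_x _; set Y := \int[mm]_p _.
  have c0 : cB != 0 :> R by rewrite gt_eqF.
  by rewrite expr2; move: (cB : R) c0 G Y => c c0 G Y; field.
- apply: (@le_trans _ _ (\int[mm]_p (2 * dq h p ^+ 2 + 2 * M ^+ 2 * dq (chi r) p ^+ 2))).
    apply: Int_le; first exact: fp.2.
      by apply: intgD; apply: intgZ; [exact: fh.2|exact: fc.2].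
    move=> p; rewrite /psi dqM.
    set a := chi r _; set b := dq h p; set c := h p.1; set d := dq (chi r) p.
    have a1 : (a * b) ^+ 2 <= b ^+ 2.
      rewrite exprMn ler_piMl ?sqr_ge0// -(real_normK (num_real a)) exprn_ile1//.
      exact: chi_le.
    have c1 : (c * d) ^+ 2 <= M ^+ 2 * d ^+ 2.
      rewrite exprMn ler_wpM2r ?sqr_ge0// -(real_normK (num_real c)).
      by rewrite ler_sqr ?nnegrE//; exact: hh.
    have s := sqr_ge0 (a * b - c * d); nra.
  rewrite IntD ?IntZ; [|exact: fc.2|exact: fh.2|by apply: intgZ; exact: fh.2|by apply: intgZ; exact: fc.2].
  rewrite lerD2l -mulrA ler_wpM2l// ler_wpM2l ?sqr_ge0//.
- apply: mulr_ge0; first by rewrite invr_ge0 ltW.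
  by apply: Int_ge0 => x; exact: sqr_ge0.
Qed.

(** The bound of [cutoff_energy] depends neither on the cutoff nor on the mollification,
    so that Fatou's lemma applies along both. *)
Lemma lap14_fingag u g M : mble u -> (forall x, `|u x| <= M) -> is_lap14 u g -> fingag u.
Proof.
move=> mu_ hM ug; have r0 n : 0 < n.+1%:R :> R by [].
pose h n x := chi n.+1%:R x * convol (moll n) u x.
have H n := cutoff_energy n mu_ hM ug (r0 n).
have ae : {ae mu, forall x, h ^~ x @ \oo --> u x}.
  apply: ae_imp (conv_moll_cvg (bounded_locint mu_ hM)) => x hx.
  rewrite -[u x]mul1r; apply: cvgM => //.
  apply: cvg_near_cst; exists (Num.trunc `|x|) => // n /= hn.
  apply: chi_eq1 => //; apply: le_trans (ltW (truncnS_gt _)) _.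
  by rewrite ler_nat ltnS.
split; first exact: mble_dq.
have [|||||i _] := @fatou_intg _ (RM * RM)%type R mm (fun n p => dq (h n) p ^+ 2) (fun p => dq u p ^+ 2)
  (4 * (cB^-1 * \int[mu]_x (g x ^+ 2)) + 3 * (M ^+ 2 * (40 * pi))).
- by move=> n; exact: (H n).1.2.
- by move=> n p; exact: sqr_ge0.
- by move=> n; exact: (H n).2.
- by apply: measurable_funX; exact: mble_dq.
- have [A [mA A0 sA]] := dq_cvg_ae ae; exists A; split=> // p /= np; apply: sA => /= c.
  by apply: np; rewrite expr2; under eq_fun do rewrite expr2; exact: cvgM.
- exact: i.
Qed.

End Duality.

(** * The bracket of the equation as a Gagliardo form *)

Section Bracket.
Context {R : realType}.
Implicit Types (f g h u w phi psi W : R -> R) (a b c s t x y M S K C L e r : R).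
Notation mu := (@lebesgue_measure R).
Notation RM := (measurableTypeR R).
Notation mm := (@lebesgue_measure R \x @lebesgue_measure R)%E.
Notation mble f := (measurable_fun (@setT RM) (f : RM -> R)).
Notation mble2 f := (measurable_fun (@setT (RM * RM)) (f : RM * RM -> R)).
Notation D := (Afrac (2^-1 : R)).
Local Opaque Afrac kcst moll.

(** Bounded functions of finite energy form an algebra. *)
Definition bfg f := [/\ mble f, exists M, forall x, `|f x| <= M & fingag f].

Lemma sqi_bddM d (T : measurableType d) (m : {measure set T -> \bar R}) (f g : T -> R) M :
  measurable_fun setT f -> (forall x : T, `|f x| <= M) -> sqi m g -> sqi m (fun x : T => f x * g x).
Proof.
move=> mf hM [mg ig]; have mfg : measurable_fun setT (fun x : T => f x * g x) by exact: measurable_funM.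
split=> //; apply: (@intg_le _ T R m _ (fun x : T => M ^+ 2 * g x ^+ 2)).
- exact: measurable_funX.
- exact: intgZ.
- move=> x; rewrite ger0_norm ?sqr_ge0// exprMn ler_wpM2r ?sqr_ge0//.
  rewrite -(real_normK (num_real (f x))) ler_sqr ?nnegrE//.
  exact: le_trans (hM x).
Qed.

Lemma dqD f g p : dq (fun x => f x + g x) p = dq f p + dq g p.
Proof. by rewrite /dq; ring. Qed.

Lemma dqZ c f p : dq (fun x => c * f x) p = c * dq f p.
Proof. by rewrite /dq; ring. Qed.

Lemma dqB f g p : dq (fun x => f x - g x) p = dq f p - dq g p.
Proof. by rewrite /dq; ring. Qed.

Lemma fingagM f g M M' : mble f -> mble g -> (forall x, `|f x| <= M) ->
  (forall x, `|g x| <= M') -> fingag f -> fingag g -> fingag (fun x => f x * g x).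
Proof.
move=> mf mg hM hM' ff fg; rewrite /fingag.
rewrite (_ : dq (fun x => f x * g x) = (fun p => f (p.1 + p.2) * dq g p + g p.1 * dq f p)).
  apply: sqiD; [apply: (@sqi_bddM _ _ _ _ _ M)|apply: (@sqi_bddM _ _ _ _ _ M')] => //.
    exact: measurable_addp.
  exact: measurable_fstp.
by apply/funext => p; exact: dqM.
Qed.

Lemma fingagZ c f : fingag f -> fingag (fun x => c * f x).
Proof.
rewrite /fingag => /(sqiZ c); congr sqi.
by apply/funext => p; rewrite dqZ.
Qed.

Lemma fingagD f g : fingag f -> fingag g -> fingag (fun x => f x + g x).
Proof.
rewrite /fingag => ff fg; have := sqiD ff fg; congr sqi.
by apply/funext => p; rewrite dqD.
Qed.

Lemma fingagB f g : fingag f -> fingag g -> fingag (fun x => f x - g x).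
Proof.
rewrite /fingag => ff fg; have := sqiB ff fg; congr sqi.
by apply/funext => p; rewrite dqB.
Qed.

Lemma bfgM f g : bfg f -> bfg g -> bfg (fun x => f x * g x).
Proof.
move=> [mf [M hM] ff] [mg [M' hM'] fg]; split.
- exact: measurable_funM.
- by exists (M * M') => x; rewrite normrM ler_pM.
- exact: fingagM hM hM' ff fg.
Qed.

Lemma energy_bfg psi : energy_class psi -> bfg psi.
Proof. by move=> [mp [M hM] _ fp]; split=> //; exists M. Qed.

Lemma energy_mul f psi : bfg f -> energy_class psi -> energy_class (fun x => f x * psi x).
Proof.
move=> bf ep; have [m b fi] := bfgM bf (energy_bfg ep); case: ep => _ _ [S hS] _.
by split=> //; exists S => x h; rewrite hS// mulr0.
Qed.

Lemma energy_add phi psi : energy_class phi -> energy_class psi ->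
  energy_class (fun x => phi x + psi x).
Proof.
move=> [mf [M hM] [S hS] ff] [mg [M' hM'] [S' hS'] fg]; split.
- exact: measurable_funD.
- by exists (M + M') => x; rewrite (le_trans (ler_normD _ _))// lerD.
- by exists (Num.max S S') => x; rewrite gt_max => /andP[h h']; rewrite hS// hS'// addr0.
- exact: fingagD.
Qed.

Lemma energy_scale c psi : energy_class psi -> energy_class (fun x => c * psi x).
Proof.
move=> [mf [M hM] [S hS] ff]; split.
- exact: measurable_funM.
- by exists (`|c| * M) => x; rewrite normrM ler_wpM2l.
- by exists S => x h; rewrite hS// mulr0.
- exact: fingagZ.
Qed.

Lemma energy_sub phi psi : energy_class phi -> energy_class psi ->
  energy_class (fun x => phi x - psi x).
Proof.
move=> ep eq; rewrite (_ : (fun x => _) = (fun x => phi x + -1 * psi x)).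
  by apply: energy_add => //; exact: energy_scale.
by apply/funext => x; rewrite mulN1r.
Qed.

Lemma test_energy phi : test_fun phi -> energy_class phi.
Proof.
move=> tp; have [M [S [L [S0 hM hS hL]]]] := test_data tp; split.
- exact: test_mble.
- by exists M.
- by exists S.
- exact: test_fingag.
Qed.

Lemma gagD w f g : fingag w -> fingag f -> fingag g ->
  gag w (fun x => f x + g x) = gag w f + gag w g.
Proof.
move=> fw ff fg; rewrite /gag -IntD; [|exact: sqi_mul|exact: sqi_mul].
by congr Rintegral; apply/funext => p; rewrite dqD mulrDr.
Qed.

Lemma gagZ w c f : fingag w -> fingag f -> gag w (fun x => c * f x) = c * gag w f.
Proof.
move=> fw ff; rewrite /gag -IntZ; last exact: sqi_mul.
by congr Rintegral; apply/funext => p; rewrite dqZ mulrCA.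
Qed.

Lemma gagB w f g : fingag w -> fingag f -> fingag g ->
  gag w (fun x => f x - g x) = gag w f - gag w g.
Proof.
move=> fw ff fg; rewrite /gag -IntB; [|exact: sqi_mul|exact: sqi_mul].
by congr Rintegral; apply/funext => p; rewrite dqB mulrBr.
Qed.

Lemma dq0 p : dq (fun=> 0) p = 0 :> R.
Proof. by rewrite /dq subrr mul0r. Qed.

Lemma gag0 w : gag w (fun=> 0) = 0.
Proof.
rewrite /gag (_ : (fun p => _) = fun=> 0) ?Int0//.
by apply/funext => p; rewrite dq0 mulr0.
Qed.

Lemma fingag0 : fingag (fun=> 0 : R).
Proof.
rewrite /fingag (_ : dq _ = fun=> 0); first exact: sqi0.
by apply/funext => p; exact: dq0.
Qed.

Lemma gag_sum (I : Type) (s : seq I) w (f : I -> R -> R) : fingag w ->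
  (forall i, fingag (f i)) ->
  fingag (fun x => \sum_(i <- s) f i x) /\
  gag w (fun x => \sum_(i <- s) f i x) = \sum_(i <- s) gag w (f i).
Proof.
move=> fw ff; elim: s => [|i s [IH1 IH2]].
  rewrite big_nil (_ : (fun x => _) = fun=> 0); first by split; [exact: fingag0|exact: gag0].
  by apply/funext => x; rewrite big_nil.
rewrite big_cons (_ : (fun x => _) = fun x => f i x + \sum_(i <- s) f i x); last first.
  by apply/funext => x; rewrite big_cons.
by rewrite gagD// IH2; split=> //; exact: fingagD.
Qed.

(** Mollifying one factor of a product converges in energy: the terms where the
    difference falls on the mollified factor converge strongly, the others by
    dominated convergence. *)
Lemma gag_conv_cvg w u psi : fingag w -> bfg u -> energy_class psi ->
  (fun n => gag w (fun x => u x * convol (moll n) psi x)) @ \oo -->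
  gag w (fun x => u x * psi x).
Proof.
move=> fw [mu_ [K hK] fu] ep; have [mp [M hM] [S hS] fp] := ep.
have [_ c2] := conv_moll_strong ep.
pose psin n := convol (moll n) psi.
have tn n := conv_test n mp hM hS; have fn n : fingag (psin n) := test_fingag (tn n).
have mn n : mble (psin n) := test_mble (tn n).
have hn n x : `|psin n x| <= M by exact: conv_bounded.
have mua : mble2 (fun p => u (p.1 + p.2)) by exact: measurable_addp.
have s1 : sqi mm (fun p => u (p.1 + p.2) * dq w p) by apply: sqi_bddM fw.
have c1 := sqi_cvg_ip s1 fn fp c2.
have m2 v : mble v -> mble2 (fun p => v p.1 * (dq u p * dq w p)).
  move=> mv; apply: measurable_funM; first exact: measurable_fstp.
  by apply: measurable_funM; [exact: fu.1|exact: fw.1].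
have iuw : intg mm (fun p => dq u p * dq w p) := sqi_mul fu fw.
have ibd v : mble v -> (forall x, `|v x| <= M) -> intg mm (fun p => v p.1 * (dq u p * dq w p)).
  move=> mv hv; apply: (@intg_bddM _ (RM * RM)%type R mm M) => //; exact: measurable_fstp.
have ae1 := conv_moll_cvg (bounded_locint mp hM).
have [|||||_ c3] := @dct _ (RM * RM)%type R mm (fun n p => psin n p.1 * (dq u p * dq w p))
  (fun p => psi p.1 * (dq u p * dq w p)) (fun p => M * `|dq u p * dq w p|).
- by move=> n; exact: m2.
- exact: m2.
- have [A [mA A0 sA]] := ae_prod ae1; exists A; split=> // p /= np; apply: sA => /= -[h1 _].
  by apply: np; exact: cvgMl.
- by apply: intgZ; exact: intg_norm.
- by move=> n p; rewrite normrM ler_wpM2r.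
have E v : mble v -> (forall x, `|v x| <= M) -> fingag v ->
    gag w (fun x => u x * v x) = \int[mm]_p (u (p.1 + p.2) * dq w p * dq v p) +
      \int[mm]_p (v p.1 * (dq u p * dq w p)).
  move=> mv hv fv; rewrite -IntD; [|exact: sqi_mul|exact: ibd].
  by rewrite /gag; congr Rintegral; apply/funext => p; rewrite dqM; ring.
rewrite (E psi)// (_ : (fun n => _) = (fun n => \int[mm]_p (u (p.1 + p.2) * dq w p * dq (psin n) p) +
      \int[mm]_p (psin n p.1 * (dq u p * dq w p)))); first exact: cvgD.
by apply/funext => n; exact: (E (psin n) (mn n) (hn n) (fn n)).
Qed.

Lemma is_lap14_ae f f' g : mble f -> mble f' -> {ae mu, forall x, f x = f' x} ->
  is_lap14 f g -> is_lap14 f' g.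
Proof.
move=> mf mf' e [l h]; split=> // phi tp; rewrite (h phi tp).
rewrite /frac_lap /regular_distr (frac_lap_D tp); have mD := mble_D tp.
apply: Int_ae; [exact: measurable_funM|exact: measurable_funM|].
by apply: ae_imp e => x ->.
Qed.

(** The sets of candidates coincide, hence so do the chosen representatives. *)
Lemma lap14_ae f f' : mble f -> mble f' -> {ae mu, forall x, f x = f' x} ->
  lap14 f = lap14 f'.
Proof.
move=> mf mf' e; rewrite /lap14; congr xget; apply/seteqP; split=> g /=.
  exact: is_lap14_ae.
apply: is_lap14_ae => //; apply: ae_imp e => x -> //.
Qed.

Lemma lap14_spec f g : is_lap14 f g -> is_lap14 f (lap14 f).
Proof. by move=> h; exact: (@xgetPex _ _ [set g | is_lap14 f g] (ex_intro _ g h)). Qed.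

Lemma is_lap14D f g f' g' M M' : mble f -> (forall x, `|f x| <= M) ->
  mble f' -> (forall x, `|f' x| <= M') -> is_lap14 f g -> is_lap14 f' g' ->
  is_lap14 (fun x => f x + f' x) (fun x => g x + g' x).
Proof.
move=> mf hM mf' hM' [/L2_sqi lg h] [/L2_sqi lg' h']; split.
  by apply/L2_sqi; exact: sqiD.
move=> phi tp; have := h phi tp; have := h' phi tp.
rewrite /frac_lap /regular_distr (frac_lap_D tp) => e' e; have sp := test_sqi tp.
have [_ iD] := D_sqi tp.
have i1 := @intg_bddM _ RM R mu M f _ mf iD hM.
have i2 := @intg_bddM _ RM R mu M' f' _ mf' iD hM'.
rewrite (_ : (fun x => (g x + g' x) * phi x) = (fun x => g x * phi x + g' x * phi x)); last first.
  by apply/funext => x; rewrite mulrDl.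
rewrite IntD; [|exact: sqi_mul|exact: sqi_mul].
rewrite e e' -IntD//; congr Rintegral; apply/funext => x; by rewrite mulrDl.
Qed.

Lemma is_lap14Z c f g M : mble f -> (forall x, `|f x| <= M) -> is_lap14 f g ->
  is_lap14 (fun x => c * f x) (fun x => c * g x).
Proof.
move=> mf hM [/L2_sqi lg h]; split; first by apply/L2_sqi; exact: sqiZ.
move=> phi tp; have := h phi tp.
rewrite /frac_lap /regular_distr (frac_lap_D tp) => e; have sp := test_sqi tp.
have [_ iD] := D_sqi tp; have i1 := @intg_bddM _ RM R mu M f _ mf iD hM.
transitivity (c * \int[mu]_x (g x * phi x)).
  rewrite -IntZ; last exact: sqi_mul.
  by congr Rintegral; apply/funext => x; rewrite mulrA.
by rewrite e -IntZ//; congr Rintegral; apply/funext => x; rewrite mulrA.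
Qed.

Lemma energy_lap14_norm psi g : energy_class psi -> is_lap14 psi g ->
  \int[mu]_x (g x ^+ 2) = cB * \int[mm]_p (dq psi p ^+ 2).
Proof.
move=> ep eg; have [mp [M hM] _ fp] := ep.
exact: (form_pairing mp hM fp eg ep eg).
Qed.

Lemma energy_Hdot12 psi psi' : mble psi -> energy_class psi' ->
  {ae mu, forall x, psi' x = psi x} -> Hdot12 psi.
Proof.
move=> mp ep e; have [mp' [M hM] [S hS] fp] := ep.
have [g [eg _]] := energy_lap14 ep; split=> //; last first.
  by exists g; exact: is_lap14_ae eg.
have mw : mble (fun x => ((1 + `|x|) `^ (3 / 2))^-1).
  by apply: (measurableT_comp mble_inv); apply: continuous_mble; exact: powR_continuous.
have ip := intg_vanish mp' hM hS.
suff : intg mu (fun x => psi x / (1 + `|x|) `^ (3 / 2)) by [].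
apply: (@intg_ae _ RM R mu (fun x => psi' x / (1 + `|x|) `^ (3 / 2))).
- exact: measurable_funM.
- exact: measurable_funM.
- by apply: ae_imp e => x ->.
- have := @intg_bddM _ RM R mu 1 (fun x => ((1 + `|x|) `^ (3 / 2))^-1) psi' mw ip.
  rewrite (_ : (fun x => _ * psi' x) = (fun x => psi' x / (1 + `|x|) `^ (3 / 2))); last first.
    by apply/funext => x; rewrite mulrC.
  apply=> x; rewrite ger0_norm ?invr_ge0 ?powR_ge0// invf_le1; last by rewrite powR_gt0// ltr_wpDr.
  apply: (@le_trans _ _ (1 `^ (3 / 2))); first by rewrite powR1.
  apply: ge0_ler_powR; rewrite ?nnegrE ?lerDl ?addr_ge0//.
Qed.

(** Every admissible sequence gives the same limit because convergence in [cvg_H12] is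
    convergence in energy; mollification provides one such sequence, so that the
    limit is the value of the bracket. *)
Lemma bracket_form f f' g psi psi' : mble f -> bfg f' -> is_lap14 f' g ->
  {ae mu, forall x, f' x = f x} -> mble psi -> energy_class psi' ->
  {ae mu, forall x, psi' x = psi x} ->
  H12_pairing (frac_lap (1 / 2) (regular_distr f)) psi = cB * gag f' psi'.
Proof.
move=> mf [mf' [M hM] ff'] eg ef mp ep e; have [mp' [K hK] [S hS] fp'] := ep.
have cp := @cB_gt0 R.
set Sd := frac_lap _ _.
have hSd phi : test_fun phi -> Sd phi = cB * gag f' phi.
  move=> tp; rewrite /Sd /frac_lap /regular_distr.
  have -> : frac_lap_test (1 / 2) phi = Afrac 1 phi.
    apply/funext => x; rewrite (frac_lap_testE _ _ (test_intg tp)).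
    by rewrite (_ : 2 * (1 / 2) = 1)//; field.
  rewrite gag_section//; last exact: test_fingag.
  rewrite -(Lap_form mf' hM tp); have mA := mble_Afrac1 tp.
  apply: Int_ae; [exact: measurable_funM|exact: measurable_funM|].
  by apply: ae_imp ef => x ->.
have diff (psin : nat -> R -> R) : (forall n, test_fun (psin n)) -> forall n,
    [/\ energy_class (psin n \- psi'), mble (psin n \- psi) &
      {ae mu, forall x, (psin n \- psi') x = (psin n \- psi) x}].
  move=> tn n; split.
  - exact: energy_sub (test_energy (tn n)) ep.
  - by apply: measurable_funB => //; exact: test_mble.
  - by apply: ae_imp e => x /= ->.
have norm (psin : nat -> R -> R) n : (forall n, test_fun (psin n)) ->
    \int[mu]_x (lap14 (psin n \- psi) x ^+ 2) =
    cB * \int[mm]_p ((dq (psin n) p - dq psi' p) ^+ 2).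
  move=> tn; have [en mn an] := diff _ tn n; have [m1 _ _ _] := en.
  have [h [eh _]] := energy_lap14 en.
  rewrite -(lap14_ae m1 mn an) (energy_lap14_norm en (lap14_spec eh)).
  by congr (_ * _); congr Rintegral; apply/funext => p; rewrite -dqB.
have lim psin : (forall n, test_fun (psin n)) -> cvg_H12 psin psi ->
    (fun n => Sd (psin n)) @ \oo --> cB * gag f' psi'.
  move=> tn [_ _ c]; rewrite (_ : (fun n => _) = (fun n => cB * gag f' (psin n))); last first.
    by apply/funext => n; exact: hSd.
  apply: cvgMr; apply: sqi_cvg_ip ff' (fun n => test_fingag (tn n)) fp' _.
  have : (fun n => cB^-1 * \int[mu]_x (lap14 (psin n \- psi) x ^+ 2)) @ \oo --> (cB^-1 * 0 : R).
    exact: cvgMr c.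
  rewrite mulr0 (_ : (fun n => _) = (fun n => \int[mm]_p ((dq (psin n) p - dq psi' p) ^+ 2)))//.
  by apply/funext => n; rewrite norm// mulKf// gt_eqF.
pose psin n := convol (moll n) psi'.
have tn n : test_fun (psin n) := conv_test n mp' hK hS.
have cv : cvg_H12 psin psi.
  have [c1 c2] := conv_moll_strong ep; split.
  - move=> n; have [en mn an] := diff _ tn n; have [m1 [K1 hK1] [S1 hS1] _] := en; split.
      by apply/L2_sqi; apply: sqi_ae mn an (vanish_sqi m1 hK1 hS1).
    exact: energy_Hdot12 en an.
  - rewrite (_ : (fun n => _) = (fun n => \int[mu]_x ((psin n x - psi' x) ^+ 2))).
      exact: c1.
    apply/funext => n; have [en mn an] := diff _ tn n; have [m1 _ _ _] := en.
    apply: Int_ae; [exact: measurable_funX|exact: measurable_funX|].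
    by apply: ae_imp an => x /= ->.
  - rewrite (_ : (fun n => _) = (fun n => cB * \int[mm]_p ((dq (psin n) p - dq psi' p) ^+ 2))).
      by rewrite -(mulr0 cB); apply: cvgMr; exact: c2.
    by apply/funext => n; exact: norm.
pose P := [set c : R | forall psin : nat -> R -> R, (forall n, test_fun (psin n)) ->
  cvg_H12 psin psi -> (fun n => Sd (psin n)) @ \oo --> c].
have h : P (xget 0 P) := xgetPex 0 (ex_intro P _ lim).
exact: seq_unique (h psin tn cv) (lim psin tn cv).
Qed.

End Bracket.

(** * Variations of sphere-valued maps *)

Section Sphere.
Context {R : realType}.
Implicit Types (f g h w psi W : R -> R) (b c s t x y M S K C L e r : R).
Notation mu := (@lebesgue_measure R).
Notation RM := (measurableTypeR R).
Notation mm := (@lebesgue_measure R \x @lebesgue_measure R)%E.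
Notation mble f := (measurable_fun (@setT RM) (f : RM -> R)).
Notation mble2 f := (measurable_fun (@setT (RM * RM)) (f : RM * RM -> R)).
Notation D := (Afrac (2^-1 : R)).
Local Opaque Afrac kcst moll.

Lemma cvg_bigsum (I : Type) (s : seq I) (f : I -> nat -> R) (l : I -> R) :
  (forall i, f i @ \oo --> l i) -> (fun n => \sum_(i <- s) f i n) @ \oo --> \sum_(i <- s) l i.
Proof.
move=> h; elim: s => [|i s IH].
  by under eq_fun do rewrite big_nil; rewrite big_nil; exact: cvg_cst.
by under eq_fun do rewrite big_cons; rewrite big_cons; exact: cvgD.
Qed.

Lemma sqi_abs d (T : measurableType d) (k : {measure set T -> \bar R}) (f : T -> R) :
  sqi k f -> sqi k (fun x : T => `|f x|).
Proof.
move=> [mf i]; split; first exact: measurableT_comp.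
by move: i; congr intg; apply/funext => x; rewrite real_normK ?num_real.
Qed.

Lemma gag_cvg w psi : fingag w -> energy_class psi ->
  (fun n => gag w (convol (moll n) psi)) @ \oo --> gag w psi.
Proof.
move=> fw ep; have [mp [M hM] [S hS] fp] := ep; have [_ c2] := conv_moll_strong ep.
apply: (sqi_cvg_ip fw _ fp c2) => n; exact: test_fingag (conv_test n mp hM hS).
Qed.

Section Components.
Context (m : nat) (a : 'I_m -> R -> R).
Context (ba : forall j, bfg (a j)) (ua : forall x, \sum_j a j x ^+ 2 = 1).
Implicit Types (phi : 'I_m -> R -> R).

Let fa j : fingag (a j). Proof. by case: (ba j). Qed.
Let ma j : mble (a j). Proof. by case: (ba j). Qed.

Lemma unit_le1 j x : `|a j x| <= 1.
Proof.
have h : a j x ^+ 2 <= 1.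
  rewrite -(ua x) (bigD1 j)//= lerDl; apply: sumr_ge0 => i _; exact: sqr_ge0.
by rewrite -[leLHS]ger0_norm// -ler_sqr ?nnegrE// expr1n normr_id real_normK ?num_real.
Qed.

(** The orthogonal projection of [phi] on the tangent space of the sphere at [a]. *)
Definition tang phi j x : R := phi j x - \sum_i (a i x * a j x) * phi i x.

(** Half the first variation of the energy at [a] in the direction [phi], up to [cB]. *)
Definition first_var phi : R := \sum_j gag (a j) (tang phi j).

Lemma first_varE phi : (forall j, energy_class (phi j)) ->
  first_var phi = \sum_j (gag (a j) (phi j) -
    \sum_i gag (a j) (fun x => (a i x * a j x) * phi i x)).
Proof.
move=> ep; rewrite /first_var; apply: eq_bigr => j _.
have eij i : energy_class (fun x => (a i x * a j x) * phi i x).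
  by apply: energy_mul => //; exact: bfgM.
have fij i : fingag (fun x => (a i x * a j x) * phi i x) by case: (eij i).
have fp : fingag (phi j) by case: (ep j).
have [f1 <-] := gag_sum (index_enum 'I_m) (fa j) fij.
by rewrite -gagB.
Qed.

Definition critical := forall phi, (forall j, test_fun (phi j)) -> first_var phi = 0.

Definition balanced := forall i j psi, test_fun psi ->
  gag (a j) (fun x => a i x * psi x) = gag (a i) (fun x => a j x * psi x).

Lemma critical_energy : critical ->
  forall phi, (forall j, energy_class (phi j)) -> first_var phi = 0.
Proof.
move=> cr phi ep; pose phin n j := convol (moll n) (phi j).
have tn n j : test_fun (phin n j).
  by have [mp [M hM] [S hS] _] := ep j; exact: conv_test hM hS.
have lim : (fun n => first_var (phin n)) @ \oo --> first_var phi.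
  rewrite first_varE//.
  under eq_fun => n do rewrite (first_varE (fun j => test_energy (tn n j))).
  apply: cvg_bigsum => j; apply: cvgB; first exact: gag_cvg.
  apply: cvg_bigsum => i; apply: gag_conv_cvg => //; exact: bfgM.
apply: (seq_unique lim); rewrite (_ : (fun n => _) = fun=> 0); first exact: cvg_cst.
by apply/funext => n; exact: cr.
Qed.

Lemma balanced_energy : balanced -> forall i j psi, energy_class psi ->
  gag (a j) (fun x => a i x * psi x) = gag (a i) (fun x => a j x * psi x).
Proof.
move=> bl i j psi ep; have [mp [M hM] [S hS] _] := ep.
have l1 := gag_conv_cvg (fa j) (ba i) ep; have l2 := gag_conv_cvg (fa i) (ba j) ep.
apply: (seq_unique l1); rewrite (_ : (fun n => _) =
  (fun n => gag (a i) (fun x => a j x * convol (moll n) psi x)))//.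
by apply/funext => n; apply: bl; exact: conv_test hM hS.
Qed.

(** Tangent fields are generated by the infinitesimal rotations
    [psi (u_i e_j - u_j e_i)]. *)
Lemma critical_balanced : critical <-> balanced.
Proof.
split=> [cr i j psi tp|bl phi tp].
  have ep := test_energy tp; have [->//|ij] := eqVneq i j.
  have eu k : energy_class (fun x => a k x * psi x) by exact: energy_mul.
(* The rotation field in the plane of the [i]-th and [j]-th coordinates. *)
  pose phi k x := (k == j)%:R * (a i x * psi x) - (k == i)%:R * (a j x * psi x).
  have ephi k : energy_class (phi k) by apply: energy_sub; exact: energy_scale.
  have := critical_energy cr ephi; rewrite /first_var.
  have tz k : tang phi k = phi k.
    apply/funext => x; rewrite /tang (_ : \sum_i0 _ = 0) ?subr0//.
    transitivity (a k x * \sum_l a l x * phi l x).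
      by rewrite mulr_sumr; apply: eq_bigr => l _; ring.
    rewrite (bigD1 i)//= (bigD1 j) 1?eq_sym//= big1 => [|l /andP[li lj]].
      by rewrite /phi !eqxx (negbTE ij) eq_sym (negbTE ij) /=; ring.
    by rewrite /phi (negbTE li) (negbTE lj) !mul0r subrr mulr0.
  under eq_bigr do rewrite tz.
  have fu k : fingag (fun x => a k x * psi x) by case: (eu k).
  have gk k : gag (a k) (phi k) = (k == j)%:R * gag (a k) (fun x => a i x * psi x) -
      (k == i)%:R * gag (a k) (fun x => a j x * psi x).
    by rewrite /phi gagB ?gagZ//; exact: fingagZ.
  under eq_bigr do rewrite gk.
  rewrite (bigD1 i)//= (bigD1 j) 1?eq_sym//= big1 => [|l /andP[li lj]]; last first.
    by rewrite (negbTE li) (negbTE lj) !mul0r subrr.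
  have ji : (j == i) = false by rewrite eq_sym (negbTE ij).
  rewrite !eqxx ji !mul0r !mul1r sub0r subr0 addr0.
  by rewrite addrC => /eqP; rewrite subr_eq0 => /eqP.
have ep j := test_energy (tp j).
have e2 i j : energy_class (fun x => a i x * phi j x) by exact: energy_mul.
have e3 i j k : energy_class (fun x => a k x * (a i x * phi j x)) by exact: energy_mul.
have f3 i j k : fingag (fun x => a k x * (a i x * phi j x)) by case: (e3 i j k).
rewrite /first_var.
have E j : gag (a j) (tang phi j) = \sum_i (gag (a j) (fun x => a i x * (a i x * phi j x)) -
    gag (a i) (fun x => a j x * (a j x * phi i x))).
  transitivity (gag (a j) (fun x => \sum_i (a i x * (a i x * phi j x) - a i x * (a j x * phi i x)))).
    congr gag; apply/funext => x; rewrite /tang sumrB; congr (_ - _).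
      by under eq_bigr do rewrite mulrA -expr2; rewrite -mulr_suml ua mul1r.
    by apply: eq_bigr => i _; rewrite mulrA.
  have fij i : fingag (fun x => a i x * (a i x * phi j x) - a i x * (a j x * phi i x)).
    exact: fingagB.
  rewrite (gag_sum _ (fa j) fij).2; apply: eq_bigr => i _.
  by rewrite gagB// (balanced_energy bl i j (e2 j i)).
under eq_bigr do rewrite E.
under eq_bigr do rewrite sumrB; rewrite sumrB [X in _ - X]exchange_big /= subrr//.
Qed.

End Components.

(** ** Uniformly Lipschitz families *)

Section Families.
Context (m : nat) (a phi : 'I_m -> R -> R) (t0 : R).
Implicit Types (F G : R -> R -> R).

Definition jump x y : R := \sum_j (`|a j x - a j y| + `|phi j x - phi j y|).

(** A class that is closed under the operations that build the Taylor remainder of the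
    projection onto the sphere, and whose members have uniformly bounded energy. *)
Definition ulip F := [/\ forall t, `|t| <= t0 -> mble (F t),
  exists C, forall t x, `|t| <= t0 -> `|F t x| <= C &
  exists C, forall t x y, `|t| <= t0 -> `|F t x - F t y| <= C * jump x y].

Lemma ulipD F G : ulip F -> ulip G -> ulip (fun t x => F t x + G t x).
Proof.
move=> [mF [C hC] [L hL]] [mG [C' hC'] [L' hL']]; split.
- by move=> t ht; apply: measurable_funD; [exact: mF|exact: mG].
- by exists (C + C') => t x ht; rewrite (le_trans (ler_normD _ _))// lerD ?hC ?hC'.
- exists (L + L') => t x y ht; rewrite opprD addrACA mulrDl (le_trans (ler_normD _ _))//.
  by rewrite lerD ?hL ?hL'.
Qed.

Lemma ulipM F G : ulip F -> ulip G -> ulip (fun t x => F t x * G t x).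
Proof.
move=> [mF [C hC] [L hL]] [mG [C' hC'] [L' hL']]; split.
- by move=> t ht; apply: measurable_funM; [exact: mF|exact: mG].
- by exists (C * C') => t x ht; rewrite normrM ler_pM ?hC ?hC'.
- exists (C * L' + C' * L) => t x y ht.
  rewrite (_ : _ - _ = F t x * (G t x - G t y) + G t y * (F t x - F t y)); last by ring.
  rewrite (le_trans (ler_normD _ _))// !normrM mulrDl -!mulrA.
  by apply: lerD; apply: ler_pM => //; rewrite ?hC ?hC' ?hL ?hL'.
Qed.

Lemma ulip_cst c : ulip (fun _ _ => c).
Proof.
split; [by move=> t _|by exists `|c| |exists 0 => t x y _].
by rewrite subrr normr0 mul0r.
Qed.

Lemma ulip_t : ulip (fun t _ => t).
Proof.
split; [by move=> t _|by exists t0|exists 0 => t x y _].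
by rewrite subrr normr0 mul0r.
Qed.

Lemma ulip_a j : mble (a j) -> (exists M, forall x, `|a j x| <= M) -> ulip (fun _ => a j).
Proof.
move=> mj [M hM]; split; [by move=> t _|by exists M|exists 1 => t x y _].
rewrite mul1r /jump (bigD1 j)//= -addrA lerDl addr_ge0//.
by apply: sumr_ge0 => i _; rewrite addr_ge0.
Qed.

Lemma ulip_phi j : mble (phi j) -> (exists M, forall x, `|phi j x| <= M) ->
  ulip (fun _ => phi j).
Proof.
move=> mj [M hM]; split; [by move=> t _|by exists M|exists 1 => t x y _].
rewrite mul1r /jump (bigD1 j)//= -addrA addrCA lerDl addr_ge0//.
by apply: sumr_ge0 => i _; rewrite addr_ge0.
Qed.

Lemma ulip_sum (I : Type) (s : seq I) (F : I -> R -> R -> R) : (forall i, ulip (F i)) ->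
  ulip (fun t x => \sum_(i <- s) F i t x).
Proof.
move=> h; elim: s => [|i s IH].
  rewrite (_ : (fun t x => _) = fun _ _ => 0); first exact: ulip_cst.
  by apply/funext => t; apply/funext => x; rewrite big_nil.
rewrite (_ : (fun t x => _) = fun t x => F i t x + \sum_(i <- s) F i t x).
  exact: ulipD.
by apply/funext => t; apply/funext => x; rewrite big_cons.
Qed.

Lemma ulip_inv F c : 0 < c -> (forall t x, `|t| <= t0 -> c <= F t x) -> ulip F ->
  ulip (fun t x => (F t x)^-1).
Proof.
move=> c0 hc [mF [C hC] [L hL]].
have F0 t x : `|t| <= t0 -> 0 < F t x by move=> ht; apply: lt_le_trans (hc t x ht).
have Fi t x : `|t| <= t0 -> `|(F t x)^-1| <= c^-1.
  move=> ht; rewrite normfV ger0_norm ?(ltW (F0 t x ht))//.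
  by rewrite lef_pV2 ?posrE ?F0// hc.
split.
- by move=> t ht; apply: (measurableT_comp mble_inv); exact: mF.
- by exists c^-1.
- exists (c^-1 * c^-1 * L) => t x y ht.
  have nx := lt0r_neq0 (F0 t x ht); have ny := lt0r_neq0 (F0 t y ht).
  rewrite (_ : _ - _ = (F t x)^-1 * (F t y)^-1 * - (F t x - F t y)).
    rewrite [leRHS](_ : _ = c^-1 * c^-1 * (L * jump x y)); last by ring.
    rewrite normrM normrN; apply: ler_pM => //; last exact: hL.
    by rewrite normrM; apply: ler_pM => //; exact: Fi.
  by field; rewrite nx ny.
Qed.

Lemma mble_sqrt f : mble f -> mble (fun x => Num.sqrt (f x)).
Proof. by move=> mf; apply: (measurableT_comp _ mf); apply: continuous_mble; exact: sqrt_continuous. Qed.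

Lemma ulip_sqrt F c : 0 < c -> (forall t x, `|t| <= t0 -> c ^+ 2 <= F t x) -> ulip F ->
  ulip (fun t x => Num.sqrt (F t x)).
Proof.
move=> c0 hc [mF [C hC] [L hL]].
have s0 t x : `|t| <= t0 -> c <= Num.sqrt (F t x).
  move=> ht; rewrite -(ger0_norm (ltW c0)) -sqrtr_sqr ler_wsqrtr//; exact: hc.
have F0 t x : `|t| <= t0 -> 0 <= F t x by move=> ht; apply: le_trans (hc t x ht); exact: sqr_ge0.
split.
- by move=> t ht; apply: mble_sqrt; exact: mF.
- exists (1 + C) => t x ht; rewrite ger0_norm ?sqrtr_ge0//.
  have := sqr_ge0 (Num.sqrt (F t x) - 1); have := sqr_sqrtr (F0 t x ht) => e.
  have := hC t x ht; rewrite ger0_norm ?F0// => h1 h2.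
  have := F0 t x ht; have := sqrtr_ge0 (F t x); nra.
- exists (c^-1 * L) => t x y ht; rewrite -mulrA ler_pdivlMl//.
  apply: le_trans (hL t x y ht).
  rewrite -{2}(sqr_sqrtr (F0 t x ht)) -{2}(sqr_sqrtr (F0 t y ht)) subr_sqr normrM mulrC.
  rewrite ler_wpM2l// ger0_norm ?addr_ge0 ?sqrtr_ge0//.
  by have := s0 t x ht; have := s0 t y ht; lra.
Qed.

Definition jumpq p : R := \sum_j (`|dq (a j) p| + `|dq (phi j) p|).

Lemma sqi_jumpq : (forall j, fingag (a j)) -> (forall j, fingag (phi j)) -> sqi mm jumpq.
Proof.
by move=> fa fp; apply: sqi_sum => j; apply: sqiD; apply: sqi_abs; [exact: fa|exact: fp].
Qed.

(** A Lipschitz function of finite-energy functions has finite energy, with a bound that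
    depends only on the Lipschitz constant. *)
Lemma ulip_fingag F : (forall j, fingag (a j)) -> (forall j, fingag (phi j)) -> ulip F ->
  exists K, forall t, `|t| <= t0 -> fingag (F t) /\ \int[mm]_p (dq (F t) p ^+ 2) <= K.
Proof.
move=> fa fp [mF _ [L hL]]; have [mj ij] := sqi_jumpq fa fp.
exists (\int[mm]_p (L ^+ 2 * jumpq p ^+ 2)) => t ht.
have le p : dq (F t) p ^+ 2 <= L ^+ 2 * jumpq p ^+ 2.
  rewrite -exprMn -(real_normK (num_real (dq (F t) p))) -(real_normK (num_real (L * _))).
  rewrite ler_sqr ?nnegrE//; apply: le_trans (ler_norm _).
  rewrite /dq normrM; apply: (@le_trans _ _ (L * jump (p.1 + p.2) p.1 * `|p.2^-1|)).
    by rewrite ler_wpM2r// hL.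
  rewrite -mulrA /jump mulr_suml le_eqVlt; apply/orP; left; apply/eqP; congr (_ * _); apply: eq_bigr => j _.
  by rewrite mulrDl /dq !normrM.
have i : intg mm (fun p => dq (F t) p ^+ 2).
  apply: (@intg_le _ (RM * RM)%type R mm _ _ _ (intgZ (L ^+ 2) ij)).
    by apply: measurable_funX; apply: mble_dq; exact: mF.
  by move=> p; rewrite ger0_norm ?sqr_ge0.
split; first by split=> //; apply: mble_dq; exact: mF.
by apply: Int_le => //; exact: intgZ.
Qed.

End Families.

End Sphere.

(** * The first variation of the energy *)

Section FirstVariation.
Context {R : realType}.
Implicit Types (f g h w psi W : R -> R) (b c s t x y M S K C L e r : R).
Notation mu := (@lebesgue_measure R).
Notation RM := (measurableTypeR R).
Notation mm := (@lebesgue_measure R \x @lebesgue_measure R)%E.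
Notation mble f := (measurable_fun (@setT RM) (f : RM -> R)).
Local Opaque Afrac kcst moll.

Lemma is_derive_quadratic (E : R -> R) l K t0 : 0 < t0 ->
  (forall t, `|t| <= t0 -> `|E t - E 0 - t * l| <= K * t ^+ 2) ->
  is_derive (0 : R) (1 : R) E l.
Proof.
move=> t00 h.
have K0 : 0 <= K.
  have ht : `|t0| <= t0 by rewrite ger0_norm// ltW.
  have := le_trans (normr_ge0 _) (h t0 ht).
  by rewrite pmulr_lge0// exprn_gt0.
have c : (fun t : R => t^-1 *: (E (t *: 1 + 0) - E 0)) @ 0^' --> (l : R).
  apply/cvgrPdist_le => e e0.
  have e1 : 0 < e / (K + 1) by rewrite divr_gt0// ltr_wpDl.
  have n1 : \forall t \near (0 : R)^', `|t| <= Num.min t0 (e / (K + 1)).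
    by apply: dnbhs0_le; rewrite lt_min t00.
  near=> t.
  have tn : t != 0 by near: t; exact: nbhs_dnbhs_neq.
  have : `|t| <= Num.min t0 (e / (K + 1)) by near: t.
  rewrite le_min => /andP[h1 h2].
  rewrite addr0 /GRing.scale/= mulr1 distrC.
  rewrite (_ : t^-1 * (E t - E 0) - l = t^-1 * (E t - E 0 - t * l)); last first.
    by rewrite [RHS]mulrBr mulKf.
  rewrite normrM normfV ler_pdivrMl ?normr_gt0//; apply: le_trans (h t h1) _.
  rewrite -(real_normK (num_real t)) expr2 mulrCA ler_wpM2l//.
  rewrite ler_pdivlMr in h2; last by rewrite ltr_wpDl.
  have := normr_ge0 t; lra.
apply: DeriveDef; first by apply/cvg_ex; exists l; exact: c.
exact: cvg_lim c.
Unshelve. all: end_near. Qed.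

(** Second-order expansion of [(A + T B) / s] with [s = |A + T B|], in a form whose
    remainder is visibly smooth. *)
Lemma unit_taylor (A B T p be s : R) : 0 < s -> s ^+ 2 = 1 + 2 * T * p + T ^+ 2 * be ->
  let h := (s * (1 + s))^-1 in let k := (s + 2) * (h * (1 + s)^-1) in
  s^-1 * (A + T * B) = A + (T * (B - p * A) +
    T ^+ 2 * (A * (- be * h + p * (2 * p + T * be) * k) - B * (2 * p + T * be) * h)).
Proof.
move=> s0 es h k; have sn : s != 0 by rewrite gt_eqF.
have s1 : 1 + s != 0 by rewrite gt_eqF// addr_gt0.
have ed : T * (2 * p + T * be) = s ^+ 2 - 1 by rewrite es; ring.
have E1 : s^-1 = 1 - T * (2 * p + T * be) * h.
  by rewrite ed /h; field; rewrite sn s1.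
have E2 : T * (2 * p + T * be) * k = 1 - 2 * h.
  by rewrite ed /k /h; field; rewrite sn s1.
move: E2; rewrite E1; move: h k {E1} => h k E2.
rewrite [RHS](_ : _ = A + T * (B - p * A) + T ^+ 2 * (A * (- be * h) - B * (2 * p + T * be) * h)
  + T * p * A * (T * (2 * p + T * be) * k)); last by ring.
by rewrite E2; ring.
Qed.

(** The quarter Laplacian is linear up to null sets; the cross term is a Gagliardo form by
    [form_pairing], since [z] has compact support. *)
Lemma energy_expand f g z M : mble f -> (forall x, `|f x| <= M) -> fingag f -> is_lap14 f g ->
  energy_class z ->
  intg mu (fun x => lap14 (fun x => f x + z x) x ^+ 2) /\
  \int[mu]_x (lap14 (fun x => f x + z x) x ^+ 2) =
    \int[mu]_x (g x ^+ 2) + cB * (2 * gag f z + \int[mm]_p (dq z p ^+ 2)).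
Proof.
move=> mf hM ff fg ez; have [mz [M' hM'] _ fz] := ez.
have [h [hz _]] := energy_lap14 ez.
have l := is_lap14D mf hM mz hM' fg hz; have l' := lap14_spec l.
have [mg ig] := (L2_sqi _).1 fg.1; have sg := (L2_sqi _).1 fg.1; have sh := (L2_sqi _).1 hz.1.
have [ml il] := (L2_sqi _).1 l'.1; have [ms _] := sqiD sg sh.
split=> //.
rewrite (_ : \int[mu]_x _ = \int[mu]_x ((g x + h x) ^+ 2)); last first.
  apply: Int_ae; [exact: measurable_funX|exact: measurable_funX|].
  by apply: ae_imp (lap14_unique l' l) => x ->.
rewrite (sqr_normD sg sh) (energy_lap14_norm ez hz) (form_pairing mf hM ff fg ez hz).
set a := \int[mu]_x _; set b := gag _ _; set c := \int[mm]_p _.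
by move: a b c (cB : R) => a b c d; ring.
Qed.

Section Components.
Context (m : nat) (a : 'I_m -> R -> R) (phi : 'I_m -> R -> R).

Definition dotp x := \sum_j a j x * phi j x.
Definition sqnp x := \sum_j phi j x ^+ 2.
Definition len t x := Num.sqrt (\sum_j (a j x + t * phi j x) ^+ 2).
Definition hcoef t x := (len t x * (1 + len t x))^-1.
Definition kcoef t x := (len t x + 2) * (hcoef t x * (1 + len t x)^-1).
Definition sproj j t x := (len t x)^-1 * (a j x + t * phi j x).

(** The second-order remainder of [unit_taylor], componentwise. *)
Definition remd j t x := a j x * (- sqnp x * hcoef t x +
    dotp x * (2 * dotp x + t * sqnp x) * kcoef t x) -
  phi j x * (2 * dotp x + t * sqnp x) * hcoef t x.

Context (ba : forall j, bfg (a j)) (ua : forall x, \sum_j a j x ^+ 2 = 1).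
Context (tp : forall j, test_fun (phi j)).

Let fa j : fingag (a j). Proof. by case: (ba j). Qed.
Let ma j : mble (a j). Proof. by case: (ba j). Qed.

Lemma sqlenE t x : \sum_j (a j x + t * phi j x) ^+ 2 = 1 + 2 * t * dotp x + t ^+ 2 * sqnp x.
Proof.
rewrite -[X in X + _ + _](ua x) /dotp /sqnp !mulr_sumr -!big_split /=; apply: eq_bigr => j _; ring.
Qed.

Lemma tangE j x : tang a phi j x = phi j x - dotp x * a j x.
Proof.
rewrite /tang /dotp mulr_suml; congr (_ - _); apply: eq_bigr => i _; ring.
Qed.

Section Small.
Context (P t0 : R) (P0 : 0 <= P) (hP : forall x, `|dotp x| <= P) (et0 : t0 = (4 * P + 4)^-1).

Let t00 : 0 < t0. Proof. by rewrite et0 invr_gt0 ltr_wpDl// mulr_ge0. Qed.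

Lemma small_len t x : `|t| <= t0 -> 2^-1 <= \sum_j (a j x + t * phi j x) ^+ 2.
Proof.
move=> ht; rewrite sqlenE.
have b0 : 0 <= t ^+ 2 * sqnp x.
  by rewrite mulr_ge0 ?sqr_ge0// sumr_ge0// => j _; exact: sqr_ge0.
have h1 : `|t * dotp x| <= t0 * P by rewrite normrM ler_pM.
have h2 : t0 * P <= 4^-1.
  rewrite et0 ler_pdivrMl; first by lra.
  by rewrite ltr_wpDl// mulr_ge0.
have := ler_norm (- (t * dotp x)); rewrite normrN; lra.
Qed.

Lemma len_ge t x : `|t| <= t0 -> 2^-1 <= len t x.
Proof.
move=> ht; have h := small_len x ht.
have e : 0 <= 2^-1 :> R by [].
rewrite -(ger0_norm e) -sqrtr_sqr ler_wsqrtr//; lra.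
Qed.

Lemma sproj_taylor j t x : `|t| <= t0 ->
  sproj j t x = a j x + (t * tang a phi j x + t ^+ 2 * remd j t x).
Proof.
move=> ht; have l := len_ge x ht; have l0 : 0 < len t x by lra.
rewrite tangE; apply: unit_taylor => //; rewrite sqr_sqrtr; first exact: sqlenE.
by apply: sumr_ge0 => i _; exact: sqr_ge0.
Qed.

Let U := ulip a phi t0.

Let Ua j : U (fun _ => a j). Proof. by have [m1 b1 _] := ba j; exact: ulip_a. Qed.

Let Up j : U (fun _ => phi j).
Proof.
have [M [_ hM]] := test_bounded (tp j); apply: ulip_phi; [exact: test_mble|by exists M].
Qed.

(** [remd] is obtained from [a], [phi] and [t] by sums, products, square roots and inverses
    of functions that stay away from zero. *)
Lemma ulip_remd j : U (remd j).
Proof.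
have M F G : U F -> U G -> U (fun t x => F t x * G t x) by exact: ulipM.
have A F G : U F -> U G -> U (fun t x => F t x + G t x) by exact: ulipD.
have SU (F : 'I_m -> R -> R -> R) : (forall i, U (F i)) -> U (fun t x => \sum_i F i t x).
  by move=> h; exact: ulip_sum.
have Ut : U (fun t _ => t) by exact: ulip_t.
have Uc c : U (fun _ _ => c) by exact: ulip_cst.
have UN F : U F -> U (fun t x => - F t x).
  move=> UF; rewrite (_ : (fun t x => - F t x) = fun t x => -1 * F t x).
    exact: (M _ _ (Uc _) UF).
  by apply/funext => t; apply/funext => x; rewrite mulN1r.
have Ud : U (fun _ => dotp).
  by apply: (SU (fun i _ x => a i x * phi i x)) => i; exact: (M _ _ (Ua i) (Up i)).
have Us : U (fun _ => sqnp).
  by apply: (SU (fun i _ x => phi i x ^+ 2)) => i; exact: (M _ _ (Up i) (Up i)).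
have Ul : U len.
  apply: (@ulip_sqrt _ _ _ _ _ _ 2^-1) => //.
    by move=> t x ht; apply: le_trans (small_len x ht); lra.
  apply: (SU (fun i t x => (a i x + t * phi i x) ^+ 2)) => i.
  have h : U (fun t x => a i x + t * phi i x) := A _ _ (Ua i) (M _ _ Ut (Up i)).
  exact: (M _ _ h h).
have U1l : U (fun t x => 1 + len t x) := A _ _ (Uc 1) Ul.
have Uh : U hcoef.
  apply: (@ulip_inv _ _ _ _ _ _ 2^-1) => //; last exact: (M _ _ Ul U1l).
  by move=> t x ht; have := len_ge x ht; nra.
have Ui : U (fun t x => (1 + len t x)^-1).
  by apply: (@ulip_inv _ _ _ _ _ _ 1) => // t x ht; have := len_ge x ht; lra.
have Uk : U kcoef := M _ _ (A _ _ Ul (Uc 2)) (M _ _ Uh Ui).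
have Uq : U (fun t x => 2 * dotp x + t * sqnp x) := A _ _ (M _ _ (Uc 2) Ud) (M _ _ Ut Us).
have U1 := M _ _ (Ua j) (A _ _ (M _ _ (UN _ Us) Uh) (M _ _ (M _ _ Ud Uq) Uk)).
exact: (A _ _ U1 (UN _ (M _ _ (M _ _ (Up j) Uq) Uh))).
Qed.

End Small.

Lemma common_support : exists S, forall x, S < `|x| -> forall j, phi j x = 0.
Proof.
have [Sf hS] := choice (fun j => ((test_funP (phi j)).1 (tp j)).2).
exists (\sum_j `|Sf j|) => x hx j; apply: hS; apply: le_lt_trans hx.
rewrite (bigD1 j)//=; apply: le_trans (ler_norm _) _; rewrite lerDl.
by apply: sumr_ge0.
Qed.

Lemma dotp_bounded : exists P, 0 <= P /\ forall x, `|dotp x| <= P.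
Proof.
have [Mf hM] := choice (fun j => test_bounded (tp j)).
exists (\sum_j Mf j); split; first by apply: sumr_ge0 => j _; exact: ltW (hM j).1.
move=> x; apply: le_trans (ler_norm_sum _ _ _) _; apply: ler_sum => j _.
rewrite normrM -[leRHS]mul1r ler_pM//; [exact: unit_le1|exact: (hM j).2].
Qed.

Lemma tang_energy j : energy_class (tang a phi j).
Proof.
have h : energy_class (fun x => dotp x * a j x).
  rewrite (_ : (fun x => _) = fun x => \sum_i (a i x * a j x) * phi i x); last first.
    by apply/funext => x; rewrite /dotp mulr_suml; apply: eq_bigr => i _; ring.
  elim: (index_enum _) => [|i s IH].
    rewrite (_ : (fun x => _) = fun x => 0 * phi j x).
      by apply: energy_scale; exact: test_energy.
    by apply/funext => x; rewrite big_nil mul0r.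
  rewrite (_ : (fun x => _) = fun x => (a i x * a j x) * phi i x + \sum_(i <- s) (a i x * a j x) * phi i x).
    by apply: energy_add => //; apply: energy_mul; [exact: bfgM|exact: test_energy].
  by apply/funext => x; rewrite big_cons.
rewrite (_ : tang a phi j = fun x => phi j x - dotp x * a j x).
  by apply: energy_sub => //; exact: test_energy.
by apply/funext => x; exact: tangE.
Qed.

(** The terms linear in [t] come from the tangential part; all others carry a factor [t^2]. *)
Lemma energy_variation (g : 'I_m -> R -> R) : (forall j, is_lap14 (a j) (g j)) ->
  exists t0 K, 0 < t0 /\ forall t, `|t| <= t0 ->
    [/\ forall j, mble (sproj j t), forall j, intg mu (fun x => lap14 (sproj j t) x ^+ 2) &
     `|\sum_j \int[mu]_x (lap14 (sproj j t) x ^+ 2) - \sum_j \int[mu]_x (g j x ^+ 2)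
       - t * (2 * cB * first_var a phi)| <= K * t ^+ 2].
Proof.
move=> lg; have [P [P0 hP]] := dotp_bounded; pose t0 := (4 * P + 4)^-1 : R.
have cp := @cB_gt0 R.
have P4 : 0 < 4 * P + 4 by rewrite ltr_wpDl// mulr_ge0.
have t00 : 0 < t0 by rewrite invr_gt0.
have fphi j : fingag (phi j) := test_fingag (tp j).
have [Kf hK] := choice (fun j => ulip_fingag fa fphi (ulip_remd P0 hP (erefl t0) j)).
pose Na j := \int[mm]_p (dq (a j) p ^+ 2); pose Nt j := \int[mm]_p (dq (tang a phi j) p ^+ 2).
(* Cauchy-Schwarz for the cross term with [remd], and [(A + t B)^2 <= 2 A^2 + 2 B^2]. *)
exists t0, (\sum_j cB * (Na j + Kf j + (2 * Nt j + 2 * Kf j))); split=> // t ht.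
have t1 : t ^+ 2 <= 1.
  rewrite -(real_normK (num_real t)) exprn_ile1//; apply: le_trans ht _.
  by rewrite /t0 invf_le1//; lra.
have [S hS] := common_support.
have er j : energy_class (remd j t).
  have [mr [C hC] _] := ulip_remd P0 hP (erefl t0) j; have [fr _] := hK j t ht; split=> //.
  - exact: mr.
  - by exists C => x; exact: hC.
  - exists S => x hx; rewrite /remd (hS x hx j).
    rewrite (_ : dotp x = 0); last by apply: big1 => i _; rewrite (hS x hx) mulr0.
    rewrite (_ : sqnp x = 0); last by apply: big1 => i _; rewrite (hS x hx) expr0n.
    by rewrite !(mul0r, mulr0, oppr0, addr0).
have et j := tang_energy j.
pose z j x := t * tang a phi j x + t ^+ 2 * remd j t x.
have ez j : energy_class (z j) by apply: energy_add; exact: energy_scale.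
have ep j : sproj j t = fun x => a j x + z j x.
  by apply/funext => x; exact: (sproj_taylor P0 hP (erefl t0)).
have fr j : fingag (remd j t) by case: (er j).
have ft j : fingag (tang a phi j) by case: (et j).
have X j : intg mu (fun x => lap14 (sproj j t) x ^+ 2) /\
    \int[mu]_x (lap14 (sproj j t) x ^+ 2) =
    \int[mu]_x (g j x ^+ 2) + cB * (2 * gag (a j) (z j) + \int[mm]_p (dq (z j) p ^+ 2)).
  by rewrite ep; have [mj [M hM] fj] := ba j; exact: energy_expand hM fj (lg j) (ez j).
split; [|by move=> j; exact: (X j).1|].
  move=> j; rewrite ep; apply: measurable_funD; first exact: ma.
  by case: (ez j).
have B1 j : `|gag (a j) (remd j t)| <= 2^-1 * (Na j + Kf j).
  apply: (@le_trans _ _ (\int[mm]_p (2^-1 * (dq (a j) p ^+ 2 + dq (remd j t) p ^+ 2)))).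
    apply: Int_abs; first exact: (sqi_mul (fa j) (fr j)).
      by apply: intgZ; apply: intgD; [exact: (fa j).2|exact: (fr j).2].
    move=> p; rewrite ler_norml; have := sqr_ge0 (dq (a j) p - dq (remd j t) p).
    by have := sqr_ge0 (dq (a j) p + dq (remd j t) p); rewrite !expr2; lra.
  rewrite IntZ; last by apply: intgD; [exact: (fa j).2|exact: (fr j).2].
  rewrite IntD; [|exact: (fa j).2|exact: (fr j).2].
  by rewrite ler_wpM2l// lerD2l; have [_] := hK j t ht.
have B2 j : \int[mm]_p (dq (z j) p ^+ 2) <= t ^+ 2 * (2 * Nt j + 2 * Kf j).
  apply: (@le_trans _ _ (\int[mm]_p (t ^+ 2 * (2 * dq (tang a phi j) p ^+ 2 + 2 * dq (remd j t) p ^+ 2)))).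
    apply: Int_le; first by case: (ez j) => _ _ _ [].
      by apply: intgZ; apply: intgD; apply: intgZ; [exact: (ft j).2|exact: (fr j).2].
    move=> p; rewrite /z dqD !dqZ.
    set A := dq (tang a phi j) p; set B := dq (remd j t) p.
    rewrite (_ : (t * A + t ^+ 2 * B) ^+ 2 = t ^+ 2 * (A + t * B) ^+ 2); last by ring.
    rewrite ler_wpM2l ?sqr_ge0//; have h1 := sqr_ge0 (A - t * B).
    have h2 : t ^+ 2 * B ^+ 2 <= B ^+ 2 by rewrite ler_piMl ?sqr_ge0.
    by move: h1 h2; rewrite !expr2; lra.
  rewrite IntZ; last by apply: intgD; apply: intgZ; [exact: (ft j).2|exact: (fr j).2].
  rewrite IntD; [|by apply: intgZ; exact: (ft j).2|by apply: intgZ; exact: (fr j).2].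
  rewrite IntZ; last exact: (ft j).2.
  rewrite IntZ; last exact: (fr j).2.
  rewrite ler_wpM2l ?sqr_ge0// lerD2l ler_wpM2l//.
  by have [_] := hK j t ht.
have G j : gag (a j) (z j) = t * gag (a j) (tang a phi j) + t ^+ 2 * gag (a j) (remd j t).
  by rewrite /z gagD ?gagZ//; exact: fingagZ.
rewrite /first_var !mulr_sumr -!sumrB mulr_suml; apply: le_trans (ler_norm_sum _ _ _) _.
apply: ler_sum => j _; rewrite (X j).2 G.
have := B1 j; have := B2 j.
have z0 : 0 <= \int[mm]_p (dq (z j) p ^+ 2) by apply: Int_ge0 => p; exact: sqr_ge0.
move: z0; set I := \int[mm]_p _; set a1 := gag _ (tang _ _ _); set a2 := gag _ _.
set g2 := \int[mu]_x _ => z0 b2 b1.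
rewrite (_ : _ - _ - _ = cB * (2 * (t ^+ 2 * a2) + I)); last first.
  by move: (cB : R) g2 a1 a2 I {z0 b2 b1} => c g2 a1 a2 I; ring.
have h3 : `|2 * (t ^+ 2 * a2)| <= t ^+ 2 * (Na j + Kf j).
  rewrite mulrCA normrM (ger0_norm (sqr_ge0 t)) ler_wpM2l ?sqr_ge0//.
  by rewrite normrM ger0_norm//; lra.
rewrite normrM (ger0_norm (ltW cp)) [leRHS](_ : _ = cB *
  (t ^+ 2 * (Na j + Kf j) + t ^+ 2 * (2 * Nt j + 2 * Kf j))); last by ring.
apply: ler_wpM2l; first exact: ltW.
by apply: le_trans (ler_normD _ _) _; rewrite (ger0_norm z0); exact: lerD.
Qed.

End Components.

End FirstVariation.

(** * Harmonicity, criticality and the wedge equation *)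

Section Harmonic.
Context {R : realType} (m : nat).
Implicit Types (f psi : R -> R) (s t x y M S K C : R) (v w : 'rV[R]_m) (u : R -> 'rV[R]_m).
Notation mu := (@lebesgue_measure R).
Notation RM := (measurableTypeR R).
Notation mm := (@lebesgue_measure R \x @lebesgue_measure R)%E.
Notation mble f := (measurable_fun (@setT RM) (f : RM -> R)).
Local Opaque Afrac kcst moll.

(** A map into the sphere almost everywhere is changed on a null set into one that
    takes all its values in the sphere. *)
Definition sphere_version u (a : 'I_m -> R -> R) := [/\ forall j, bfg (a j),
  forall x, \sum_j a j x ^+ 2 = 1,
  forall j, is_lap14 (a j) (lap14 (fun x => u x 0 j)),
  forall j, mble (fun x => u x 0 j) &
  {ae mu, forall x, forall j, a j x = u x 0 j}].

Lemma sqr_enorm v : enorm v ^+ 2 = \sum_j v 0 j ^+ 2.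
Proof. by rewrite sqr_sqrtr// sumr_ge0// => j _; exact: sqr_ge0. Qed.

Lemma sphere_versionP u : (1 <= m)%N -> Hdot12_sphere u -> exists a, sphere_version u a.
Proof.
move=> hm [hu ae]; pose N x := \sum_j u x 0 j ^+ 2; pose j0 := Ordinal hm.
have mu_ j : mble (fun x => u x 0 j) by case: (hu j).
have mN : mble N.
  by apply: measurable_sum => j; exact: measurable_funX.
pose A : set RM := [set x | N x = 1].
have mA : measurable A.
  have := mN measurableT [set 1] (measurable_set1 _); rewrite setTI; apply.
pose d j : R := (j == j0)%:R.
(* Outside [A] the value is the first basis vector. *)
pose a j x := \1_A x * (u x 0 j - d j) + d j.
have a1 j x : N x = 1 -> a j x = u x 0 j.
  by move=> h; rewrite /a indicE mem_set// mul1r subrK.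
have a0 j x : N x <> 1 -> a j x = d j.
  by move=> h; rewrite /a indicE memNset// mul0r add0r.
have ua x : \sum_j a j x ^+ 2 = 1.
  have [h|h] := pselect (N x = 1).
    by rewrite -[RHS]h; apply: eq_bigr => j _; rewrite a1.
  rewrite (bigD1 j0)//= big1 => [|j hj]; rewrite a0// /d ?eqxx ?expr1n ?addr0//.
  by rewrite (negbTE hj) expr0n.
have aea : {ae mu, forall x, forall j, a j x = u x 0 j}.
  apply: ae_imp ae => x h j; apply: a1; rewrite /N -sqr_enorm h expr1n //.
have ma j : mble (a j).
  apply: measurable_funD => //; apply: measurable_funM; first exact: measurable_indic.
  exact: measurable_funB.
have la j : is_lap14 (a j) (lap14 (fun x => u x 0 j)).
  have [_ _ [g hg]] := hu j; apply: is_lap14_ae (lap14_spec hg) => //.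
  by apply: ae_imp aea => x ->.
exists a; split=> // j; split=> //; first by exists 1 => x; exact: unit_le1.
exact: lap14_fingag (unit_le1 ua j) (la j).
Qed.

(** The components of [u] and [a] agree almost everywhere, hence so do those of the
    projections, and [lap14_ae] applies. *)
Lemma energy_proj u a (phi : R -> 'rV[R]_m) t : sphere_version u a ->
  (forall j, test_fun (fun x => phi x 0 j)) ->
  (forall j, mble (sproj a (fun j x => phi x 0 j) j t)) ->
  (forall j, intg mu (fun x => lap14 (sproj a (fun j x => phi x 0 j) j t) x ^+ 2)) ->
  energy (fun x => sphere_proj (u x + t *: phi x)) =
  \sum_j \int[mu]_x (lap14 (sproj a (fun j x => phi x 0 j) j t) x ^+ 2).
Proof.
move=> [_ _ _ mu_ ae] tp mp ip.
have mphi j : mble (fun x => phi x 0 j) by exact: test_mble.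
have mv j : mble (fun x => u x 0 j + t * phi x 0 j).
  by apply: measurable_funD => //; exact: measurable_funM.
have ce x j : sphere_proj (u x + t *: phi x) 0 j =
    (Num.sqrt (\sum_i (u x 0 i + t * phi x 0 i) ^+ 2))^-1 * (u x 0 j + t * phi x 0 j).
  rewrite /sphere_proj /enorm !mxE; congr (_^-1 * _).
  by congr Num.sqrt; apply: eq_bigr => i _; rewrite !mxE.
have mc j : mble (fun x => sphere_proj (u x + t *: phi x) 0 j).
  rewrite (_ : (fun x => _) = fun x => (Num.sqrt (\sum_i (u x 0 i + t * phi x 0 i) ^+ 2))^-1 *
    (u x 0 j + t * phi x 0 j)); last by apply/funext => x; exact: ce.
  apply: measurable_funM => //; apply: (measurableT_comp mble_inv); apply: mble_sqrt.
  by apply: measurable_sum => i; exact: measurable_funX.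
have le j : lap14 (fun x => sphere_proj (u x + t *: phi x) 0 j) =
    lap14 (sproj a (fun j x => phi x 0 j) j t).
  apply: lap14_ae => //; apply: ae_imp ae => x hx; rewrite ce /sproj /len.
  by rewrite hx; congr (_^-1 * _); congr Num.sqrt; apply: eq_bigr => i _; rewrite hx.
rewrite /energy -Int_sum//; congr Rintegral; apply/funext => x.
by rewrite sqr_enorm; apply: eq_bigr => j _; rewrite /vlap14 mxE le.
Qed.

Lemma rebase (E E0 G l K B t : R) : `|E0 - G - 0 * l| <= K * 0 ^+ 2 ->
  `|E - G - t * l| <= B -> `|E - E0 - t * l| <= B.
Proof.
by rewrite mul0r subr0 expr0n /= mulr0 normr_le0 subr_eq0 => /eqP ->.
Qed.

Lemma energy_derivative u a (phi : R -> 'rV[R]_m) : sphere_version u a ->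
  (forall j, test_fun (fun x => phi x 0 j)) ->
  is_derive (0 : R) (1 : R) (fun t : R => energy (fun x => sphere_proj (u x + t *: phi x)))
    (2 * cB * first_var a (fun j x => phi x 0 j)).
Proof.
move=> sv tp; have [ba ua la _ _] := sv.
have [t0 [K [t00 hK]]] := energy_variation ba ua tp la.
have E0 : `|0 : R| <= t0 by rewrite normr0 ltW.
have Et t : `|t| <= t0 -> energy (fun x => sphere_proj (u x + t *: phi x)) =
    \sum_j \int[mu]_x (lap14 (sproj a (fun j x => phi x 0 j) j t) x ^+ 2).
  by move=> /hK [h1 h2 _]; exact: energy_proj.
apply: (@is_derive_quadratic _ _ _ K t0) => // t ht.
have [_ _ h0] := hK 0 E0; have [_ _ h] := hK t ht.
rewrite (Et t ht) (Et 0 E0).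
exact: rebase h0 h.
Qed.

Lemma harmonic_critical u a : Hdot12_sphere u -> sphere_version u a ->
  weak_half_harmonic u <-> critical a.
Proof.
move=> hu sv; split=> [[_ wh] phi tp|cr].
  pose Phi x : 'rV[R]_m := \row_j phi j x.
  have eP j : (fun x => Phi x 0 j) = phi j by apply/funext => x; rewrite mxE.
  have tP j : test_fun (fun x => Phi x 0 j) by rewrite eP.
  have d1 := wh Phi tP; have d2 := energy_derivative sv tP.
  have : 2 * cB * first_var a (fun j x => Phi x 0 j) = 0.
    by rewrite -(@derive_val _ _ _ _ _ _ _ d2) (@derive_val _ _ _ _ _ _ _ d1).
  rewrite (_ : (fun j x => Phi x 0 j) = phi); last by apply/funext => j; exact: eP.
  move=> /eqP; rewrite mulf_eq0 => /orP[|/eqP//].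
  by rewrite mulf_eq0 pnatr_eq0 /= gt_eqF// cB_gt0.
split=> // phi tp; have d := energy_derivative sv tp.
by apply: (is_derive_eq d); rewrite cr// mulr0.
Qed.

Lemma sum_delta (F : 'I_m -> R) b : \sum_j F j * (j == b)%:R = F b.
Proof.
rewrite (bigD1 b)//= eqxx mulr1 big1 ?addr0// => j /negbTE ->.
by rewrite mulr0.
Qed.

Lemma wedgeE v w i j : wedge v w i j = v 0 i * w 0 j - w 0 i * v 0 j.
Proof. by rewrite /wedge !mxE !big_ord1 !mxE. Qed.

Lemma wedge_mxE v k i j : wedge_mx v k (mxvec_index i j) =
  v 0 i * (k == j)%:R - (k == i)%:R * v 0 j.
Proof.
by rewrite /wedge_mx mxE mxvecE wedgeE !mxE !eqxx /= ![k == _]eq_sym.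
Qed.

Lemma mul_wedge_mx v w i j : (w *m wedge_mx v) 0 (mxvec_index i j) =
  mxvec (wedge v w) 0 (mxvec_index i j).
Proof.
rewrite mxvecE wedgeE mxE.
transitivity (\sum_k (v 0 i * w 0 k) * (k == j)%:R - \sum_k (w 0 k * v 0 j) * (k == i)%:R).
  by rewrite -sumrB; apply: eq_bigr => k _; rewrite wedge_mxE; ring.
by rewrite (sum_delta (fun k => v 0 i * w 0 k)) (sum_delta (fun k => w 0 k * v 0 j)).
Qed.

Lemma ae_ord (P : 'I_m -> R -> Prop) : (forall j, {ae mu, forall x, P j x}) ->
  {ae mu, forall x, forall j, P j x}.
Proof.
move=> h; have : forall n, {ae mu, forall x, forall j : 'I_m, val j = n -> P j x}.
  move=> n; have [nm|nm] := ltnP n m.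
    apply: ae_imp (h (Ordinal nm)) => x hx j e.
    by rewrite (_ : j = Ordinal nm)//; exact: val_inj.
  apply: aeW => x j e; exfalso; have := ltn_ord j; rewrite -[nat_of_ord j]/(val j) e ltnNge nm//.
by move=> /ae_all; apply: ae_imp => x hx j; exact: (hx (val j)).
Qed.

(** The second term of [T]: only [k = i] and [k = j] contribute. *)
Lemma bracket_wedge u a (i j : 'I_m) psi : sphere_version u a -> test_fun psi ->
  \sum_k mul_distr (fun x => wedge_mx (u x) k (mxvec_index i j))
      (frac_lap (1 / 2) (regular_distr (fun x => u x 0 k))) psi =
  cB * (gag (a j) (fun x => a i x * psi x) - gag (a i) (fun x => a j x * psi x)).
Proof.
move=> [ba ua la mu_ ae] tp; have mp := test_mble tp.
have ep l : energy_class (fun x => a l x * psi x) by apply: energy_mul => //; exact: test_energy.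
have fp l : fingag (fun x => a l x * psi x) by case: (ep l).
have fa l : fingag (a l) by case: (ba l).
pose q k x := (k == j)%:R * (a i x * psi x) - (k == i)%:R * (a j x * psi x).
have eq_ k : energy_class (q k) by apply: energy_sub; exact: energy_scale.
have B k : mul_distr (fun x => wedge_mx (u x) k (mxvec_index i j))
      (frac_lap (1 / 2) (regular_distr (fun x => u x 0 k))) psi =
    cB * gag (a k) (q k).
  rewrite /mul_distr; apply: (@bracket_form _ _ _ (lap14 (fun x => u x 0 k))) => //.
  - by apply: ae_imp ae => x.
  - rewrite (_ : _ \* _ = fun x => (u x 0 i * (k == j)%:R - (k == i)%:R * u x 0 j) * psi x).
      apply: measurable_funM => //; apply: measurable_funB; exact: measurable_funM.
    by apply/funext => x /=; rewrite wedge_mxE.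
  - by apply: ae_imp ae => x hx /=; rewrite wedge_mxE /q !hx; ring.
transitivity (\sum_k (cB * gag (a k) (fun x => a i x * psi x) * (k == j)%:R -
    cB * gag (a k) (fun x => a j x * psi x) * (k == i)%:R)).
  apply: eq_bigr => k _; rewrite B /q gagB; [|by []|exact: fingagZ|exact: fingagZ].
  rewrite !gagZ//; set A := gag _ _; set B' := gag _ _.
  by move: (cB : R) A B' => c A B'; ring.
rewrite sumrB (sum_delta (fun k => cB * gag (a k) (fun x => a i x * psi x))).
by rewrite (sum_delta (fun k => cB * gag (a k) (fun x => a j x * psi x))) mulrBr.
Qed.

(** The third term of [T] vanishes, being the exterior square of a vector. *)
Lemma last_term u a (i j : 'I_m) psi : sphere_version u a -> test_fun psi ->
  regular_distr (fun x => (vlap14 u x *m mxlap14 (fun x => wedge_mx (u x)) x)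
    0 (mxvec_index i j)) psi = 0.
Proof.
move=> [ba ua la mu_ ae] tp; have mp := test_mble tp.
pose v j := lap14 (fun x => u x 0 j).
have mv j' : mble (v j') by case: ((L2_sqi _).1 (la j').1).
have ma j' : mble (a j') by case: (ba j').
have a1 := unit_le1 ua.
pose Q k x := wedge_mx (u x) k (mxvec_index i j).
pose q k x := (k == j)%:R * a i x + - (k == i)%:R * a j x.
have mQ k : mble (Q k).
  rewrite (_ : Q k = fun x => u x 0 i * (k == j)%:R - (k == i)%:R * u x 0 j).
    apply: measurable_funB; exact: measurable_funM.
  by apply/funext => x; rewrite /Q wedge_mxE.
have mq k : mble (q k) by apply: measurable_funD; exact: measurable_funM.
have lq k : is_lap14 (q k) (fun x => (k == j)%:R * v i x + - (k == i)%:R * v j x).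
  have b c l x : `|c * a l x| <= `|c| by rewrite normrM ler_piMr.
  apply: (is_lap14D _ (b _ i) _ (b _ j)).
  - exact: measurable_funM.
  - exact: measurable_funM.
  - exact: is_lap14Z (ma i) (a1 i) (la i).
  - exact: is_lap14Z (ma j) (a1 j) (la j).
have lQ k : is_lap14 (Q k) (fun x => (k == j)%:R * v i x + - (k == i)%:R * v j x).
  apply: is_lap14_ae (lq k) => //.
  by apply: ae_imp ae => x hx; rewrite /q /Q wedge_mxE !hx; ring.
have lL k := lap14_spec (lQ k).
have mL k : mble (lap14 (Q k)) by case: ((L2_sqi _).1 (lL k).1).
have aeL := ae_ord (fun k => lap14_unique (lL k) (lQ k)).
rewrite /regular_distr (_ : (fun x => _ * psi x) = fun x => (\sum_k v k x * lap14 (Q k) x) * psi x).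
  rewrite -[RHS](@Int0 _ RM R mu); apply: Int_ae => //.
    apply: measurable_funM => //; apply: measurable_sum => k; exact: measurable_funM.
  apply: ae_imp aeL => x hx.
  transitivity ((\sum_k (v k x * v i x) * (k == j)%:R - \sum_k (v k x * v j x) * (k == i)%:R) * psi x).
    by congr (_ * _); rewrite -sumrB; apply: eq_bigr => k _; rewrite hx; ring.
  by rewrite (sum_delta (fun k => v k x * v i x)) (sum_delta (fun k => v k x * v j x)); ring.
by apply/funext => x; rewrite mxE; congr (_ * _); apply: eq_bigr => k _; rewrite !mxE.
Qed.

Lemma equation_balanced u a : sphere_version u a ->
  (forall l : 'I_(m * m),
     distr_eq
       (frac_lap (1 / 4)
          (regular_distr (fun x => mxvec (wedge (u x) (vlap14 u x)) 0 l)))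
       (T_op (fun x => wedge_mx (u x)) u l)) <-> balanced a.
Proof.
move=> sv; have cp := @cB_gt0 R.
have key i j psi : test_fun psi ->
  (frac_lap (1 / 4) (regular_distr (fun x => mxvec (wedge (u x) (vlap14 u x)) 0 (mxvec_index i j))) psi
   = T_op (fun x => wedge_mx (u x)) u (mxvec_index i j) psi) <->
  gag (a j) (fun x => a i x * psi x) = gag (a i) (fun x => a j x * psi x).
  move=> tp; rewrite /T_op (bracket_wedge i j sv tp) (last_term i j sv tp) addr0.
  rewrite (_ : (fun x => (vlap14 u x *m wedge_mx (u x)) 0 (mxvec_index i j)) =
    (fun x => mxvec (wedge (u x) (vlap14 u x)) 0 (mxvec_index i j))); last first.
    by apply/funext => x; rewrite mul_wedge_mx.
  set X := frac_lap _ _ _; set A := gag _ _; set B := gag _ _.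
  split=> [/eqP|->]; last by rewrite subrr mulr0 subr0.
  rewrite eq_sym subr_eq addrC -subr_eq subrr eq_sym mulf_eq0 (gt_eqF cp) /= subr_eq0.
  by move/eqP.
split=> [h i j psi tp|bl l psi tp].
  by apply/key => //; exact: h.
by case/mxvec_indexP: l => i j; apply/key => //; exact: bl.
Qed.

End Harmonic.

Local Close Scope classical_set_scope.
Unset Implicit Arguments.

Theorem proposition1p1 (R : realType) (m : nat) (hm : (1 <= m)%N)
    (u : R -> 'rV[R]_m) (hu : Hdot12_sphere u) :
  weak_half_harmonic u <->
  (forall l : 'I_(m * m),
     distr_eq
       (frac_lap (1 / 4)
          (regular_distr (fun x => mxvec (wedge (u x) (vlap14 u x)) 0 l)))
       (T_op (fun x => wedge_mx (u x)) u l)).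
Proof.
have [a sv] := sphere_versionP hm hu; have [ba ua _ _ _] := sv.
rewrite (harmonic_critical hu sv) (equation_balanced sv).
exact: critical_balanced ba ua.
Qed.
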